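(* Let each of $S$ and $T$ be either a (not necessarily unital) $C^*$-algebra or a unital complete operator system. (a) For any $\phi\in\mathrm{CC}^+(S,T)$, there is a unique $\phi^{\mathrm d}\in\mathrm{CC}^+_w(T^{\mathrm d},S^{\mathrm d})$ satisfying $\phi^{\mathrm d}\circ\mu_{T^*}=\mu_{S^*}\circ\phi^*$. (b) The assignment $\phi\mapsto\phi^{\mathrm d}$ is a bijection from $\mathrm{CC}^+(S,T)$ onto $\mathrm{CC}^+_w(T^{\mathrm d},S^{\mathrm d})$. (c) There is a completely isometric MOS isomorphism from $S$ onto $T$ if and only if there is a weak-$*$-continuous completely isometric MOS isomorphism from $T^{\mathrm d}$ onto $S^{\mathrm d}$.
   Context: Matrices. For a complex vector space $X$ identify $M_n(X)\subseteq M_{n+1}(X)$ (upper left corner) and put $M_\infty(X)=\bigcup_n M_n(X)$. For linear $\varphi:X\to Y$, $\varphi^{(\infty)}([x_{i,j}])=[\varphi(x_{i,j})]$ on $M_\infty(X)$. An operator space is a complex vector space $X$ with a norm on $M_\infty(X)$ (a matrix norm) such that $\|\sum_k a_k^*x_kb_k\|\le\|\sum_k a_k^*a_k\|^{1/2}\|\sum_k b_k^*b_k\|^{1/2}\max_k\|x_k\|$ for all finite families $a_k,b_k\in M_\infty(\mathbb{C})$, $x_k\in M_\infty(X)$. A linear map $\varphi$ between operator spaces is a complete contraction / a complete isometry / a complete embedding if $\varphi^{(\infty)}$ is contractive / isometric / bounded and bounded below ($\inf_{\|x\|=1}\|\varphi^{(\infty)}(x)\|>0$). SMOS and MOS. A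 semi-matrix ordered operator space (SMOS) is an operator space $X$ with an involution $*$ such that $[x_{i,j}]\mapsto[x_{j,i}^*]$ is isometric on $M_\infty(X)$, and a norm-closed subset (matrix cone) $M_\infty(X)^+\subseteq M_\infty(X)^{\mathrm{sa}}:=\{x:x^*=x\}$ with $\sum_k a_k^*x_ka_k\in M_\infty(X)^+$ for all finite families $a_k\in M_\infty(\mathbb{C})$, $x_k\in M_\infty(X)^+$. It is a MOS if $M_\infty(X)^+\cap -M_\infty(X)^+=\{0\}$. For SMOSs, a $*$-preserving linear map $\varphi:X\to Y$ is completely positive if $\varphi^{(\infty)}(M_\infty(X)^+)\subseteq M_\infty(Y)^+$; completely order monomorphic if it is injective and, for $x\in M_\infty(X)^{\mathrm{sa}}$, $x\in M_\infty(X)^+\Leftrightarrow\varphi^{(\infty)}(x)\in M_\infty(Y)^+$; a MOS isomorphism if it is a bijective completely order monomorphic complete embedding. $\mathrm{CC}^+(X,Y)$ denotes the set of completely positive complete contractions. An operator system is a self-adjoint subspace of some $\mathcal{L}(\mathfrak{H})$ (bounded operators on a Hilbert space) with the induced matrix norm, involution and matrix cone; it is unital if it contains the identity, complete if it is norm-complete. A $C^*$-algebra is an operator system via any faithful representation. Duals. For $f=[f_{i,j}]\in M_\infty(X^* )$ let $\theta_f(x)=[f_{i,j}(x)]$ ($x\in X$). The dual space $X^*$ of a SMOS $X$ is always the SMOS with involution $f^*(x)=\overline{f(x^* )}$, i.e. $[f_{i,j}]^*=[(f_{j,i})^*]$, dual matrix norm $\|f\|=\sup\{\|\theta_f^{(\infty)}(x)\|:x\in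 M_\infty(X),\|x\|\le1\}$ and dual matrix cone $M_\infty(X^* )^+=\{f\in M_\infty(X^* )^{\mathrm{sa}}:\theta_f\text{ is completely positive}\}$. $\phi^*$ is the dual map of $\phi$. Dual objects. A SMOS (resp. MOS) $D$ is a dual SMOS (resp. dual MOS) if there is a $*$-invariant norm-closed subspace $D_\#\subseteq D^*$ (a predual) such that the canonical map $D\to(D_\#)^*$ is a surjective complete isometry, and $M_\infty(D)^+$ is closed under the weak-$*$ topology $\sigma(M_\infty(D),M_\infty(D_\#))$ (entrywise $\sigma(D,D_\#)$-convergence). For complete $X$, $X^*$ is a dual SMOS with predual $X$. A dual MOS $D$ is a dual operator system if there is a weak-$*$-homeomorphic completely isometric MOS isomorphism from $D$ onto a weak-$*$-closed (self-adjoint) subspace of some $\mathcal{L}(\mathfrak{H})$. For dual operator systems $D,E$, $\mathrm{CC}^+_w(D,E)$ is the set of weak-$*$-continuous completely positive complete contractions from $D$ to $E$. The map $\mu_D$. For a dual MOS $D$ with predual $D_\#$, let $\mathcal{WQ}^D_n$ be the set of $\sigma(D,D_\#)$-continuous maps in $\mathrm{CC}^+(D,M_n(\mathbb{C}))$, let $N(D)=\bigoplus^{\ell_\infty}_{n\in\mathbb{N}}\ell_\infty(\mathcal{WQ}^D_n;M_n(\mathbb{C}))$ (a von Neumann algebra), and let $\mu_D:D\to N(D)$ be $\mu_D(x)=(\mu_D(x)_n)_n$ with $\mu_D(x)_n(\varphi)=\varphi(x)$. For $S$ a $C^*$-algebra or a unital complete operator system, $S^*$ is a dual MOS with predual $S$,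 and $S^{\mathrm d}:=\mu_{S^*}(S^* )$ is a weak-$*$-closed subspace of $N(S^* )$, equipped with the dual operator system structure induced from $N(S^* )$; $\mu_{S^*}:S^*\to S^{\mathrm d}$ is a weak-$*$-homeomorphic MOS isomorphism. *)

(* Defs.v *)
From HB Require Import structures.
From mathcomp Require Import all_boot all_order all_algebra.
From mathcomp Require Import sesquilinear complex.
From mathcomp Require Import all_classical all_reals topology normedtype sequences.
From mathcomp Require Import ring lra.

Set Implicit Arguments.
Unset Strict Implicit.
Unset Printing Implicit Defensive.

Import Order.TTheory GRing.Theory Num.Theory Num.Def.
Import numFieldNormedType.Exports.

Local Open Scope classical_set_scope.
Local Open Scope ring_scope.

Local Notation Re := complex.Re.
Local Notation normc := Normc.normc.

Definition norm_complete (R : realType) (V : zmodType) (nrm : V -> R) : Prop :=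
  forall u : nat -> V,
    (forall e, 0 < e -> exists N : nat, forall m n : nat,
       (N <= m)%N -> (N <= n)%N -> nrm (u m - u n) < e) ->
    exists l : V, forall e, 0 < e -> exists N : nat, forall n : nat,
       (N <= n)%N -> nrm (u n - l) < e.

(* Inner products are linear in the first variable. *)
Record ipspace (R : realType) := IPSpace {
  ip_car :> lmodType R[i] ;
  ip : {dot ip_car for conjC} }.

Section InnerProduct.
Variables (R : realType) (H : ipspace R).
Implicit Types (u v : H).

Definition hnorm (v : H) : R := Num.sqrt (Re (ip H v v)).

Definition is_hilbert : Prop := norm_complete hnorm.

Lemma ipE u v : ip H u v = (ip H v u)^*.
Proof. by rewrite hermC /= expr0 mul1r. Qed.

Lemma ip_linl (a : R[i]) u v w : ip H (a *: u + v) w = a * ip H u w + ip H v w.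
Proof. by rewrite linearPl. Qed.

Lemma ip_linr (a : R[i]) u v w :
  ip H w (a *: u + v) = a^* * ip H w u + ip H w v.
Proof. by rewrite ipE ip_linl rmorphD rmorphM /= -!ipE. Qed.

Lemma ip0l v : ip H 0 v = 0.
Proof. by rewrite -[X in ip H X](addr0 0) -[X in X + _](scaler0 _ (-1)) ip_linl mulN1r addNr. Qed.

Lemma ip0r v : ip H v 0 = 0.
Proof. by rewrite ipE ip0l rmorph0. Qed.

Lemma ip_gt0 v : v != 0 -> 0 < ip H v v.
Proof. exact: neq0_dnorm_gt0. Qed.

Lemma ip_ge0 v : 0 <= ip H v v.
Proof. by have [->|/ip_gt0/ltW//] := eqVneq v 0; rewrite ip0l. Qed.

Lemma hnorm_ge0 v : 0 <= hnorm v. Proof. exact: sqrtr_ge0. Qed.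

Lemma sqr_hnorm v : hnorm v ^+ 2 = Re (ip H v v).
Proof. by rewrite sqr_sqrtr//; have := ip_ge0 v; rewrite lecE => /andP[]. Qed.

Lemma ip_hnorm v : ip H v v = Complex (hnorm v ^+ 2) 0.
Proof.
have := ip_ge0 v; rewrite sqr_hnorm lecE; case: (ip H v v) => a b /= /andP[/eqP-> _].
by [].
Qed.

Lemma hnorm_eq0 v : hnorm v = 0 -> v = 0.
Proof.
move=> v0; apply/eqP/negPn/negP => /ip_gt0.
by rewrite ip_hnorm v0 expr0n /= ltxx.
Qed.

Lemma hnorm0 : hnorm (0 : H) = 0. Proof. by rewrite /hnorm ip0l sqrtr0. Qed.

Lemma cauchy_schwarz u v : normc (ip H u v) <= hnorm u * hnorm v.
Proof.
have [->|v0] := eqVneq v 0.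
  by rewrite ip0r hnorm0 Normc.normc0 mulr0.
have b0 := ip_gt0 v0; set a := ip H u v; set b := ip H v v in b0.
have br : b^* = b by apply/CrealP/gtr0_real.
have := ip_ge0 (b *: u + (- a) *: v).
have -> : ip H (b *: u + - a *: v) (b *: u + - a *: v)
    = b * (b * ip H u u - a * a^*).
  rewrite ip_linl -[- a *: v]addr0 ip_linl !ip_linr !(ip0l, ip0r) !addr0.
  rewrite -/a -/b (ipE v u) -/a rmorphN /= br; ring.
rewrite pmulr_rge0// subr_ge0 /b !ip_hnorm; case: a => x y.
rewrite lecE /= => /andP[_ h]; rewrite -[leRHS]ger0_norm ?mulr_ge0 ?hnorm_ge0//.
rewrite -sqrtr_sqr ler_sqrt ?sqr_ge0//; nra.
Qed.

Lemma ipZ (a : R[i]) v : ip H (a *: v) (a *: v) = a * a^* * ip H v v.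
Proof.
rewrite -[X in ip H X _]addr0 -[X in ip H _ X]addr0 ip_linl ip_linr.
by rewrite !(ip0l, ip0r) !addr0 mulrA.
Qed.

Lemma hnormZ (a : R[i]) v : hnorm (a *: v) = normc a * hnorm v.
Proof.
rewrite {1}/hnorm ipZ ip_hnorm; case: a => x y /=.
rewrite -[hnorm v in RHS]ger0_norm ?hnorm_ge0// -sqrtr_sqr -sqrtrM ?addr_ge0 ?sqr_ge0//.
by congr Num.sqrt; ring.
Qed.

Lemma ipDl u v w : ip H (u + v) w = ip H u w + ip H v w.
Proof. by rewrite -[u in LHS]scale1r ip_linl mul1r. Qed.

Lemma ipDr u v w : ip H w (u + v) = ip H w u + ip H w v.
Proof. by rewrite ipE ipDl rmorphD /= -!ipE. Qed.

Lemma ipD u v : ip H (u + v) (u + v) =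
  ip H u u + (ip H u v + (ip H u v)^*) + ip H v v.
Proof. by rewrite ipDl !ipDr (ipE v u) !addrA. Qed.

Lemma Re_le_normc (z : R[i]) : Re z <= normc z.
Proof.
case: z => x y /=; apply: le_trans (ler_norm _) _.
by rewrite -sqrtr_sqr ler_sqrt ?addr_ge0 ?sqr_ge0// lerDl sqr_ge0.
Qed.

Lemma ipZr (a : R[i]) v w : ip H w (a *: v) = a^* * ip H w v.
Proof. by rewrite -[_ *: _]addr0 ip_linr ip0r addr0. Qed.

Lemma ip_suml n (f : 'I_n -> H) w : ip H (\sum_i f i) w = \sum_i ip H (f i) w.
Proof. exact: (big_morph (fun v => ip H v w) (fun u v => ipDl u v w) (ip0l w)). Qed.

Lemma ip_sumr n (f : 'I_n -> H) w : ip H w (\sum_i f i) = \sum_i ip H w (f i).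
Proof. exact: (big_morph (ip H w) (fun u v => ipDr u v w) (ip0r w)). Qed.

Lemma ip_injr u v : (forall w, ip H w u = ip H w v) -> u = v.
Proof.
move=> uv; apply/eqP; rewrite -subr_eq0; apply/negPn/negP => /ip_gt0.
rewrite ipDr -scaleN1r ipZr uv rmorphN1 mulN1r subrr ltxx.
by [].
Qed.

Lemma hnormD u v : hnorm (u + v) <= hnorm u + hnorm v.
Proof.
rewrite -[leRHS]ger0_norm ?addr_ge0 ?hnorm_ge0// -sqrtr_sqr ler_sqrt ?sqr_ge0//.
have := le_trans (Re_le_normc _) (cauchy_schwarz u v).
rewrite ipD !ip_hnorm; case: (ip H u v) => x y /= h; nra.
Qed.

Lemma hnorm_sum n (f : 'I_n -> H) : hnorm (\sum_i f i) <= \sum_i hnorm (f i).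
Proof.
elim/big_ind2: _ => [|a x b y ax by_|//]; first by rewrite hnorm0.
by apply: le_trans (hnormD _ _) _; exact: lerD.
Qed.

End InnerProduct.

Section OperatorNorm.
Variables (R : realType) (H : ipspace R).
Implicit Types (T : H -> H) (v w : H).

Definition bounded_op T : Prop :=
  linear T /\ exists M : R, forall v, hnorm (T v) <= M * hnorm v.

Definition opnorm T : R := sup [set hnorm (T v) | v in [set v | hnorm v <= 1]].

Lemma opnorm_has_sup T :
  bounded_op T -> has_sup [set hnorm (T v) | v in [set v | hnorm v <= 1]].
Proof.
move=> [_ [M TM]]; split; first by exists (hnorm (T 0)), 0; rewrite //= hnorm0.
exists `|M| => _ [v /= v1 <-]; apply: le_trans (TM v) _.
apply: le_trans (_ : `|M| * hnorm v <= _).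
  by rewrite ler_wpM2r ?hnorm_ge0 ?ler_norm.
by rewrite ler_piMr.
Qed.

Lemma opnorm_ge0 T : bounded_op T -> 0 <= opnorm T.
Proof.
move=> bT; apply: le_trans (hnorm_ge0 (T 0)) _.
by apply: (sup_upper_bound (opnorm_has_sup bT)); exists 0 => //=; rewrite hnorm0.
Qed.

Lemma opnormP T v : bounded_op T -> hnorm (T v) <= opnorm T * hnorm v.
Proof.
move=> bT; have lT := bT.1.
have T0 : T 0 = 0.
  by have := lT (-1) 0 0; rewrite scaler0 addr0 scaleN1r addNr.
have TZ a : T (a *: v) = a *: T v by have := lT a v 0; rewrite T0 !addr0.
have [->|v0] := eqVneq v 0; first by rewrite T0 hnorm0 mulr0.
have n0 : 0 < hnorm v.
  by rewrite lt_neqAle hnorm_ge0 andbT eq_sym; apply: contra v0 => /eqP/hnorm_eq0 ->.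
pose a : R[i] := Complex (hnorm v)^-1 0.
have na : normc a = (hnorm v)^-1.
  by rewrite /= expr0n addr0 sqrtr_sqr ger0_norm// invr_ge0 ltW.
rewrite -ler_pdivrMr// mulrC -na -hnormZ -TZ.
apply: (sup_upper_bound (opnorm_has_sup bT)); exists (a *: v) => //=.
by rewrite hnormZ na mulVf ?gt_eqF.
Qed.

Lemma opnorm_le T (M : R) :
  0 <= M -> (forall v, hnorm (T v) <= M * hnorm v) -> opnorm T <= M.
Proof.
move=> M0 TM; apply: ge_sup; first by exists (hnorm (T 0)), 0; rewrite //= hnorm0.
by move=> _ [v /= v1 <-]; apply: le_trans (TM v) _; rewrite ler_piMr.
Qed.

Definition adjoint_ops T T' : Prop := forall v w, ip H (T v) w = ip H v (T' w).

Lemma adjoint_opsC T T' : adjoint_ops T T' -> adjoint_ops T' T.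
Proof. by move=> TT' v w; rewrite ipE -TT' -ipE. Qed.

Lemma opnorm_adjoint T T' :
  bounded_op T -> bounded_op T' -> adjoint_ops T T' -> opnorm T' = opnorm T.
Proof.
wlog suff le : T T' / bounded_op T -> bounded_op T' -> adjoint_ops T T' -> opnorm T' <= opnorm T.
  by move=> bT bT' TT'; apply/le_anti; rewrite !le// ; exact: adjoint_opsC.
move=> bT bT' TT'; apply: opnorm_le => [|w]; first exact: opnorm_ge0.
have [->|w0] := eqVneq (hnorm (T' w)) 0; first by rewrite mulr_ge0 ?opnorm_ge0 ?hnorm_ge0.
rewrite -(@ler_pM2r _ (hnorm (T' w))) ?lt_neqAle 1?eq_sym ?w0 ?hnorm_ge0//.
rewrite -expr2 sqr_hnorm -TT'; apply: le_trans (Re_le_normc _) _.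
apply: le_trans (cauchy_schwarz _ _) _; rewrite mulrAC ler_wpM2r ?hnorm_ge0//.
exact: opnormP.
Qed.

End OperatorNorm.

Section DirectSum.
Variables (R : realType) (H : ipspace R) (n : nat).
Implicit Types (u v w : 'I_n -> H).

Definition dsum_ip u v : R[i] := \sum_(i < n) ip H (u i) (v i).

Lemma dsum_ip_bilinear : bilinear_for
  (GRing.Scale.Law.clone _ _ ( *%R ) _)
  (GRing.Scale.Law.clone _ _ (conjC \; *%R) _) dsum_ip.
Proof.
split=> w a u v; rewrite /dsum_ip /= mulr_sumr -big_split; apply: eq_bigr => i _ /=.
  by rewrite -ip_linl.
by rewrite -ip_linr.
Qed.

HB.instance Definition _ :=
  bilinear_isBilinear.Build R[i] _ _ _ _ _ dsum_ip dsum_ip_bilinear.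

Lemma dsum_ip_hermitian u v : dsum_ip u v = (-1) ^+ false * (dsum_ip v u)^*.
Proof.
by rewrite expr0 mul1r rmorph_sum; apply: eq_bigr => i _ /=; rewrite ipE.
Qed.

HB.instance Definition _ :=
  isHermitianSesquilinear.Build R[i] _ _ _ dsum_ip dsum_ip_hermitian.

Lemma dsum_ip_gt0 u : u != 0 -> 0 < dsum_ip u u.
Proof.
move=> u0; rewrite lt_neqAle sumr_ge0 ?andbT => [|i _]; last exact: ip_ge0.
apply: contra u0 => /eqP/esym/eqP.
rewrite psumr_eq0 => [/allP u0|i _]; last exact: ip_ge0.
apply/eqP/funext => i; have := u0 i (mem_index_enum _).
by rewrite /= => ui0; apply: contraTeq ui0 => /ip_gt0; rewrite lt0r => /andP[].
Qed.

HB.instance Definition _ := isDotProduct.Build R[i] _ dsum_ip dsum_ip_gt0.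

Definition dsum : ipspace R := IPSpace (dsum_ip : {dot ('I_n -> H) for conjC}).

End DirectSum.

Section ScalarSpace.
Variable R : realType.
Implicit Types (a b : R[i]^o).

Definition scalar_ip a b : R[i] := a * b^*.

Lemma scalar_ip_bilinear : bilinear_for
  (GRing.Scale.Law.clone _ _ ( *%R ) _)
  (GRing.Scale.Law.clone _ _ (conjC \; *%R) _) scalar_ip.
Proof.
split=> c a u v; rewrite /scalar_ip /= ?rmorphD ?rmorphM /=.
  by rewrite mulrDl mulrA.
by rewrite mulrDr mulrCA.
Qed.

HB.instance Definition _ :=
  bilinear_isBilinear.Build R[i] _ _ _ _ _ scalar_ip scalar_ip_bilinear.

Lemma scalar_ip_hermitian a b : scalar_ip a b = (-1) ^+ false * (scalar_ip b a)^*.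
Proof. by rewrite expr0 mul1r rmorphM /= conjCK mulrC. Qed.

HB.instance Definition _ :=
  isHermitianSesquilinear.Build R[i] _ _ _ scalar_ip scalar_ip_hermitian.

Lemma scalar_ip_gt0 a : a != 0 -> 0 < scalar_ip a a.
Proof. by move=> a0; rewrite /scalar_ip -normCK exprn_gt0// normr_gt0. Qed.

HB.instance Definition _ := isDotProduct.Build R[i] _ scalar_ip scalar_ip_gt0.

Definition scalar_space : ipspace R := IPSpace (scalar_ip : {dot R[i]^o for conjC}).

End ScalarSpace.

(* The data of a semi-matrix ordered operator space.  A function on M_oo(X), the
   union of the M_n(X), is given by its restrictions to the M_n(X).  Of the axioms
   on the norm, the cone and the involution, only those needed to form duals are
   recorded; the others (triangle inequality, Ruan's inequality, closedness and
   stability of the cone) are properties of the spaces of operators, duals,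
   l_infty-sums and subspaces built below. *)

Record smos_data (R : realType) := SmosData {
  sm_car :> lmodType R[i] ;
  mnorm : forall n, 'M[sm_car]_n -> R ;
  star : sm_car -> sm_car ;
  mcone : forall n, set 'M[sm_car]_n ;
  star_antilinear : forall (a : R[i]) x y,
    star (a *: x + y) = a^* *: star x + star y ;
  starK : involutive star ;
  mnorm_star : forall n (x : 'M[sm_car]_n), mnorm (map_mx star x)^T = mnorm x }.

Arguments mnorm {R X n} x : rename.
Arguments star {R X} x : rename.
Arguments mcone {R} X n : rename.

Definition nrm (R : realType) (X : smos_data R) (x : X) : R :=
  mnorm (const_mx x : 'M[X]_1).

Definition selfadjoint (R : realType) (X : smos_data R) n (x : 'M[X]_n) : Prop :=
  (map_mx star x)^T = x.

Section Maps.
Variables (R : realType) (X Y : smos_data R) (phi : X -> Y).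

Definition star_preserving : Prop := forall x, phi (star x) = star (phi x).

Definition ccontractive : Prop :=
  forall n (x : 'M[X]_n), mnorm (map_mx phi x) <= mnorm x.

Definition cisometric : Prop :=
  forall n (x : 'M[X]_n), mnorm (map_mx phi x) = mnorm x.

Definition cembedding : Prop :=
  (exists M : R, forall n (x : 'M[X]_n), mnorm (map_mx phi x) <= M * mnorm x) /\
  (exists2 c : R, 0 < c & forall n (x : 'M[X]_n),
     mnorm x = 1 -> c <= mnorm (map_mx phi x)).

Definition cpositive : Prop :=
  star_preserving /\ forall n (x : 'M[X]_n), mcone X n x -> mcone Y n (map_mx phi x).

Definition corder_mono : Prop :=
  [/\ star_preserving, injective phi &
    forall n (x : 'M[X]_n), selfadjoint x ->
      (mcone X n x <-> mcone Y n (map_mx phi x))].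

Definition mos_iso : Prop :=
  [/\ linear phi, bijective phi, corder_mono & cembedding].

End Maps.

Arguments cisometric {R} X Y phi.
Arguments mos_iso {R} X Y phi.

Definition CCp (R : realType) (X Y : smos_data R) : set (X -> Y) :=
  [set phi | [/\ linear phi, cpositive phi & ccontractive phi]].

Arguments CCp {R} X Y.

(* A self-adjoint space of bounded operators on os_H, the inclusion being os_op. *)
Record opspace (R : realType) := OpSpace {
  os_car :> lmodType R[i] ;
  os_H : ipspace R ;
  os_op : os_car -> os_H -> os_H ;
  os_star : os_car -> os_car ;
  os_opP : forall (a : R[i]) x y v, os_op (a *: x + y) v = a *: os_op x v + os_op y v ;
  os_bounded : forall x, bounded_op (os_op x) ;
  os_inj : forall x y, os_op x =1 os_op y -> x = y ;
  os_adjoint : forall x, adjoint_ops (os_op x) (os_op (os_star x)) }.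

Section Amplification.
Variables (R : realType) (V : Type) (H : ipspace R) (op : V -> H -> H).

Definition amp n (x : 'M[V]_n) : dsum H n -> dsum H n :=
  fun v i => \sum_(j < n) op (x i j) (v j).

Lemma hnorm_coord n (v : dsum H n) i : hnorm (v i) <= hnorm v.
Proof.
rewrite /hnorm ler_sqrt; last by have := ip_ge0 v; rewrite lecE => /andP[].
rewrite [ip _ v v](bigD1 i)//= raddfD /= lerDl.
by have : 0 <= \sum_(j < n | j != i) ip H (v j) (v j);
  [apply: sumr_ge0 => j _; exact: ip_ge0|rewrite lecE => /andP[]].
Qed.

Lemma hnorm_dsum n (v : dsum H n) : hnorm v <= \sum_i hnorm (v i).
Proof.
rewrite -[leRHS]ger0_norm ?sumr_ge0// => [|i _]; last exact: hnorm_ge0.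
rewrite -sqrtr_sqr ler_sqrt ?sqr_ge0//.
have -> : Re (ip (dsum H n) v v) = \sum_i hnorm (v i) ^+ 2.
  by rewrite /= /dsum_ip raddf_sum; apply: eq_bigr => i _; rewrite sqr_hnorm.
have : 0 <= \sum_i hnorm (v i) /\ \sum_i hnorm (v i) ^+ 2 <= (\sum_i hnorm (v i)) ^+ 2.
  apply: (big_ind2 (fun x y => 0 <= y /\ x <= y ^+ 2)) => [|x y a b [y0 xy] [b0 ab]|i _].
  - by rewrite expr0n.
  - by split; [exact: addr_ge0|nra].
  - by split; first exact: hnorm_ge0.
by case.
Qed.

Lemma amp_bounded n (x : 'M[V]_n) :
  (forall y, bounded_op (op y)) -> bounded_op (amp x).
Proof.
move=> bop; split=> [a v w|].
  apply/funext => i.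
  rewrite -[RHS]/(a *: (\sum_j op (x i j) (v j)) + \sum_j op (x i j) (w j)).
  rewrite scaler_sumr -big_split.
  by apply: eq_bigr => j _ /=; rewrite (bop _).1.
exists (\sum_i \sum_j opnorm (op (x i j))) => v.
apply: le_trans (hnorm_dsum _) _; rewrite mulr_suml; apply: ler_sum => i _.
rewrite mulr_suml; apply: le_trans (hnorm_sum _) _.
apply: ler_sum => j _; apply: le_trans (opnormP _ (bop _)) _.
by rewrite ler_wpM2l ?opnorm_ge0 ?hnorm_coord.
Qed.

End Amplification.

Section OpspaceTheory.
Variables (R : realType) (X : opspace R).

Lemma os_starP (a : R[i]) (x y : X) :
  os_star (a *: x + y) = a^* *: os_star x + os_star y.
Proof.
apply: os_inj => w; apply: ip_injr => v; rewrite -os_adjoint !os_opP.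
by rewrite ip_linl ipDr ipZr conjCK !os_adjoint.
Qed.

Lemma os_starK : involutive (@os_star R X).
Proof.
move=> x; apply: os_inj => w; apply: ip_injr => v.
rewrite -(os_adjoint (os_star x) v w).
exact: (adjoint_opsC (os_adjoint x)).
Qed.

Lemma amp_adjoint n (x : 'M[X]_n) :
  adjoint_ops (amp (@os_op R X) x) (amp (@os_op R X) (map_mx (@os_star R X) x)^T).
Proof.
move=> v w; rewrite /= /dsum_ip /amp.
under eq_bigr do rewrite ip_suml; rewrite exchange_big /=; apply: eq_bigr => j _.
by rewrite ip_sumr; apply: eq_bigr => i _; rewrite !mxE os_adjoint.
Qed.

Lemma opnorm_amp_star n (x : 'M[X]_n) :
  opnorm (amp (@os_op R X) (map_mx (@os_star R X) x)^T) = opnorm (amp (@os_op R X) x).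
Proof.
by apply: opnorm_adjoint; [apply: amp_bounded; exact: os_bounded..|exact: amp_adjoint].
Qed.

End OpspaceTheory.

(* The structure induced from the bounded operators on H: an n x n matrix acts
   on the n-fold direct sum of H. *)
Definition smos_of_opspace (R : realType) (X : opspace R) : smos_data R :=
  @SmosData R X
    (fun n x => opnorm (amp (@os_op R X) x))
    (@os_star R X)
    (fun n => [set x | (map_mx (@os_star R X) x)^T = x /\
       forall v, 0 <= ip (dsum (os_H X) n) (amp (@os_op R X) x v) v])
    (@os_starP R X) (@os_starK R X) (@opnorm_amp_star R X).

Coercion smos_of_opspace : opspace >-> smos_data.

Section MatrixAlgebra.
Variables (R : realType) (n : nat).

Definition mx_op (A : 'M[R[i]]_n) : dsum (scalar_space R) n -> dsum (scalar_space R) n :=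
  fun v i => \sum_(j < n) A i j * v j.

Definition mx_star (A : 'M[R[i]]_n) : 'M[R[i]]_n := (map_mx conjC A)^T.

Lemma mx_opP (a : R[i]) (A B : 'M[R[i]]_n) v :
  mx_op (a *: A + B) v = a *: mx_op A v + mx_op B v.
Proof.
apply/funext => i.
rewrite -[RHS]/(a * (\sum_j A i j * v j) + \sum_j B i j * v j) mulr_sumr -big_split.
by apply: eq_bigr => j _ /=; rewrite !mxE mulrDl -mulrA.
Qed.

Lemma mx_op_bounded A : bounded_op (mx_op A).
Proof.
apply: (@amp_bounded R R[i] (scalar_space R) (fun a b => a * b)) => a.
split=> [c u v|]; first by rewrite /= mulrDr mulrCA.
exists (normc a) => v; rewrite -hnormZ; exact: lexx.
Qed.

Lemma mx_op_inj A B : mx_op A =1 mx_op B -> A = B.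
Proof.
move=> AB; apply/matrixP => i j.
have /(congr1 (fun v => v i)) := AB (fun k => (k == j)%:R).
rewrite /mx_op (bigD1 j)//= eqxx mulr1 big1 ?addr0 => [->|k /negPf->]; last by rewrite mulr0.
by rewrite (bigD1 j)//= eqxx mulr1 big1 ?addr0 => [//|k /negPf->]; rewrite mulr0.
Qed.

Lemma mx_op_adjoint A : adjoint_ops (mx_op A) (mx_op (mx_star A)).
Proof.
move=> v w; rewrite /= /dsum_ip /mx_op /= /scalar_ip.
under eq_bigr do rewrite mulr_suml; rewrite exchange_big /=; apply: eq_bigr => j _.
rewrite rmorph_sum mulr_sumr; apply: eq_bigr => i _.
by rewrite !mxE rmorphM /= conjCK; ring.
Qed.

Definition mx_opspace : opspace R :=
  OpSpace mx_opP mx_op_bounded mx_op_inj mx_op_adjoint.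

End MatrixAlgebra.

Definition Mn (R : realType) (n : nat) : smos_data R := smos_of_opspace (mx_opspace R n).

Lemma opspace_nrm_le (R : realType) (X : opspace R) (a : R[i]) (x y : X) :
  nrm (a *: x + y : smos_of_opspace X) <=
  normc a * nrm (x : smos_of_opspace X) + nrm (y : smos_of_opspace X).
Proof.
have bd z : bounded_op (amp (@os_op R X) (const_mx z : 'M_1)).
  by apply: amp_bounded; exact: os_bounded.
apply: opnorm_le => [|v].
  by rewrite addr_ge0 ?mulr_ge0 ?opnorm_ge0//; case: a => ? ?; exact: sqrtr_ge0.
have -> : amp (@os_op R X) (const_mx (a *: x + y)) v =
    a *: amp (@os_op R X) (const_mx x : 'M_1) v + amp (@os_op R X) (const_mx y : 'M_1) v.
  apply/funext => i.
  rewrite -[RHS]/(a *: (\sum_j os_op ((const_mx x : 'M_1) i j) (v j)) +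
                  \sum_j os_op ((const_mx y : 'M_1) i j) (v j)).
  by rewrite scaler_sumr -big_split; apply: eq_bigr => j _ /=; rewrite !mxE os_opP.
apply: le_trans (hnormD _ _) _; rewrite hnormZ mulrDl -mulrA lerD ?opnormP//.
by rewrite ler_wpM2l ?opnormP//; case: (a) => ? ?; exact: sqrtr_ge0.
Qed.

Section SmosTheory.
Variables (R : realType) (X : smos_data R).

Lemma nrm_star (x : X) : nrm (star x) = nrm x.
Proof. by rewrite /nrm -[RHS]mnorm_star map_const_mx trmx_const. Qed.

End SmosTheory.

Section Dual.
Variables (R : realType) (X : smos_data R).

Definition functional : {pred X -> R[i]^o} := fun f =>
  `[< linear f /\ exists2 M : R, 0 <= M & forall x, normc (f x) <= M * nrm x >].

Lemma functional_submod : submod_closed functional.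
Proof.
split=> [|a f g /asboolP[lf [M M0 fM]] /asboolP[lg [N N0 gN]]]; apply/asboolP; split.
- by move=> a x y; rewrite /= scaler0 addr0.
- by exists 0 => // x; rewrite mul0r Normc.normc0.
- move=> c x y; rewrite -[LHS]/(a * f (c *: x + y) + g (c *: x + y)) lf lg.
  rewrite -[RHS]/(c * (a * f x + g x) + (a * f y + g y)) /GRing.scale /=; ring.
- exists (normc a * M + N) => [|x];
    first by rewrite addr_ge0 ?mulr_ge0//; case: (a) => ? ?; exact: sqrtr_ge0.
  rewrite -[X in normc X]/(a * f x + g x).
  apply: le_trans (le_normcD _ _) _; rewrite Normc.normcM mulrDl -mulrA lerD//.
  by rewrite ler_wpM2l//; case: (a) => ? ?; exact: sqrtr_ge0.
Qed.

HB.instance Definition _ :=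
  GRing.isSubmodClosed.Build R[i] (X -> R[i]^o) functional functional_submod.

Record dualT := DualT { dual_fun :> X -> R[i]^o ; _ : dual_fun \in functional }.

HB.instance Definition _ := [isSub for dual_fun].
HB.instance Definition _ := [Choice of dualT by <:].
HB.instance Definition _ :=
  GRing.SubChoice_isSubLmodule.Build R[i] (X -> R[i]^o) functional dualT functional_submod.

Lemma dual_star_subproof (f : dualT) : (fun x => (f (star x))^* : R[i]^o) \in functional.
Proof.
case: f => f /= /asboolP[lf [M M0 fM]]; apply/asboolP; split=> [a x y|].
  by rewrite star_antilinear lf rmorphD rmorphM /= conjCK.
by exists M => // x; rewrite -(nrm_star x); apply: le_trans (fM _); case: (f _) => a b /=; rewrite sqrrN.
Qed.

Definition dual_star (f : dualT) : dualT := DualT (dual_star_subproof f).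

Definition theta n (f : 'M[dualT]_n) (x : X) : Mn R n :=
  \matrix_(i, j) f i j x.

(* The set is bounded: a matrix of bounded functionals is completely bounded. *)
Definition dual_mnorm n (f : 'M[dualT]_n) : R :=
  sup [set r | exists (m : nat) (x : 'M[X]_m),
         mnorm x <= 1 /\ r = mnorm (map_mx (theta f) x)].

Definition dual_mcone n : set 'M[dualT]_n :=
  [set f | (map_mx dual_star f)^T = f /\ cpositive (theta f)].

Lemma dual_star_antilinear (a : R[i]) (f g : dualT) :
  dual_star (a *: f + g) = a^* *: dual_star f + dual_star g.
Proof.
apply/val_inj/funext => x /=.
rewrite -[LHS]/((a * f (star x) + g (star x))^*) rmorphD rmorphM /=.
by [].
Qed.

Lemma dual_starK : involutive dual_star.
Proof. by move=> f; apply/val_inj/funext => x /=; rewrite starK conjCK. Qed.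

Lemma dual_mnorm_star n (f : 'M[dualT]_n) :
  dual_mnorm (map_mx dual_star f)^T = dual_mnorm f.
Proof.
have sub (g : 'M[dualT]_n) r :
  (exists (m : nat) (x : 'M[X]_m),
     mnorm x <= 1 /\ r = mnorm (map_mx (theta (map_mx dual_star g)^T) x)) ->
  (exists (m : nat) (x : 'M[X]_m), mnorm x <= 1 /\ r = mnorm (map_mx (theta g) x)).
  move=> [m [x [x1 ->]]]; exists m, (map_mx star x)^T; rewrite mnorm_star; split=> //.
  rewrite -[RHS]mnorm_star; congr mnorm.
  by apply/matrixP => i j; apply/matrixP => k l; rewrite !mxE /=.
congr sup; apply/seteqP; split=> r; first exact: sub.
rewrite -{1}(_ : (map_mx dual_star (map_mx dual_star f)^T)^T = f); first exact: sub.
by apply/matrixP => i j; rewrite !mxE dual_starK.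
Qed.

Definition dual : smos_data R :=
  @SmosData R dualT dual_mnorm dual_star dual_mcone
    dual_star_antilinear dual_starK dual_mnorm_star.

End Dual.

Arguments functional {R} X _.

Section DualMap.
Variables (R : realType) (X Y : smos_data R) (phi : CCp X Y).

Lemma dual_map_subproof (f : dualT Y) : (fun x => f (val phi x)) \in functional X.
Proof.
have [lphi _ cphi] := set_valP phi.
case: f => f /= /asboolP[lf [M M0 fM]]; apply/asboolP; split=> [a x y|].
  by rewrite lphi lf.
exists M => // x; apply: le_trans (fM _) _.
by rewrite ler_wpM2l// /nrm -map_const_mx.
Qed.

Definition dual_map (f : dualT Y) : dualT X := DualT (dual_map_subproof f).

End DualMap.

(* D together with the functionals that make up its predual D_#. *)
Record wsmos_data (R : realType) := WSmosData {
  ws_smos :> smos_data R ;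
  predual : set (ws_smos -> R[i]) }.

Arguments predual {R} D : rename.

Definition wstar_top (R : realType) (D : wsmos_data R) : topologicalType :=
  initial_topology (fun (x : D) =>
    (fun f : predual D => val f x) : prod_topology (fun _ : predual D => R[i]^o)).

Definition wstar_continuous (R : realType) (D E : wsmos_data R) (psi : D -> E) : Prop :=
  continuous (psi : wstar_top D -> wstar_top E).

Arguments wstar_continuous {R} D E psi.

Definition CCw (R : realType) (D E : wsmos_data R) : set (D -> E) :=
  [set psi | CCp D E psi /\ wstar_continuous D E psi].

Arguments CCw {R} D E.

Definition dual_wsmos (R : realType) (X : smos_data R) : wsmos_data R :=
  @WSmosData R (dual X) [set (fun f : dualT X => f x) | x in setT].

Section MuMap.
Variables (R : realType) (D : wsmos_data R).

Definition WQ n : set (D -> Mn R n) :=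
  [set phi | CCp D (Mn R n) phi /\
     continuous (phi : wstar_top D -> 'M[R[i]^o]_n)].

Arguments WQ n : clear implicits.

Definition ND_index : Type := {n : nat & WQ n.+1}.

Definition ND_size (i : ND_index) : nat := (projT1 i).+1.

(* Elements of N(D), the l_infty-sum of the algebras M_n(C), n >= 1, over the maps
   in WQ n. *)
Record ND := MkND {
  ND_fun :> forall i : ND_index, Mn R (ND_size i) ;
  ND_bounded : exists M : R, forall i, nrm (ND_fun i) <= M }.

Lemma ND_eqP (x y : ND) : (forall i, x i = y i) -> x = y.
Proof.
case: x y => [x xb] [y yb] /= xy.
have {}xy : x = y by exact: functional_extensionality_dep.
by case: _ / xy yb => yb; congr MkND; exact: Prop_irrelevance.
Qed.

Lemma ND_scaleD_subproof (a : R[i]) (x y : ND) :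
  exists M : R, forall i, nrm (a *: x i + y i : Mn R (ND_size i)) <= M.
Proof.
have [M xM] := ND_bounded x; have [N yN] := ND_bounded y.
exists (normc a * M + N) => i; apply: le_trans (opspace_nrm_le a (x i) (y i)) _.
apply: lerD (yN i); apply: ler_wpM2l (xM i).
by case: (a) => ? ?; exact: sqrtr_ge0.
Qed.

Lemma ND_zero_subproof : exists M : R, forall i, nrm (0 : Mn R (ND_size i)) <= M.
Proof.
exists 0 => i; apply: opnorm_le => // v; rewrite mul0r (_ : amp _ _ _ = 0) ?hnorm0//.
by apply/funext => k; apply: big1 => j _; rewrite mxE; apply/funext => l;
  apply: big1 => m _; rewrite mxE mul0r.
Qed.

Definition ND_zero : ND := MkND ND_zero_subproof.
Definition ND_scaleD a (x y : ND) : ND := MkND (ND_scaleD_subproof a x y).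
Definition ND_add := ND_scaleD 1.
Definition ND_scale a x := ND_scaleD a x ND_zero.
Definition ND_opp := ND_scale (-1).

HB.instance Definition _ := gen_eqMixin ND.
HB.instance Definition _ := gen_choiceMixin ND.

Lemma ND_addA : associative ND_add.
Proof. by move=> x y z; apply: ND_eqP => i /=; rewrite !scale1r addrA. Qed.
Lemma ND_addC : commutative ND_add.
Proof. by move=> x y; apply: ND_eqP => i /=; rewrite !scale1r addrC. Qed.
Lemma ND_add0 : left_id ND_zero ND_add.
Proof. by move=> x; apply: ND_eqP => i /=; rewrite !scale1r add0r. Qed.
Lemma ND_addN : left_inverse ND_zero ND_opp ND_add.
Proof. by move=> x; apply: ND_eqP => i /=; rewrite addr0 scale1r scaleN1r addNr. Qed.

HB.instance Definition _ := GRing.isZmodule.Build ND ND_addA ND_addC ND_add0 ND_addN.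

Lemma ND_addE (x y : ND) i : (x + y) i = x i + y i.
Proof. by rewrite /= scale1r. Qed.
Lemma ND_scaleA a b x : ND_scale a (ND_scale b x) = ND_scale (a * b) x.
Proof. by apply: ND_eqP => i /=; rewrite !addr0 scalerA. Qed.
Lemma ND_scale1 : left_id 1 ND_scale.
Proof. by move=> x; apply: ND_eqP => i /=; rewrite addr0 scale1r. Qed.
Lemma ND_scaleDr : right_distributive ND_scale +%R.
Proof. by move=> a x y; apply: ND_eqP => i /=; rewrite !addr0 !scale1r scalerDr. Qed.
Lemma ND_scaleDl x : {morph ND_scale^~ x : a b / a + b}.
Proof. by move=> a b; apply: ND_eqP => i /=; rewrite !addr0 scale1r scalerDl. Qed.

HB.instance Definition _ := GRing.Zmodule_isLmodule.Build R[i] ND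
  ND_scaleA ND_scale1 ND_scaleDr ND_scaleDl.

Lemma ND_linE a (x y : ND) i : (a *: x + y) i = a *: x i + y i.
Proof. by rewrite /= scale1r addr0. Qed.

Lemma ND_star_subproof (x : ND) : exists M : R, forall i, nrm (star (x i)) <= M.
Proof. by have [M xM] := ND_bounded x; exists M => i; rewrite nrm_star. Qed.

Definition ND_star (x : ND) : ND := MkND (ND_star_subproof x).

Definition ND_coord i (x : ND) : Mn R (ND_size i) := x i.

Definition ND_mnorm m (x : 'M[ND]_m) : R :=
  sup [set r | exists i, r = mnorm (map_mx (ND_coord i) x)].

Definition ND_mcone m : set 'M[ND]_m :=
  [set x | forall i, mcone (Mn R (ND_size i)) m (map_mx (ND_coord i) x)].

Lemma ND_star_antilinear (a : R[i]) (x y : ND) :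
  ND_star (a *: x + y) = a^* *: ND_star x + ND_star y.
Proof. by apply: ND_eqP => i; rewrite ND_linE -star_antilinear -ND_linE. Qed.

Lemma ND_starK : involutive ND_star.
Proof. by move=> x; apply: ND_eqP => i; exact: starK. Qed.

Lemma ND_mnorm_star m (x : 'M[ND]_m) : ND_mnorm (map_mx ND_star x)^T = ND_mnorm x.
Proof.
have xE i : mnorm (map_mx (ND_coord i) (map_mx ND_star x)^T) = mnorm (map_mx (ND_coord i) x).
  by rewrite -[RHS]mnorm_star; congr mnorm; apply/matrixP => j k; rewrite !mxE.
by congr sup; apply/seteqP; split=> _ [i ->]; exists i; rewrite xE.
Qed.

Definition ND_smos : smos_data R :=
  @SmosData R ND ND_mnorm ND_star ND_mcone ND_star_antilinear ND_starK ND_mnorm_star.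

(* The normal functionals of the von Neumann algebra N(D), which acts on the
   Hilbert direct sum of the spaces C^n: sums of <x xi_k, eta_k> with xi and eta
   square-summable.  They are the predual that defines the weak-* topology. *)
Definition ND_normal : set (ND_smos -> R[i]) :=
  [set f | exists (i : nat -> ND_index)
      (xi eta : forall k, dsum (scalar_space R) (ND_size (i k))),
    [/\ cvgn (series (fun k => hnorm (xi k) ^+ 2)),
        cvgn (series (fun k => hnorm (eta k) ^+ 2)) &
        forall x : ND,
          (series (fun k => ip _ (mx_op (x (i k)) (xi k)) (eta k) : R[i]^o))
            @ \oo --> (f x : R[i]^o)]].

Lemma mu_subproof (x : D) :
  exists M : R, forall i : ND_index, nrm (val (projT2 i) x : Mn R (ND_size i)) <= M.
Proof.
exists (nrm x) => i; have [[_ _ /(_ 1%N (const_mx x)) h] _] := set_valP (projT2 i).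
by rewrite /nrm -map_const_mx.
Qed.

Definition mu (x : D) : ND := MkND (mu_subproof x).

Lemma mu_linear : linear mu.
Proof.
move=> a x y; apply: ND_eqP => i; rewrite ND_linE.
by have [[l _ _] _] := set_valP (projT2 i); exact: l.
Qed.

Lemma mu_star x : mu (star x) = ND_star (mu x).
Proof.
apply: ND_eqP => i; have [[_ [l _] _] _] := set_valP (projT2 i); exact: l.
Qed.

Definition mu_range : {pred ND} := fun y => `[< range mu y >].

Lemma mu_range_submod : submod_closed mu_range.
Proof.
split=> [|a x y /asboolP[u _ <-] /asboolP[v _ <-]]; apply/asboolP.
  by exists 0 => //; have := mu_linear (-1) 0 0; rewrite scaler0 addr0 scaleN1r addNr.
by exists (a *: u + v) => //; exact: mu_linear.
Qed.

HB.instance Definition _ :=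
  GRing.isSubmodClosed.Build R[i] ND mu_range mu_range_submod.

Record mu_image := MuImage { mu_image_val :> ND ; _ : mu_image_val \in mu_range }.

HB.instance Definition _ := [isSub for mu_image_val].
HB.instance Definition _ := [Choice of mu_image by <:].
HB.instance Definition _ :=
  GRing.SubChoice_isSubLmodule.Build R[i] ND mu_range mu_image mu_range_submod.

Lemma mu_image_star_subproof (y : mu_image) : ND_star y \in mu_range.
Proof.
by case: y => y /= /asboolP[x _ <-]; apply/asboolP; exists (star x) => //; exact: mu_star.
Qed.

Definition mu_image_star (y : mu_image) : mu_image := MuImage (mu_image_star_subproof y).

Lemma mu_image_star_antilinear (a : R[i]) (x y : mu_image) :
  mu_image_star (a *: x + y) = a^* *: mu_image_star x + mu_image_star y.
Proof. by apply: val_inj; exact: ND_star_antilinear. Qed.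

Lemma mu_image_starK : involutive mu_image_star.
Proof. by move=> y; apply: val_inj; exact: ND_starK. Qed.

Lemma mu_image_mnorm_star m (x : 'M[mu_image]_m) :
  ND_mnorm (map_mx mu_image_val (map_mx mu_image_star x)^T) =
  ND_mnorm (map_mx mu_image_val x).
Proof.
rewrite -[RHS]ND_mnorm_star; congr ND_mnorm.
by apply/matrixP => i j; rewrite !mxE.
Qed.

(* The range of mu with the structure induced from N(D); the restrictions of
   the normal functionals induce the relative weak-* topology. *)
Definition mu_image_wsmos : wsmos_data R :=
  @WSmosData R
    (@SmosData R mu_image
      (fun m x => ND_mnorm (map_mx mu_image_val x)) mu_image_star
      (fun m => [set x | ND_mcone (map_mx mu_image_val x)])
      mu_image_star_antilinear mu_image_starK mu_image_mnorm_star)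
    [set (fun y : mu_image => f (mu_image_val y)) | f in ND_normal].

Lemma mu_to_image_subproof x : mu x \in mu_range.
Proof. by apply/asboolP; exists x. Qed.

Definition mu_to_image (x : D) : mu_image := MuImage (mu_to_image_subproof x).

End MuMap.

Section DDual.
Variable R : realType.

(* S^d, with its weak-* topology, and mu_{S^*} : S^* -> S^d. *)
Definition ddual (S : smos_data R) : wsmos_data R := mu_image_wsmos (dual_wsmos S).

Definition mu_dual (S : smos_data R) (f : dualT S) : ddual S :=
  @mu_to_image R (dual_wsmos S) f.

(* phi^d o mu_{T^*} = mu_{S^*} o phi^* *)
Definition is_dmap (S T : smos_data R) (phi : CCp S T) (psi : CCw (ddual T) (ddual S)) : Prop :=
  forall f : dualT T, val psi (mu_dual f) = mu_dual (dual_map phi f).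

End DDual.

Record operator_system (R : realType) := OperatorSystem {
  opsys_space :> opspace R ;
  opsys_hilbert : is_hilbert (os_H opsys_space) }.

Section OperatorSystems.
Variables (R : realType) (S : operator_system R).

Definition complete_opsys : Prop :=
  norm_complete (fun x : S => nrm (x : smos_of_opspace S)).

Definition unital_opsys : Prop := exists e : S, forall v, os_op e v = v.

(* S is a C*-algebra for the product mul and the norm nm, and os_op is a faithful
   *-representation of it: os_op is injective (os_inj) and turns the involution
   into the adjoint (os_adjoint). *)
Record cstar_algebra_for (mul : S -> S -> S) (nm : S -> R) : Prop := {
  cs_mulPl : forall (a : R[i]) x y z, mul (a *: x + y) z = a *: mul x z + mul y z ;
  cs_mulPr : forall (a : R[i]) x y z, mul z (a *: x + y) = a *: mul z x + mul z y ;
  cs_mulA : associative mul ;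
  cs_starM : forall x y, os_star (mul x y) = mul (os_star y) (os_star x) ;
  cs_norm0 : forall x, nm x = 0 -> x = 0 ;
  cs_normZ : forall (a : R[i]) x, nm (a *: x) = normc a * nm x ;
  cs_normD : forall x y, nm (x + y) <= nm x + nm y ;
  cs_normM : forall x y, nm (mul x y) <= nm x * nm y ;
  cs_cstar : forall x, nm (mul (os_star x) x) = nm x ^+ 2 ;
  cs_complete : norm_complete nm ;
  cs_opM : forall x y v, os_op (mul x y) v = os_op x (os_op y v) }.

Definition cstar_algebra : Prop := exists mul nm, cstar_algebra_for mul nm.

End OperatorSystems.

(* Main.v *)
(* A weak-* continuous complete positive contraction from S^* to M_n is evaluation
   at a positive contraction of M_n(S), so phi^* composes with these maps and passes
   to the images of mu.  Conversely psi induces G : T^* -> S^* with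
   mu_S G = psi mu_T.  Every normal functional restricts on T^* to evaluation at a
   point of T, because it is a series of evaluations dominated in norm and T is
   complete; every element u x u, with u in an approximate unit of S, is a corner of
   the positive matrix [[u, u x u], [(u x u)^*, u]], so evaluation at it is normal on
   S^d.  Hence G is the transpose of a map phi : S -> T, and testing against vector
   functionals shows that phi is completely positive and that phi(u) <= 1; the same
   matrix then bounds phi(u x u) by 1.  An isomorphism psi gives a phi that is bounded
   below, and that has dense range by Hahn-Banach.

   For a C*-algebra, the approximate unit 1 - (1 - a)^m is taken with a proportional to
   the sum of x x^* + x^* x over finitely many x.  Completeness for the operator norm
   needs a faithful representation to be isometric; this uses square roots in the
   algebra of multipliers, built by an iteration that converges in norm. *)
From mathcomp Require Import all_boot all_order all_algebra.
From mathcomp Require Import complex.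
From mathcomp Require Import all_classical all_reals topology normedtype sequences.
From mathcomp Require Import ring lra.
Require Import Defs.
Set Implicit Arguments.
Unset Strict Implicit.
Unset Printing Implicit Defensive.

Import Order.TTheory GRing.Theory Num.Theory Num.Def.
Import numFieldNormedType.Exports.

Local Open Scope classical_set_scope.
Local Open Scope ring_scope.

(** The norm of S^d sees a functional only through positive contractions over S, so mu is bounded
    below but need not be isometric: on S = C + C the functional (1, -1) has norm 2 and its image
    has norm 1. Contractivity of psi therefore gives only the bound 4 for G, hence for phi; the
    constant 1 has to be recovered from the order, with u standing for the missing unit. The bound 4
    still makes phi continuous, so that an estimate on the elements u x u extends to all of S by
    approximation. A second obstacle is the comparison of weak-* topologies. From T^* to T^d
    continuity rests on the completeness of T; in the other direction only evaluations at elements u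
    x u are shown to be weak-* continuous on S^d, and norm limits in T supply the remaining points.
    In (c) the inverse of psi is not assumed weak-* continuous, so it has no transpose at first: phi
    is shown to be onto by separation, and only then is its inverse recognized as that transpose. *)

Local Notation Re := complex.Re.
Local Notation Im := complex.Im.
Local Notation normc := Normc.normc.

(** * Complex numbers and Hilbert spaces *)

Section ComplexNumbers.
Variable R : realType.
Implicit Types z : R[i].

Lemma normc_ge0 z : 0 <= normc z.
Proof. by case: z => a b; exact: sqrtr_ge0. Qed.

Lemma normcJ z : normc z^* = normc z.
Proof. by case: z => a b /=; rewrite sqrrN. Qed.

Lemma normcR (r : R) : normc r%:C%C = `|r|.
Proof. by rewrite /= expr0n addr0 sqrtr_sqr. Qed.

Lemma sqr_normcE z : z * z^* = ((normc z) ^+ 2)%:C%C.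
Proof.
case: z => a b; rewrite /= sqr_sqrtr ?addr_ge0 ?sqr_ge0//.
by apply/eqP; rewrite eq_complex /=; apply/andP; split; apply/eqP; ring.
Qed.

Lemma normc_sum (I : Type) (r : seq I) (P : pred I) (F : I -> R[i]) :
  normc (\sum_(i <- r | P i) F i) <= \sum_(i <- r | P i) normc (F i).
Proof.
elim/big_ind2: _ => [|x a y b xa yb|//]; first by rewrite Normc.normc0.
by apply: le_trans (le_normcD _ _) _; exact: lerD.
Qed.

Lemma conjR (r : R) : (r%:C%C : R[i])^* = r%:C%C.
Proof. by rewrite -[LHS]/(Complex r (- 0)) oppr0. Qed.

Lemma ReD z1 z2 : Re (z1 + z2) = Re z1 + Re z2.
Proof. by case: z1 z2 => [? ?] [? ?]. Qed.

Lemma ReB z1 z2 : Re (z1 - z2) = Re z1 - Re z2.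
Proof. by case: z1 z2 => [? ?] [? ?]. Qed.

Lemma Re_conj z : Re z^* = Re z. Proof. by case: z. Qed.

Lemma normcB z1 z2 : normc (z1 - z2) = normc (z2 - z1).
Proof. by rewrite -normcN opprB. Qed.

Lemma normc_norm z : `|z| = (normc z)%:C%C.
Proof. by case: z. Qed.

(** The sign is negative so that rotating a vector by c inside a nonnegative quadratic form bounds
    the modulus of the cross term from above. *)
Lemma phase z : exists2 c : R[i], normc c = 1 & Re (c * z) = - normc z.
Proof.
have [->|z0] := eqVneq z 0.
  by exists 1; rewrite ?Normc.normc1// mulr0 Normc.normc0 oppr0.
have n0 : normc z != 0.
  by apply: contra z0 => /eqP/Normc.eq0_normc ->.
exists (- (normc z)^-1%:C%C * z^*).
  rewrite Normc.normcM normcN normcR normcJ ger0_norm ?invr_ge0 ?normc_ge0//.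
  by rewrite mulVf.
rewrite -mulrA [_^* * _]mulrC sqr_normcE /=.
by field.
Qed.

End ComplexNumbers.

Section HilbertSpaces.
Variables (R : realType) (H : ipspace R).
Implicit Types u v w : H.

Lemma ip0_eq u : (forall w, ip H u w = 0) -> u = 0.
Proof.
move=> u0; apply: hnorm_eq0; apply/eqP; rewrite -sqrf_eq0 sqr_hnorm u0.
by [].
Qed.

Lemma hnorm_le_ip u (M : R) : 0 <= M ->
  (forall w, normc (ip H u w) <= M * hnorm w) -> hnorm u <= M.
Proof.
move=> M0 uM; have [->|u0] := eqVneq (hnorm u) 0; first by [].
have hu : 0 < hnorm u by rewrite lt_neqAle eq_sym u0 hnorm_ge0.
rewrite -(ler_pM2r hu); apply: le_trans (uM u).
by rewrite ip_hnorm normcR ger0_norm ?sqr_ge0// expr2.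
Qed.

Lemma ipNl u w : ip H (- u) w = - ip H u w.
Proof. by rewrite -scaleN1r -[_ *: _]addr0 ip_linl ip0l addr0 mulN1r. Qed.

Lemma ipBl u v w : ip H (u - v) w = ip H u w - ip H v w.
Proof. by rewrite ipDl ipNl. Qed.

Lemma ipZl (a : R[i]) u w : ip H (a *: u) w = a * ip H u w.
Proof. by rewrite -[_ *: _]addr0 ip_linl ip0l addr0. Qed.

Lemma ipNr u w : ip H w (- u) = - ip H w u.
Proof. by rewrite ipE ipNl rmorphN /= -ipE. Qed.

Lemma ipBr u v w : ip H w (u - v) = ip H w u - ip H w v.
Proof. by rewrite ipDr ipNr. Qed.

Lemma Re_ipxx u : Re (ip H u u) = hnorm u ^+ 2.
Proof. by rewrite sqr_hnorm. Qed.

Lemma Re_ipC u v : Re (ip H u v) = Re (ip H v u).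
Proof. by rewrite ipE Re_conj. Qed.

Lemma bounded_op0 (T : H -> H) : bounded_op T -> T 0 = 0.
Proof. by move=> [lT _]; have := lT (-1) 0 0; rewrite scaler0 addr0 scaleN1r addNr. Qed.

Lemma hnorm_le_sqr u v : hnorm u ^+ 2 <= hnorm v ^+ 2 -> hnorm u <= hnorm v.
Proof. by rewrite ler_pXn2r ?nnegrE ?hnorm_ge0. Qed.

Section Dsum.
Variable n : nat.

Definition delta_vec (j : 'I_n) v : dsum H n := fun k => if k == j then v else 0.

Lemma ip_delta_vecr j v (w : dsum H n) : ip (dsum H n) w (delta_vec j v) = ip H (w j) v.
Proof.
rewrite /= /dsum_ip (bigD1 j)//= /delta_vec eqxx big1 ?addr0// => k /negPf ->.
exact: ip0r.
Qed.

Lemma hnorm_delta_vec j v : hnorm (delta_vec j v) = hnorm v.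
Proof.
by rewrite {1}/hnorm ip_delta_vecr /delta_vec eqxx.
Qed.

Lemma sqr_hnorm_dsum (v : dsum H n) : hnorm v ^+ 2 = \sum_i hnorm (v i) ^+ 2.
Proof.
rewrite sqr_hnorm /= /dsum_ip raddf_sum; apply: eq_bigr => i _.
by rewrite sqr_hnorm.
Qed.

End Dsum.

Lemma hnorm_dsum1 (v : dsum H 1) : hnorm v = hnorm (v ord0).
Proof. by rewrite /hnorm /= /dsum_ip big_ord1. Qed.

End HilbertSpaces.

Section Amplification.
Variables (R : realType) (V : Type) (H : ipspace R) (op : V -> H -> H).

Lemma ip_amp n (x : 'M[V]_n) (v w : dsum H n) :
  ip (dsum H n) (amp op x v) w = \sum_i \sum_j ip H (op (x i j) (v j)) (w i).
Proof. by rewrite /= /dsum_ip /amp; apply: eq_bigr => i _; rewrite ip_suml. Qed.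

End Amplification.

Section Opspace.
Variables (R : realType) (X : opspace R).
Local Notation H := (os_H X).
Local Notation XS := (smos_of_opspace X).
Implicit Types (x y : X) (v w : H).

Lemma os_op0l v : os_op (0 : X) v = 0.
Proof. by have := os_opP (-1) (0 : X) 0 v; rewrite scaler0 addr0 scaleN1r addNr. Qed.

Lemma os_opDl x y v : os_op (x + y) v = os_op x v + os_op y v.
Proof. by rewrite -[x in LHS]scale1r os_opP scale1r. Qed.

Lemma os_opZl a x v : os_op (a *: x) v = a *: os_op x v.
Proof. by rewrite -[_ *: x]addr0 os_opP os_op0l addr0. Qed.

Lemma os_opNl x v : os_op (- x) v = - os_op x v.
Proof. by rewrite -scaleN1r os_opZl scaleN1r. Qed.

Lemma os_opBl x y v : os_op (x - y) v = os_op x v - os_op y v.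
Proof. by rewrite os_opDl os_opNl. Qed.

Lemma os_op0r x : os_op x 0 = 0.
Proof. exact: bounded_op0 (os_bounded x). Qed.

Lemma os_opDr x v w : os_op x (v + w) = os_op x v + os_op x w.
Proof. by have [l _] := os_bounded x; have := l 1 v w; rewrite !scale1r. Qed.

Lemma os_opZr x a v : os_op x (a *: v) = a *: os_op x v.
Proof. by have [l _] := os_bounded x; have := l a v 0; rewrite os_op0r !addr0. Qed.

Lemma os_opNr x v : os_op x (- v) = - os_op x v.
Proof. by rewrite -scaleN1r os_opZr scaleN1r. Qed.

Lemma os_opBr x v w : os_op x (v - w) = os_op x v - os_op x w.
Proof. by rewrite os_opDr os_opNr. Qed.

Lemma os_suml (I : Type) (r : seq I) (P : pred I) (F : I -> X) v :
  os_op (\sum_(i <- r | P i) F i) v = \sum_(i <- r | P i) os_op (F i) v.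
Proof. exact: (big_morph (fun x => os_op x v) (fun x y => os_opDl x y v) (os_op0l v)). Qed.

Lemma os_sumr (I : Type) (r : seq I) (P : pred I) (F : I -> H) x :
  os_op x (\sum_(i <- r | P i) F i) = \sum_(i <- r | P i) os_op x (F i).
Proof. exact: (big_morph (os_op x) (os_opDr x) (os_op0r x)). Qed.

Lemma mnormP n (x : 'M[XS]_n) (v : dsum H n) :
  hnorm (amp (@os_op R X) x v) <= mnorm x * hnorm v.
Proof. by apply: opnormP; apply: amp_bounded; exact: os_bounded. Qed.

Lemma mnorm_ge0 n (x : 'M[XS]_n) : 0 <= mnorm x.
Proof. by apply: opnorm_ge0; apply: amp_bounded; exact: os_bounded. Qed.

Lemma mnorm_le n (x : 'M[XS]_n) (M : R) : 0 <= M ->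
  (forall v : dsum H n, hnorm (amp (@os_op R X) x v) <= M * hnorm v) -> mnorm x <= M.
Proof. exact: opnorm_le. Qed.

Lemma mnorm_le_ip n (x : 'M[XS]_n) (M : R) : 0 <= M ->
  (forall v w : dsum H n,
     normc (\sum_i \sum_j ip H (os_op (x i j) (v j)) (w i)) <= M * hnorm v * hnorm w) ->
  mnorm x <= M.
Proof.
move=> M0 xM; apply: mnorm_le => // v; apply: hnorm_le_ip => [|w].
  by rewrite mulr_ge0// hnorm_ge0.
by rewrite ip_amp.
Qed.

Lemma mnorm_ip n (x : 'M[XS]_n) (v w : dsum H n) :
  normc (\sum_i \sum_j ip H (os_op (x i j) (v j)) (w i)) <= mnorm x * hnorm v * hnorm w.
Proof.
rewrite -ip_amp; apply: le_trans (cauchy_schwarz _ _) _.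
by rewrite ler_wpM2r ?hnorm_ge0// mnormP.
Qed.

Lemma nrm_ge0 (x : X) : 0 <= nrm (x : XS). Proof. exact: mnorm_ge0. Qed.

Lemma nrmP x v : hnorm (os_op x v) <= nrm (x : XS) * hnorm v.
Proof.
have := @mnormP 1 (const_mx x) (fun _ => v).
by rewrite !hnorm_dsum1 /amp big_ord1 mxE.
Qed.

Lemma nrm_ip x v w : normc (ip H (os_op x v) w) <= nrm (x : XS) * hnorm v * hnorm w.
Proof.
apply: le_trans (cauchy_schwarz _ _) _.
by rewrite ler_wpM2r ?hnorm_ge0// nrmP.
Qed.

Lemma nrm_le x (M : R) : 0 <= M -> (forall v, hnorm (os_op x v) <= M * hnorm v) ->
  nrm (x : XS) <= M.
Proof.
move=> M0 xM; apply: mnorm_le => // v.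
by rewrite !hnorm_dsum1 /amp big_ord1 mxE.
Qed.

Lemma nrm_le_ip x (M : R) : 0 <= M ->
  (forall v w, normc (ip H (os_op x v) w) <= M * hnorm v * hnorm w) ->
  nrm (x : XS) <= M.
Proof.
move=> M0 xM; apply: nrm_le => // v; apply: hnorm_le_ip => [|w].
  by rewrite mulr_ge0// hnorm_ge0.
exact: xM.
Qed.

Lemma nrm0 : nrm (0 : XS) = 0.
Proof.
apply/le_anti; rewrite nrm_ge0 andbT; apply: nrm_le => // v.
by rewrite os_op0l hnorm0 mul0r.
Qed.

Lemma nrm_eq0 x : nrm (x : XS) = 0 -> x = 0.
Proof.
move=> x0; apply: os_inj => v; rewrite os_op0l; apply: hnorm_eq0; apply/le_anti.
by rewrite hnorm_ge0 andbT; apply: le_trans (nrmP _ _) _; rewrite x0 mul0r.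
Qed.

Lemma nrmD x y : nrm (x + y : XS) <=
  nrm (x : XS) + nrm (y : XS).
Proof.
apply: nrm_le => [|v]; first by rewrite addr_ge0 ?nrm_ge0.
rewrite os_opDl mulrDl; apply: le_trans (hnormD _ _) _.
by rewrite lerD ?nrmP.
Qed.

Lemma nrmZ_le (a : R[i]) x : nrm (a *: x : XS) <=
  normc a * nrm (x : XS).
Proof.
apply: nrm_le => [|v]; first by rewrite mulr_ge0 ?nrm_ge0 ?normc_ge0.
by rewrite os_opZl hnormZ -mulrA ler_wpM2l ?normc_ge0 ?nrmP.
Qed.

Lemma nrmN x : nrm (- x : XS) = nrm (x : XS).
Proof.
have le y : nrm (- y : XS) <= nrm (y : XS).
  have -> : - y = (-1) *: y by rewrite scaleN1r.
  apply: le_trans (nrmZ_le _ _) _.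
  by rewrite normcN Normc.normc1 mul1r.
by apply/le_anti; rewrite le/= -{1}[x]opprK le.
Qed.

Lemma nrmB x y : nrm (x - y : XS) = nrm (y - x : XS).
Proof. by rewrite -nrmN opprB. Qed.

Lemma mnorm_le_entries n (x : 'M[XS]_n) :
  mnorm x <= \sum_i \sum_j nrm (x i j : XS).
Proof.
have s0 : 0 <= \sum_i \sum_j nrm (x i j : XS).
  by apply: sumr_ge0 => i _; apply: sumr_ge0 => j _; exact: nrm_ge0.
apply: mnorm_le_ip => // v w; rewrite !mulr_suml.
apply: le_trans (normc_sum _ _ _) _; apply: ler_sum => i _.
rewrite !mulr_suml; apply: le_trans (normc_sum _ _ _) _; apply: ler_sum => j _.
apply: le_trans (nrm_ip _ _ _) _; apply: ler_pM; rewrite ?mulr_ge0 ?nrm_ge0 ?hnorm_ge0//.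
  by apply: ler_wpM2l; [exact: nrm_ge0|exact: hnorm_coord].
exact: hnorm_coord.
Qed.

Lemma mnormZ_le n (a : R[i]) (x : 'M[XS]_n) :
  mnorm (map_mx ( *:%R a) x : 'M[XS]_n) <= normc a * mnorm x.
Proof.
apply: mnorm_le_ip => [|v w]; first by rewrite mulr_ge0 ?mnorm_ge0 ?normc_ge0.
under eq_bigr do under eq_bigr do rewrite mxE os_opZl ipZl.
under eq_bigr do rewrite -mulr_sumr.
by rewrite -mulr_sumr Normc.normcM -!mulrA ler_wpM2l ?normc_ge0// mulrA mnorm_ip.
Qed.

Lemma mconeE n (x : 'M[XS]_n) :
  (forall i j, os_star (x j i) = x i j) ->
  (forall v : dsum H n, 0 <= Re (\sum_i \sum_j ip H (os_op (x i j) (v j)) (v i))) ->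
  mcone XS n x.
Proof.
move=> sx px; have sx' : (map_mx (@os_star R X) x)^T = x.
  by apply/matrixP => i j; rewrite !mxE.
split=> // v; rewrite lecE ip_amp px andbT.
set s := (X in Im X); have : s = s^*.
  rewrite /s -ip_amp {1}(amp_adjoint x v v) sx'.
  by rewrite ipE.
by case: s => a b [] /= /eqP; rewrite -addr_eq0 -mulr2n mulrn_eq0 /=.
Qed.

Lemma mcone_star n (x : 'M[XS]_n) i j :
  mcone XS n x -> os_star (x j i) = x i j.
Proof. by move=> [/matrixP/(_ i j) + _]; rewrite !mxE. Qed.

Lemma mcone_ge0 n (x : 'M[XS]_n) (v : dsum H n) : mcone XS n x ->
  0 <= \sum_i \sum_j ip H (os_op (x i j) (v j)) (v i).
Proof. by move=> [_ /(_ v)]; rewrite ip_amp. Qed.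

End Opspace.

(** * Weak-* continuous forms on a dual space *)

Section WeakStar.
Variables (R : realType) (D : wsmos_data R).

Lemma cvg_wstar (F : set_system D) (x : D) : Filter F ->
  (forall f, predual D f -> (f : D -> R[i]^o) @ F --> (f x : R[i]^o)) ->
  F --> (x : wstar_top D).
Proof.
move=> FF Ff A [B [[C oC CB] Bx BA]]; apply: (filterS BA); rewrite -CB.
pose q (y : D) : prod_topology (fun _ : predual D => R[i]^o) := fun f => val f y.
suff : q @ F --> q x.
  by apply; apply: open_nbhs_nbhs; split=> //; move: Bx; rewrite -CB.
apply/cvg_sup => f U [V [[W oW WV] Vx VU]]; apply: (filterS VU); rewrite -WV.
apply: (Ff (val f) (set_valP f)).
by apply: open_nbhs_nbhs; split=> //; move: Vx; rewrite -WV.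
Qed.

Lemma predual_continuous f : predual D f -> continuous (f : wstar_top D -> R[i]^o).
Proof.
move=> Df x.
pose q (y : D) : prod_topology (fun _ : predual D => R[i]^o) := fun f => val f y.
have qc : continuous (q : wstar_top D -> _) by exact: initial_continuous.
have fE : f = (fun g : prod_topology (fun _ : predual D => R[i]^o) =>
    g (SigSub (mem_set Df))) \o q by [].
rewrite fE.
apply: (@continuous_comp (wstar_top D) (prod_topology (fun _ : predual D => R[i]^o)) R[i]^o
  q (proj (SigSub (mem_set Df)))).
  exact: qc.
exact: proj_continuous.
Qed.

End WeakStar.

Section WeakStarMaps.
Variables (R : realType) (D E : wsmos_data R).

Lemma wstar_continuousP (psi : D -> E) :
  (forall f, predual E f -> continuous (f \o psi : wstar_top D -> R[i]^o)) ->
  wstar_continuous D E psi.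
Proof.
move=> psic x.
have FF : Filter (psi @ nbhs (x : wstar_top D)) by exact: fmap_filter.
by apply: cvg_wstar => f Ef; exact: psic.
Qed.

End WeakStarMaps.

Section Evaluations.
Variables (R : realType) (T : smos_data R).

Lemma dualT_linear (f : dualT T) : linear (f : T -> R[i]).
Proof. by case: f => f /= /asboolP[]. Qed.

Lemma dualT0 (f : dualT T) : f 0 = 0.
Proof. by have := dualT_linear f (-1) 0 0; rewrite scaler0 addr0 scaleN1r addNr. Qed.

Lemma dualTD (f : dualT T) x y : f (x + y) = f x + f y.
Proof. by have := dualT_linear f 1 x y; rewrite !scale1r. Qed.

Lemma dualTZ (f : dualT T) a x : f (a *: x) = a * f x.
Proof. by have := dualT_linear f a x 0; rewrite dualT0 !addr0. Qed.

Lemma dualTN (f : dualT T) x : f (- x) = - f x.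
Proof. by rewrite -scaleN1r dualTZ mulN1r. Qed.

Lemma dualTB (f : dualT T) x y : f (x - y) = f x - f y.
Proof. by rewrite dualTD dualTN. Qed.

Lemma dualT_sum (I : Type) (r : seq I) (P : pred I) (F : I -> T) (f : dualT T) :
  f (\sum_(i <- r | P i) F i) = \sum_(i <- r | P i) f (F i).
Proof. exact: (big_morph f (dualTD f) (dualT0 f)). Qed.

Lemma dualT_eqP (f g : dualT T) : (forall x, f x = g x) -> f = g.
Proof. by move=> fg; apply/val_inj/funext. Qed.

Lemma dualT_bound (f : dualT T) : exists2 M : R, 0 <= M & forall x, normc (f x) <= M * nrm x.
Proof. by case: f => f /= /asboolP[]. Qed.

Section LinearForm.
Variables (L : dualT T -> R[i]) (lL : linear (L : dualT T -> R[i]^o)).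

Lemma form0 : L 0 = 0.
Proof. by have := lL (-1) 0 0; rewrite scaler0 addr0 scaleN1r addNr. Qed.

Lemma formZ a f : L (a *: f) = a * L f.
Proof. by have := lL a f 0; rewrite form0 !addr0. Qed.

End LinearForm.

(** The classical fact that a form killing the common kernel of finitely many forms is a combination
    of them; a combination of evaluations is the evaluation at the combined point. *)
Lemma form_vanishing_on_kernels (s : seq T) (L : dualT T -> R[i]) :
  linear (L : dualT T -> R[i]^o) ->
  (forall f : dualT T, all (fun x => f x == 0) s -> L f = 0) ->
  exists z : T, forall f, L f = f z.
Proof.
elim: s L => [|x s IH] L lL L0; first by exists 0 => f; rewrite dualT0 L0.
have [sx|/existsNP[f0 /not_implyP[sf0 /eqP f0x]]] :=
    pselect (forall f : dualT T, all (fun y => f y == 0) s -> f x = 0).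
  by apply: IH => // f sf; apply: L0; rewrite /= sf sx// eqxx.
(* Here f0 vanishes on s but not at x. Subtracting c times evaluation at x makes L vanish at f0;
   below, g is f moved along f0 until it vanishes at x too. *)
pose c := L f0 / f0 x.
have [|f sf|z zE] := IH (fun f => L f - c * f x).
- move=> a f g; rewrite lL -[(_ + g) x]/(a * f x + g x) -[_ *: L f]/(a * L f).
  rewrite -[_ *: (L f - _)]/(a * (L f - c * f x)); ring.
- pose g : dualT T := (- (f x / f0 x)) *: f0 + f.
  have : L g = 0.
    apply: L0; apply/allP => y; rewrite -[g y]/(- (f x / f0 x) * f0 y + f y).
    rewrite inE => /orP[/eqP ->|ys]; first by rewrite mulNr divfK// addNr.
    by rewrite (eqP (allP sf0 _ ys)) (eqP (allP sf _ ys)) mulr0 addr0.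
  rewrite lL -[_ *: L f0]/(- (f x / f0 x) * L f0) /c => Lg.
  by rewrite -[RHS]Lg; field.
exists (z + c *: x) => f; rewrite dualTD dualTZ -zE; ring.
Qed.

(* The subspaces on which finitely many evaluations vanish form a filter that
   converges to 0, so a continuous form is bounded, hence zero, on one of them. *)
Lemma wstar_form_eval (L : dualT T -> R[i]) :
  linear (L : dualT T -> R[i]^o) ->
  continuous (L : wstar_top (dual_wsmos T) -> R[i]^o) ->
  exists z : T, forall f, L f = f z.
Proof.
move=> lL cL.
pose F : set_system (dualT T) := filter_from (setT : set (seq T))
  (fun s => [set f : dualT T | all (fun x => f x == 0) s]).
have FF : Filter F.
  apply: filter_from_filter; first by exists [::].
  move=> s t _ _; exists (s ++ t) => // f /=.
  by rewrite all_cat => /andP[].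
have F0 : F --> (0 : wstar_top (dual_wsmos T)).
  apply: (@cvg_wstar R (dual_wsmos T) F 0) => _ [x _ <-] A /nbhs_singleton A0.
  by exists [:: x] => // f; rewrite /= andbT => /eqP fx; rewrite fx -(dualT0 0) in A0 *.
have FL : (L : dualT T -> R[i]^o) @ F --> (0 : R[i]^o).
  by have := cvg_trans (cvg_app (L : dualT T -> R[i]^o) F0) (cL 0); rewrite form0.
have [s _ sL] := @cvgr0_norm_lt R[i] R[i]^o _ F FF _ FL 1 ltr01.
apply: (@form_vanishing_on_kernels s) => // f sf; apply/eqP/negPn/negP => Lf.
have /= := sL ((L f)^-1 *: f).
rewrite formZ// mulVf// normr1 ltxx; move=> H; apply/notF/H.
apply/allP => x xs; rewrite -[X in X == _]/((L f)^-1 * f x).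
by rewrite (eqP (allP sf _ xs)) mulr0.
Qed.

End Evaluations.

(** * Functionals and evaluations on an operator space *)

Section Duals.
Variables (R : realType) (S : opspace R).
Local Notation H := (os_H S).
Local Notation SS := (smos_of_opspace S).
Local Notation Csp := (scalar_space R).

Lemma vector_functional_subproof (v w : H) :
  (fun x : SS => ip H (os_op x v) w : R[i]^o) \in @functional R SS.
Proof.
apply/asboolP; split=> [a x y|]; first by rewrite os_opP ip_linl.
exists (hnorm v * hnorm w) => [|x]; first by rewrite mulr_ge0 ?hnorm_ge0.
by apply: le_trans (nrm_ip _ _ _) _; rewrite -mulrA mulrC.
Qed.

Definition vector_functional v w : dualT SS := DualT (vector_functional_subproof v w).

Lemma dual_star_vector_functional v w :
  dual_star (vector_functional v w) = vector_functional w v.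
Proof.
apply: dualT_eqP => x.
by rewrite /= -[os_star x]/(os_star x) os_adjoint os_starK -ipE.
Qed.

Section Tensor.
Variable m : nat.
Implicit Types (a b : dsum Csp m).

Definition tensor_vec (K : ipspace R) a (v : K) : dsum K m := fun j => (a j : R[i]) *: v.

Lemma hnorm_tensor_vec (K : ipspace R) a (v : K) :
  hnorm (tensor_vec a v) = hnorm a * hnorm v.
Proof.
apply: (pexpIrn (isT : (0 < 2)%N)); rewrite ?nnegrE ?mulr_ge0 ?hnorm_ge0//.
rewrite exprMn !sqr_hnorm_dsum mulr_suml; apply: eq_bigr => j _.
rewrite hnormZ exprMn; congr (_ * _).
by rewrite sqr_hnorm /= /scalar_ip sqr_normcE.
Qed.

(* Bounded functionals are completely bounded, with the same bound. *)
Lemma tensor_form_bound (f : dualT SS) (M : R) (X : 'M[SS]_m) a b :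
  0 <= M -> (forall x, normc (f x) <= M * nrm x) ->
  normc (\sum_i \sum_j f (X i j) * (a j : R[i]) * (b i : R[i])^*) <=
  M * mnorm X * hnorm a * hnorm b.
Proof.
move=> M0 fM.
(* z compresses X by the scalar vectors a and b, so its vector forms are forms of X at tensor
   vectors, and its norm is controlled by that of X. *)
pose z : SS := \sum_i \sum_j ((a j : R[i]) * (b i : R[i])^*) *: X i j.
have -> : \sum_i \sum_j f (X i j) * (a j : R[i]) * (b i : R[i])^* = f z.
  rewrite dualT_sum; apply: eq_bigr => i _; rewrite dualT_sum.
  by apply: eq_bigr => j _; rewrite dualTZ; ring.
apply: le_trans (fM z) _; rewrite -!mulrA ler_wpM2l//.
apply: nrm_le_ip => [|v w]; first by rewrite !mulr_ge0 ?hnorm_ge0 ?mnorm_ge0.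
have := mnorm_ip X (tensor_vec a v) (tensor_vec b w).
rewrite !hnorm_tensor_vec.
have -> : \sum_i \sum_j ip H (os_op (X i j) (tensor_vec a v j)) (tensor_vec b w i) =
    ip H (os_op z v) w.
  rewrite os_suml ip_suml; apply: eq_bigr => i _; rewrite os_suml ip_suml.
  apply: eq_bigr => j _; rewrite os_opZr ipZl ipZr os_opZl ipZl; ring.
by move=> h; apply: le_trans h _; rewrite le_eqVlt; apply/orP; left; apply/eqP; ring.
Qed.

End Tensor.

Section Evmx.
Variables (m n : nat).

Definition evmx (X : 'M[SS]_m) (f : dualT SS) : Mn R m := \matrix_(i, j) f (X i j).

(** The shuffle between the tensor products of C^n and C^m in the two orders. The matrices of
    [theta f] over X and of [evmx X] over f have the same entries, the numbers f_kl(X_ij), arranged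
    in these two ways. *)
Definition flip (p : dsum (dsum Csp n) m) : dsum (dsum Csp m) n := fun k i => p i k.

Lemma hnorm_flip p : hnorm (flip p) = hnorm p.
Proof. by rewrite /hnorm /= /dsum_ip /= /dsum_ip exchange_big. Qed.

Lemma theta_form (f : 'M[dualT SS]_n) (X : 'M[SS]_m) (p q : dsum (dsum Csp n) m) :
  \sum_i \sum_j ip _ (mx_op (theta f (X i j)) (p j)) (q i) =
  \sum_k \sum_l \sum_i \sum_j f k l (X i j) * (p j l : R[i]) * (q i k : R[i])^*.
Proof.
under eq_bigr => i _ do under eq_bigr => j _ do
  (rewrite /= /dsum_ip /mx_op /= /scalar_ip; under eq_bigr => k _ do rewrite mulr_suml).
under eq_bigr => i _ do rewrite exchange_big /=.
rewrite exchange_big /=; apply: eq_bigr => k _.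
under eq_bigr => i _ do rewrite exchange_big /=.
rewrite exchange_big /=; apply: eq_bigr => l _.
by apply: eq_bigr => i _; apply: eq_bigr => j _; rewrite mxE.
Qed.

Lemma evmx_form (f : 'M[dualT SS]_n) (X : 'M[SS]_m) (p q : dsum (dsum Csp n) m) :
  \sum_k \sum_l ip _ (mx_op (evmx X (f k l)) (flip p l)) (flip q k) =
  \sum_k \sum_l \sum_i \sum_j f k l (X i j) * (p j l : R[i]) * (q i k : R[i])^*.
Proof.
apply: eq_bigr => k _; apply: eq_bigr => l _.
rewrite /= /dsum_ip /mx_op /= /scalar_ip; apply: eq_bigr => i _.
by rewrite mulr_suml; apply: eq_bigr => j _; rewrite mxE.
Qed.

End Evmx.

Lemma flipK m n (p : dsum (dsum Csp m) n) : flip (flip p) = p.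
Proof. by []. Qed.

(** Up to [flip], both sides are norms of one scalar matrix; this makes evaluation at a contraction
    completely contractive on the dual. *)
Lemma mnorm_evmx_theta m n (f : 'M[dualT SS]_n) (X : 'M[SS]_m) :
  mnorm (map_mx (evmx X) f : 'M[Mn R m]_n) <= mnorm (map_mx (theta f) X : 'M[Mn R n]_m).
Proof.
apply: mnorm_le_ip => [|p q]; first exact: mnorm_ge0.
under eq_bigr do under eq_bigr do rewrite mxE.
rewrite -(flipK p) -(flipK q).
have := evmx_form f X (flip p) (flip q) => ->; rewrite -theta_form.
have := mnorm_ip (map_mx (theta f) X) (flip p) (flip q).
under eq_bigr do under eq_bigr do rewrite mxE.
by rewrite (hnorm_flip p) (hnorm_flip q).
Qed.

(** [dual_mnorm] is a real supremum, which says nothing about an unbounded set; this bound, the sum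
    of the bounds of the entries, makes it usable. *)
Lemma theta_bounded n (f : 'M[dualT SS]_n) :
  exists2 M : R, 0 <= M & forall m (X : 'M[SS]_m),
    mnorm (map_mx (theta f) X : 'M[Mn R n]_m) <= M * mnorm X.
Proof.
have /choice[M0] : forall kl : 'I_n * 'I_n, exists M : R, 0 <= M /\
    forall x, normc (f kl.1 kl.2 x) <= M * nrm x.
  by move=> kl; have [M] := dualT_bound (f kl.1 kl.2); exists M.
move=> fM; exists (\sum_k \sum_l M0 (k, l)) => [|m X].
  by apply: sumr_ge0 => k _; apply: sumr_ge0 => l _; have [] := fM (k, l).
apply: mnorm_le_ip => [|p q].
  apply: mulr_ge0; last exact: mnorm_ge0.
  by apply: sumr_ge0 => k _; apply: sumr_ge0 => l _; have [] := fM (k, l).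
under eq_bigr do under eq_bigr do rewrite mxE.
rewrite theta_form !mulr_suml; apply: le_trans (normc_sum _ _ _) _.
apply: ler_sum => k _; rewrite !mulr_suml; apply: le_trans (normc_sum _ _ _) _.
apply: ler_sum => l _; have [h0 h] := fM (k, l).
apply: le_trans (tensor_form_bound X (flip p l) (flip q k) h0 h) _.
apply: ler_pM; rewrite ?mulr_ge0 ?mnorm_ge0 ?hnorm_ge0//; last first.
  by apply: le_trans (hnorm_coord (flip q) k) _; rewrite hnorm_flip.
apply: ler_wpM2l; first by rewrite mulr_ge0 ?mnorm_ge0.
by apply: le_trans (hnorm_coord (flip p) l) _; rewrite hnorm_flip.
Qed.

Lemma dual_mnorm_has_sup n (f : 'M[dualT SS]_n) :
  has_sup [set r | exists (m : nat) (x : 'M[SS]_m),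
     mnorm x <= 1 /\ r = mnorm (map_mx (theta f) x : 'M[Mn R n]_m)].
Proof.
have [M M0 fM] := theta_bounded f; split.
  exists (mnorm (map_mx (theta f) (const_mx 0 : 'M[SS]_1) : 'M[Mn R n]_1)).
  exists 1%N, (const_mx 0); split=> //.
  by rewrite -/(nrm (0 : SS)) nrm0.
by exists M => _ [m [X [X1 ->]]]; apply: le_trans (fM _ X) _; rewrite ler_piMr.
Qed.

Lemma dual_mnorm_ub m n (f : 'M[dualT SS]_n) (X : 'M[SS]_m) : mnorm X <= 1 ->
  mnorm (map_mx (theta f) X : 'M[Mn R n]_m) <= mnorm (f : 'M[dual SS]_n).
Proof.
by move=> X1; apply: (sup_upper_bound (dual_mnorm_has_sup f)); exists m, X.
Qed.

Lemma dual_mnorm_le n (f : 'M[dualT SS]_n) (M : R) :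
  (forall m (X : 'M[SS]_m), mnorm X <= 1 ->
     mnorm (map_mx (theta f) X : 'M[Mn R n]_m) <= M) ->
  mnorm (f : 'M[dual SS]_n) <= M.
Proof.
move=> fM; apply: ge_sup; first by have [] := dual_mnorm_has_sup f.
by move=> _ [m [X [X1 ->]]]; exact: fM.
Qed.

Lemma dual_nrm_ge0 (f : dualT SS) : 0 <= nrm (f : dual SS).
Proof.
apply: (@le_trans _ _ (mnorm (map_mx (theta (const_mx f)) (const_mx 0 : 'M[SS]_1)))).
  exact: (@mnorm_ge0 R (mx_opspace R 1)).
by apply: dual_mnorm_ub; rewrite -/(nrm (0 : SS)) nrm0.
Qed.

(** The dual norm tests all matrix levels; tensoring the scalar vectors with v and w reduces each
    level to a single form of X. *)
Lemma nrm_vector_functional v w :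
  nrm (vector_functional v w : dual SS) <= hnorm v * hnorm w.
Proof.
apply: dual_mnorm_le => m X X1; apply: mnorm_le_ip => [|p q].
  by rewrite mulr_ge0 ?hnorm_ge0.
under eq_bigr do under eq_bigr do rewrite mxE.
rewrite theta_form !big_ord1 !mxE.
have := mnorm_ip X (tensor_vec (flip p ord0) v) (tensor_vec (flip q ord0) w).
rewrite !hnorm_tensor_vec.
under eq_bigr do under eq_bigr do rewrite os_opZr ipZl ipZr.
rewrite (_ : \sum_i \sum_j _ = \sum_i \sum_j
  vector_functional v w (X i j) * (p j ord0 : R[i]) * (q i ord0 : R[i])^*); last first.
  by apply: eq_bigr => i _; apply: eq_bigr => j _; rewrite /flip /=; ring.
move=> h; apply: le_trans h _.
have -> : hnorm (flip p ord0) = hnorm p by rewrite -(hnorm_flip p) hnorm_dsum1.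
have -> : hnorm (flip q ord0) = hnorm q by rewrite -(hnorm_flip q) hnorm_dsum1.
rewrite -[leRHS]mul1r (_ : mnorm X * _ * _ =
  mnorm X * (hnorm v * hnorm w * hnorm p * hnorm q)); last by ring.
by rewrite ler_wpM2r ?mulr_ge0 ?hnorm_ge0.
Qed.

(** The quadratic form of [theta F] at X and p is that of X at the vectors u_j = sum_l p_jl e_l. *)
Lemma mcone_vector_functional n (e : dsum H n) :
  mcone (dual SS) n (\matrix_(k, l) vector_functional (e l) (e k)).
Proof.
set F := (X in mcone _ _ X).
have Fstar k l : dual_star (F l k) = F k l by rewrite !mxE dual_star_vector_functional.
split; first by apply/matrixP => k l; rewrite !mxE dual_star_vector_functional.
have thstar x : theta F (star x) = star (theta F x).
  by apply/matrixP => k l; rewrite !mxE /= -[os_star x]/(os_star x) os_adjoint os_starK -ipE.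
split=> // m X Xp; apply: mconeE => [i j|p].
  rewrite ![map_mx _ _ _ _]mxE -[LHS]/(star (theta F (X j i))) -thstar.
  by congr theta; exact: mcone_star.
pose u : dsum H m := fun j => \sum_l (p j l : R[i]) *: e l.
have := mcone_ge0 u Xp; rewrite lecE => /andP[_].
congr (_ <= Re _); apply: eq_bigr => i _; apply: eq_bigr => j _.
rewrite mxE /u ip_sumr /= /dsum_ip /mx_op /= /scalar_ip; apply: eq_bigr => k _.
rewrite os_sumr ip_suml mulr_suml; apply: eq_bigr => l _.
by rewrite !mxE os_opZr ipZl ipZr /=; ring.
Qed.

End Duals.

Lemma hnorm_scalar (R : realType) (a : R[i]) : hnorm (a : scalar_space R) = normc a.
Proof.
rewrite /hnorm -[ip _ _ _]/(a * a^*) sqr_normcE /= sqrtr_sqr ger0_norm//.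
exact: normc_ge0.
Qed.

Section EvaluationMaps.
Variables (R : realType) (S : opspace R).
Local Notation H := (os_H S).
Local Notation SS := (smos_of_opspace S).
Local Notation Csp := (scalar_space R).

Lemma evmx_linear m (X : 'M[SS]_m) : linear (evmx X : dualT SS -> Mn R m).
Proof. by move=> a f g; apply/matrixP => i j; rewrite !mxE. Qed.

Lemma evmx_continuous m (X : 'M[SS]_m) :
  continuous (evmx X : wstar_top (dual_wsmos SS) -> 'M[R[i]^o]_m).
Proof.
move=> f A [P Pn PA].
have : nbhs (f : wstar_top (dual_wsmos SS))
    [set g : dualT SS | forall i j, P i j (g (X i j) : R[i]^o)].
  have FF := nbhs_filter (f : wstar_top (dual_wsmos SS)).
  apply: (@filter_forall _ _
    (fun i (g : dualT SS) => forall j, P i j (g (X i j) : R[i]^o)) _ FF) => i.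
  apply: (@filter_forall _ _
    (fun j (g : dualT SS) => P i j (g (X i j) : R[i]^o)) _ FF) => j.
  have pX : predual (dual_wsmos SS) (fun g : dualT SS => g (X i j)) by exists (X i j).
  have cX : continuous (_ : wstar_top (dual_wsmos SS) -> R[i]^o) := predual_continuous pX.
  by apply: (cX f (P i j)); have := Pn i j; rewrite mxE.
by apply: filterS => g gP; apply: PA => i j; rewrite mxE; exact: gP.
Qed.

Lemma evmx_star_preserving m (X : 'M[SS]_m) :
  (forall i j, os_star (X j i) = X i j) ->
  forall f : dualT SS, evmx X (dual_star f) = mx_star (evmx X f).
Proof. by move=> sX f; apply/matrixP => i j; rewrite !mxE /= -(sX j i). Qed.

Lemma evmx_cpositive m (X : 'M[SS]_m) : mcone SS m X ->
  @cpositive R (dual SS) (Mn R m) (evmx X).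
Proof.
move=> Xp; have Xs i j := mcone_star i j Xp.
split=> [f|n f [fs [_ fp]]]; first exact: evmx_star_preserving.
apply: mconeE => [k l|p].
  rewrite ![map_mx _ _ _ _]mxE -[LHS]/(mx_star (evmx X (f l k))) -evmx_star_preserving//.
  by rewrite -[in RHS]fs !mxE.
under eq_bigr do under eq_bigr do rewrite mxE.
have /= := evmx_form f X (flip p) (flip p); rewrite -theta_form => ->.
have := @mcone_ge0 R (mx_opspace R n) m _ (flip p) (fp m X Xp); rewrite lecE => /andP[_].
by under eq_bigr do under eq_bigr do rewrite mxE.
Qed.

Lemma evmx_WQ m (X : 'M[SS]_m) : mcone SS m X -> mnorm X <= 1 ->
  @WQ R (dual_wsmos SS) m (evmx X).
Proof.
move=> Xp X1; split; last exact: evmx_continuous.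
split; [exact: evmx_linear|exact: evmx_cpositive|] => n f.
by apply: le_trans (mnorm_evmx_theta f X) _; exact: dual_mnorm_ub.
Qed.

Lemma WQ_evmx n (chi : dualT SS -> Mn R n) : @WQ R (dual_wsmos SS) n chi ->
  exists X : 'M[SS]_n, chi = evmx X.
Proof.
move=> [[lchi _ _] cchi].
have /choice[X XE] : forall ij : 'I_n * 'I_n, exists z : SS,
    forall f, chi f ij.1 ij.2 = f z.
  move=> [i j] /=; apply: (@wstar_form_eval R SS (fun f => chi f i j)) => [a f g|].
    by rewrite lchi !mxE.
  move=> f; apply: (@continuous_comp (wstar_top (dual_wsmos SS)) 'M[R[i]^o]_n R[i]^o
    chi (fun M : 'M[R[i]^o]_n => M i j)); first exact: cchi.
  exact: (@coord_continuous R[i]).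
exists (\matrix_(i, j) X (i, j)); apply/funext => f; apply/matrixP => i j.
rewrite [RHS]mxE [X in f X]mxE; exact: (XE (i, j)).
Qed.

Lemma vector_functional_sep (x y : SS) : (forall f : dualT SS, f x = f y) -> x = y.
Proof.
move=> xy; apply: os_inj => v; apply/eqP; rewrite -subr_eq0; apply/eqP.
apply: ip0_eq => w; rewrite ipBl; apply/eqP; rewrite subr_eq0; apply/eqP.
exact: (xy (vector_functional v w)).
Qed.

Lemma nrm_le_functionals (x : SS) (M : R) : 0 <= M ->
  (forall f : dualT SS, normc (f x) <= M * nrm (f : dual SS)) -> nrm x <= M.
Proof.
move=> M0 xM; apply: nrm_le_ip => // v w.
apply: le_trans (xM (vector_functional v w)) _.
by rewrite -mulrA ler_wpM2l// nrm_vector_functional.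
Qed.

End EvaluationMaps.

(** * The norm and the cone of N(D), tested on the maps in [WQ] *)

Section SupSpace.
Variables (R : realType) (D : wsmos_data R).

Lemma ND_mnorm_ub m (x : 'M[ND D]_m) (i : ND_index D) :
  mnorm (map_mx (ND_coord i) x : 'M[Mn R (ND_size i)]_m) <= ND_mnorm x.
Proof.
apply: sup_upper_bound; last by exists i.
split; first by exists (mnorm (map_mx (ND_coord i) x : 'M[Mn R (ND_size i)]_m)), i.
have /choice[M xM] : forall kl : 'I_m * 'I_m, exists M : R,
    forall i, nrm (x kl.1 kl.2 i) <= M.
  by move=> kl; exact: ND_bounded.
exists (\sum_k \sum_l M (k, l)) => _ [j ->].
apply: le_trans (@mnorm_le_entries R (mx_opspace R (ND_size j)) m _) _.
apply: ler_sum => k _; apply: ler_sum => l _; rewrite mxE.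
exact: (xM (k, l)).
Qed.

Lemma ND_mnorm_le m (x : 'M[ND D]_m) (M : R) : 0 <= M ->
  (forall i, mnorm (map_mx (ND_coord i) x : 'M[Mn R (ND_size i)]_m) <= M) ->
  ND_mnorm x <= M.
Proof.
move=> M0 xM; rewrite /ND_mnorm.
(* The index family is not shown to be inhabited here; over the empty set [sup] is 0, hence the
   assumption [0 <= M]. *)
have [->|/set0P] := eqVneq [set r | exists i, r =
  mnorm (map_mx (ND_coord i) x : 'M[Mn R (ND_size i)]_m)] set0.
  by rewrite sup0.
by move=> /ge_sup; apply => _ [i ->]; exact: xM.
Qed.

Lemma ND_mnorm_ge0 m (x : 'M[ND D]_m) : 0 <= ND_mnorm x.
Proof.
rewrite /ND_mnorm.
have [->|/set0P[r [i ri]]] := eqVneq [set r | exists i, r =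
  mnorm (map_mx (ND_coord i) x : 'M[Mn R (ND_size i)]_m)] set0.
  by rewrite sup0.
exact: le_trans (@mnorm_ge0 R (mx_opspace R (ND_size i)) _ _) (ND_mnorm_ub x i).
Qed.

Lemma map_coord_mu m (f : 'M[D]_m) (i : ND_index D) :
  map_mx (ND_coord i) (map_mx (@mu R D) f) = map_mx (val (projT2 i)) f.
Proof. by apply/matrixP => k l; rewrite !mxE. Qed.

Lemma mu_mnorm_le m (f : 'M[D]_m) : 0 <= mnorm f ->
  ND_mnorm (map_mx (@mu R D) f) <= mnorm f.
Proof.
move=> f0; apply: ND_mnorm_le => // i; rewrite map_coord_mu.
by have [[_ _ h] _] := set_valP (projT2 i); exact: h.
Qed.

Lemma mu_mcone m (f : 'M[D]_m) : mcone D m f -> ND_mcone (map_mx (@mu R D) f).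
Proof.
move=> fp i; rewrite map_coord_mu.
by have [[_ [_ h] _] _] := set_valP (projT2 i); exact: h.
Qed.

Lemma ND_mcone_WQ n m (f : 'M[D]_m) (chi : D -> Mn R n.+1) : @WQ R D n.+1 chi ->
  ND_mcone (map_mx (@mu R D) f) -> mcone (Mn R n.+1) m (map_mx chi f).
Proof.
move=> chiW /(_ (existT _ n (SigSub (mem_set chiW)))).
by rewrite map_coord_mu.
Qed.

Lemma ND_mnorm_WQ n m (f : 'M[D]_m) (chi : D -> Mn R n.+1) : @WQ R D n.+1 chi ->
  mnorm (map_mx chi f) <= ND_mnorm (map_mx (@mu R D) f).
Proof.
move=> chiW.
have := ND_mnorm_ub (map_mx (@mu R D) f) (existT _ n (SigSub (mem_set chiW))).
by rewrite map_coord_mu.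
Qed.

End SupSpace.

(** * Convergence of series *)

Section Series.
Variable R : realType.

Lemma cvg_cauchy_real (u : nat -> R) : cvgn u -> forall e, 0 < e ->
  exists N : nat, forall m n, (N <= m)%N -> (N <= n)%N -> `|u m - u n| < e.
Proof.
move=> cu e e0.
have [N _ uN] := (cvgrPdist_lt _ _).1 cu (e / 2) (divr_gt0 e0 (ltr0n R 2)).
exists N => m n Nm Nn.
have -> : u m - u n = (limn u - u n) - (limn u - u m) by ring.
apply: le_lt_trans (ler_normB _ _) _.
by rewrite [ltRHS]splitr; apply: ltrD; exact: uN.
Qed.

Lemma real_complete : norm_complete (fun x : R => `|x|).
Proof.
move=> u cu.
have : cvgn u.
  apply: cauchy_cvg; apply: cauchy_exP => e e0.
  have [N uN] := cu e e0; exists (u N); exists N => // n Nn /=.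
  by rewrite /ball /= uN.
move=> lu; exists (limn u) => e e0.
have [N _ uN] := (cvgrPdist_lt _ _).1 lu e e0.
by exists N => n Nn; rewrite distrC; exact: uN.
Qed.

Lemma normc_le_ReIm (z : R[i]) : normc z <= `|Re z| + `|Im z|.
Proof.
case: z => a b /=; rewrite -[leRHS]ger0_norm ?addr_ge0// -sqrtr_sqr.
rewrite ler_sqrt ?sqr_ge0// sqrrD !real_normK ?num_real//.
rewrite -addrA lerD2l lerDr mulrn_wge0//.
exact: mulr_ge0.
Qed.

Lemma normc_ge_absRe (z : R[i]) : `|Re z| <= normc z.
Proof.
case: z => a b /=.
by rewrite -sqrtr_sqr ler_sqrt ?addr_ge0 ?sqr_ge0// lerDl sqr_ge0.
Qed.

Lemma normc_ge_absIm (z : R[i]) : `|Im z| <= normc z.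
Proof.
case: z => a b /=.
by rewrite -sqrtr_sqr ler_sqrt ?addr_ge0 ?sqr_ge0// lerDr sqr_ge0.
Qed.

Lemma complex_complete : @norm_complete R R[i] (@Normc.normc R).
Proof.
move=> u cu.
have [|a ua] := @real_complete (fun n => Re (u n)).
  move=> e e0; have [N uN] := cu e e0; exists N => m n Nm Nn.
  by rewrite -raddfB; apply: le_lt_trans (normc_ge_absRe _) _; exact: uN.
have [|b ub] := @real_complete (fun n => Im (u n)).
  move=> e e0; have [N uN] := cu e e0; exists N => m n Nm Nn.
  by rewrite -raddfB; apply: le_lt_trans (normc_ge_absIm _) _; exact: uN.
exists (Complex a b) => e e0; have e20 := divr_gt0 e0 (ltr0n R 2).
have [N uN] := ua _ e20; have [N' uN'] := ub _ e20; exists (maxn N N') => n.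
rewrite geq_max => /andP[/uN {}uN /uN' {}uN'].
apply: le_lt_trans (normc_le_ReIm _) _; rewrite [ltRHS]splitr.
by apply: ltrD; [move: uN|move: uN']; case: (u n).
Qed.

Lemma cvg_normcP (u : nat -> R[i]) (l : R[i]) :
  (u : nat -> R[i]^o) @ \oo --> (l : R[i]^o) <->
  forall e, 0 < e -> exists N : nat, forall n, (N <= n)%N -> normc (u n - l) < e.
Proof.
split=> [ul e e0|ul].
  have e0' : 0 < e%:C%C by rewrite ltcR.
  have [N _ uN] := (@cvgrPdist_lt _ R[i]^o _ _ _ _ _).1 ul _ e0'.
  exists N => n Nn; have := uN n Nn; rewrite /= normc_norm ltcR.
  by rewrite normcB.
apply/(@cvgrPdist_lt _ R[i]^o) => e; rewrite ltcE => /andP[/eqP/= ie e0].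
have [N uN] := ul _ e0; exists N => // n Nn /=.
have -> : e = (Re e)%:C%C by case: (e) ie => a b /= ->.
by rewrite normc_norm normcB ltcR; exact: uN.
Qed.

Lemma normc_lim_unique (u : nat -> R[i]) (l l' : R[i]) :
  (forall e, 0 < e -> exists N : nat, forall n, (N <= n)%N -> normc (u n - l) < e) ->
  (forall e, 0 < e -> exists N : nat, forall n, (N <= n)%N -> normc (u n - l') < e) ->
  l = l'.
Proof.
move=> ul ul'; apply/eqP; rewrite -subr_eq0; apply/eqP/Normc.eq0_normc/le_anti.
rewrite normc_ge0 andbT; apply/ler_addgt0Pl => e e0; rewrite addr0.
have e20 := divr_gt0 e0 (ltr0n R 2).
have [N uN] := ul _ e20; have [N' uN'] := ul' _ e20.
have := uN _ (leq_maxl N N'); have := uN' _ (leq_maxr N N').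
set z := u _ => h h'; have -> : l - l' = (z - l') - (z - l) by ring.
by apply: le_trans (le_normcD _ _) _; rewrite normcN [leRHS]splitr; apply/ltW/ltrD.
Qed.

Section NormedSeries.
Variables (V : zmodType) (nm : V -> R).
Hypotheses (nm0 : nm 0 = 0) (nmN : forall x, nm (- x) = nm x).
Hypothesis nmD : forall x y, nm (x + y) <= nm x + nm y.
Hypothesis nm_complete : norm_complete nm.

(** Stated for an abstract norm because it serves twice: for the modulus on C, to define normal
    functionals, and for the operator norm, to sum points of T. *)
Lemma dominated_series (z : nat -> V) (b : nat -> R) :
  (forall k, nm (z k) <= b k) -> cvgn (series b) ->
  exists l : V, forall e, 0 < e -> exists N : nat, forall n, (N <= n)%N ->
    nm (\sum_(0 <= k < n) z k - l) < e.
Proof.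
move=> zb cb; apply: nm_complete => e e0.
have [N bN] := cvg_cauchy_real cb e0; exists N.
suff le m n : (N <= m)%N -> (m <= n)%N ->
    nm (\sum_(0 <= k < n) z k - \sum_(0 <= k < m) z k) < e.
  move=> m n Nm Nn; have [mn|/ltnW nm'] := leqP m n; last exact: le.
  by rewrite -nmN opprB; exact: le.
move=> Nm mn; rewrite (big_cat_nat (leq0n m) mn) /= addrAC subrr add0r.
apply: le_lt_trans (bN n m (leq_trans Nm mn) Nm).
rewrite /series /= (big_cat_nat (leq0n m) mn) /= addrAC subrr add0r.
apply: le_trans (ler_norm _).
elim/big_ind2: _ => [|x a y c xa yc|k _]; first by rewrite nm0.
  by apply: le_trans (nmD _ _) _; exact: lerD.
exact: zb.
Qed.

End NormedSeries.

Lemma cvg_series_scaled_sum (a b : nat -> R) (M : R) : cvgn (series a) -> cvgn (series b) ->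
  cvgn (series (fun k => M * (a k + b k))).
Proof.
move=> ca cb; have -> : (fun k => M * (a k + b k)) = M *: (a + b) :> (nat -> R) by [].
by apply: is_cvg_seriesZ; rewrite seriesD; apply: is_cvgD.
Qed.

End Series.

(** * The map mu and normal functionals *)

Section Composition.
Variables (R : realType).

Lemma map_mx_compE (A B C : Type) (f : A -> B) (g : B -> C) m (x : 'M[A]_m) :
  map_mx g (map_mx f x) = map_mx (g \o f) x.
Proof. by apply/matrixP => i j; rewrite !mxE. Qed.

Lemma linear0 (X Y : lmodType R[i]) (f : X -> Y) : linear f -> f 0 = 0.
Proof. by move=> lf; have := lf (-1) 0 0; rewrite scaler0 addr0 scaleN1r addNr. Qed.

Lemma CCp_comp (X Y Z : smos_data R) (f : X -> Y) (g : Y -> Z) :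
  CCp X Y f -> CCp Y Z g -> CCp X Z (g \o f).
Proof.
move=> [lf [sf pf] cf] [lg [sg pg] cg]; split.
- by move=> a x y; rewrite /= lf lg.
- split=> [x|n x xp]; first by rewrite /= sf sg.
  by rewrite -map_mx_compE; exact/pg/pf.
- move=> n x; rewrite -map_mx_compE; apply: le_trans (cg _ _) _; exact: cf.
Qed.

Lemma wstar_continuous_comp (D E F : wsmos_data R) (f : D -> E) (g : E -> F) :
  wstar_continuous D E f -> wstar_continuous E F g -> wstar_continuous D F (g \o f).
Proof.
move=> cf cg x.
exact: (@continuous_comp (wstar_top D) (wstar_top E) (wstar_top F) f g x (cf x) (cg (f x))).
Qed.

Lemma WQ_comp (D E : wsmos_data R) (G : D -> E) n (chi : E -> Mn R n) :
  CCw D E G -> @WQ R E n chi -> @WQ R D n (chi \o G).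
Proof.
move=> [cG wG] [cchi wchi]; split; first exact: CCp_comp.
move=> x; apply: (@continuous_comp (wstar_top D) (wstar_top E) 'M[R[i]^o]_n G chi).
  exact: wG.
exact: wchi.
Qed.

End Composition.

Section Normal.
Variables (R : realType) (D : wsmos_data R).

Lemma mx_op_ip_le n (A : 'M[R[i]]_n) (xi eta : dsum (scalar_space R) n) :
  normc (ip _ (mx_op A xi) eta) <= nrm (A : Mn R n) * hnorm xi * hnorm eta.
Proof. exact: (@nrm_ip R (mx_opspace R n)). Qed.

(** The crude inequality xi eta <= xi^2 + eta^2 turns square-summability of the two families of
    vectors into domination by a convergent series. *)
Lemma normal_dominated (a xi eta M : R) : 0 <= M -> 0 <= xi -> 0 <= eta ->
  a <= M * xi * eta -> a <= M * (xi ^+ 2 + eta ^+ 2).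
Proof.
move=> M0 xi0 eta0 h; apply: le_trans h _; rewrite -mulrA ler_wpM2l//; nra.
Qed.

Lemma ND_normal_exists (i : nat -> ND_index D)
    (xi eta : forall k, dsum (scalar_space R) (ND_size (i k))) :
  cvgn (series (fun k => hnorm (xi k) ^+ 2)) ->
  cvgn (series (fun k => hnorm (eta k) ^+ 2)) ->
  exists2 h : ND D -> R[i], ND_normal h & forall x : ND D,
    (series (fun k => ip _ (mx_op (x (i k)) (xi k)) (eta k) : R[i]^o))
      @ \oo --> (h x : R[i]^o).
Proof.
move=> cxi ceta.
have /choice[h hP] : forall x : ND D, exists l : R[i],
    (series (fun k => ip _ (mx_op (x (i k)) (xi k)) (eta k) : R[i]^o))
      @ \oo --> (l : R[i]^o).
  move=> x; have [M xM] := ND_bounded x.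
  have [||l lP] := @dominated_series R R[i] (@Normc.normc R) (Normc.normc0 _)
    (@normcN R) (@le_normcD R) (@complex_complete R)
    (fun k => ip _ (mx_op (x (i k)) (xi k)) (eta k))
    (fun k => M * (hnorm (xi k) ^+ 2 + hnorm (eta k) ^+ 2)).
  - move=> k; apply: normal_dominated; rewrite ?hnorm_ge0//.
      by apply: le_trans (xM (i k)); exact: nrm_ge0.
    apply: le_trans (mx_op_ip_le _ _ _) _.
    by rewrite ler_wpM2r ?hnorm_ge0// ler_wpM2r ?hnorm_ge0.
  - exact: cvg_series_scaled_sum.
  by exists l; apply/cvg_normcP.
by exists h => //; exists i, xi, eta.
Qed.

End Normal.

Section Lift.
Variables (R : realType) (D E : wsmos_data R) (G : D -> E).
Hypothesis GC : CCw D E G.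
Hypothesis mu_inj : injective (@mu R D).

Lemma mu_to_image_linear (F : wsmos_data R) : linear (@mu_to_image R F).
Proof. by move=> a x y; apply: val_inj; exact: mu_linear. Qed.

Lemma mu_to_image_star (F : wsmos_data R) (x : F) :
  star (mu_to_image x : mu_image_wsmos F) = mu_to_image (star x).
Proof. by apply: val_inj; rewrite /= mu_star. Qed.

Lemma mu_to_image_surj (F : wsmos_data R) (y : mu_image F) : exists x, mu_to_image x = y.
Proof.
case: y => y yP; have /asboolP[x _ xy] := yP.
by exists x; apply: val_inj.
Qed.

Lemma mu_to_image_inj : injective (@mu_to_image R D).
Proof. by move=> x y /(congr1 val) /= /mu_inj. Qed.

Lemma mu_image_mx (F : wsmos_data R) n (y : 'M[mu_image F]_n) :
  exists x : 'M[F]_n, map_mx (@mu_to_image R F) x = y.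
Proof.
have /choice[x xE] : forall y : mu_image F, exists x, mu_to_image x = y.
  exact: mu_to_image_surj.
by exists (map_mx x y); apply/matrixP => i j; rewrite !mxE.
Qed.

Lemma map_val_mu (F : wsmos_data R) n (x : 'M[F]_n) :
  map_mx (@mu_image_val R F) (map_mx (@mu_to_image R F) x) = map_mx (@mu R F) x.
Proof. by apply/matrixP => i j; rewrite !mxE. Qed.

(** Injectivity of mu makes psi well defined. Norm and cone of the image are tested by maps in [WQ],
    and composing such a map with G gives another one. *)
Lemma mu_image_lift : exists2 psi : mu_image_wsmos D -> mu_image_wsmos E,
  CCw (mu_image_wsmos D) (mu_image_wsmos E) psi &
  forall f, psi (mu_to_image f) = mu_to_image (G f).
Proof.
have /choice[pre preE] := @mu_to_image_surj D.
pose psi y := mu_to_image (G (pre y)).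
have psiE f : psi (mu_to_image f) = mu_to_image (G f).
  by rewrite /psi; congr (mu_to_image (G _)); apply: mu_to_image_inj; rewrite preE.
have map_psi n (f : 'M[D]_n) : map_mx psi (map_mx (@mu_to_image R D) f) =
    map_mx (@mu_to_image R E) (map_mx G f).
  by apply/matrixP => i j; rewrite !mxE psiE.
have [[lG [sG pG] cG] wG] := GC.
exists psi => //; split; first split.
- move=> a x y; have [f <-] := mu_to_image_surj x; have [g <-] := mu_to_image_surj y.
  by rewrite -mu_to_image_linear !psiE lG mu_to_image_linear.
- split=> [y|n y].
    have [f <-] := mu_to_image_surj y.
    by rewrite mu_to_image_star !psiE sG mu_to_image_star.
  have [f <-] := mu_image_mx y; rewrite map_psi /= !map_val_mu => fp [n' chi].
  rewrite map_coord_mu map_mx_compE.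
  have chiW := set_valP chi.
  exact: (ND_mcone_WQ (WQ_comp GC chiW) fp).
- move=> n y; have [f <-] := mu_image_mx y; rewrite map_psi /= !map_val_mu.
  apply: ND_mnorm_le => [|[n' chi]]; first exact: ND_mnorm_ge0.
  rewrite map_coord_mu map_mx_compE.
  exact: (ND_mnorm_WQ _ (WQ_comp GC (set_valP chi))).
apply: wstar_continuousP => _ [h [i [xi [eta [cxi ceta hP]]]] <-].
(* Composition with G turns an index of N(E) into an index of N(D) of the same size, so the same
   vectors xi and eta define the pulled back normal functional. *)
pose i' k : ND_index D := existT _ (projT1 (i k))
  (SigSub (mem_set (WQ_comp GC (set_valP (projT2 (i k)))))).
have [h' h'n h'P] := @ND_normal_exists R D i' xi eta cxi ceta.
have -> : (fun y : mu_image E => h (mu_image_val y)) \o psi =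
    (fun y : mu_image D => h' (mu_image_val y)).
  apply/funext => y; have [f <-] := mu_to_image_surj y.
  rewrite -[LHS]/(h (mu_image_val (psi (mu_to_image f)))) psiE.
  apply: normc_lim_unique; first exact: ((cvg_normcP _ _).1 (hP (mu (G f)))).
  exact: ((cvg_normcP _ _).1 (h'P (mu f))).
by apply: predual_continuous; exists h'.
Qed.

End Lift.

(** * Positive blocks *)

(* [y i] is [u (x i) u] with [u] in [S] and [0 <= u <= 1], written as [u ^ 2 <= u]. *)
Definition approx_unital (R : realType) (S : opspace R) : Prop :=
  forall (I : finType) (x : I -> S) (e : R), 0 < e ->
  exists (u : S) (y : I -> S),
    [/\ os_star u = u,
        forall v, hnorm (os_op u v) ^+ 2 <= Re (ip (os_H S) (os_op u v) v),
        forall i v, os_op (y i) v = os_op u (os_op (x i) (os_op u v)) &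
        forall i, nrm (x i - y i : smos_of_opspace S) <= e].

Section Blocks.
Variables (R : realType) (S : opspace R).
Local Notation H := (os_H S).
Local Notation SS := (smos_of_opspace S).

Section UnitBlock.
Variables (u : S) (us : os_star u = u).
Hypothesis uP : forall v, hnorm (os_op u v) ^+ 2 <= Re (ip H (os_op u v) v).

Lemma unit_contr v : hnorm (os_op u v) <= hnorm v.
Proof.
have := le_trans (uP v) (Re_le_normc _); move=> h.
have {h} := le_trans h (cauchy_schwarz _ _).
have [->|u0] := eqVneq (hnorm (os_op u v)) 0; first by rewrite hnorm_ge0.
by rewrite expr2 ler_pM2l// lt_neqAle eq_sym u0 hnorm_ge0.
Qed.

Lemma nrm_unit : nrm (u : SS) <= 1.
Proof. by apply: nrm_le => // v; rewrite mul1r unit_contr. Qed.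

Definition unit_diag n : 'M[SS]_n := \matrix_(i, j) if i == j then u else 0.

(* [[u, y], [y^*, u]], positive when [y = u x u] with [x] a contraction: it plays
   the role of [[1, x], [x^*, 1]] in a space without unit. *)
Definition unit_block n (y : 'M[SS]_n) : 'M[SS]_(n + n) :=
  block_mx (unit_diag n) y
           (\matrix_(i, j) os_star (y j i)) (unit_diag n).

Lemma block_form n (A B C D : 'M[SS]_n) (v : dsum H (n + n)) (a b : dsum H n) :
  (forall i, v (lshift n i) = a i) -> (forall i, v (rshift n i) = b i) ->
  \sum_i \sum_j ip H (os_op (block_mx A B C D i j) (v j)) (v i) =
  \sum_i \sum_j ip H (os_op (A i j) (a j)) (a i) +
  \sum_i \sum_j ip H (os_op (B i j) (b j)) (a i) +
  (\sum_i \sum_j ip H (os_op (C i j) (a j)) (b i) +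
   \sum_i \sum_j ip H (os_op (D i j) (b j)) (b i)).
Proof.
move=> va vb; rewrite big_split_ord /=; congr (_ + _);
  rewrite -big_split; apply: eq_bigr => i _; rewrite big_split_ord /=;
  congr (_ + _); apply: eq_bigr => j _.
- by rewrite block_mxEul !(va, vb).
- by rewrite block_mxEur !(va, vb).
- by rewrite block_mxEdl !(va, vb).
- by rewrite block_mxEdr !(va, vb).
Qed.

Lemma diag_form n (a : dsum H n) :
  \sum_i \sum_j ip H (os_op (unit_diag n i j) (a j)) (a i) =
  \sum_i ip H (os_op u (a i)) (a i).
Proof.
apply: eq_bigr => i _; rewrite (bigD1 i)//= mxE eqxx big1 ?addr0// => j /negPf ji.
by rewrite mxE eq_sym ji os_op0l ip0l.
Qed.

Lemma star_form n (y : 'M[SS]_n) (a b : dsum H n) :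
  \sum_i \sum_j ip H (os_op ((\matrix_(i, j) os_star (y j i) : 'M[SS]_n) i j) (a j)) (b i) =
  (\sum_i \sum_j ip H (os_op (y i j) (b j)) (a i))^*.
Proof.
rewrite exchange_big rmorph_sum /=; apply: eq_bigr => j _.
rewrite rmorph_sum /=; apply: eq_bigr => i _.
by rewrite mxE os_adjoint os_starK -ipE.
Qed.

(** At a vector with halves a and b the form is <u a, a> + <u b, b> + 2 Re <x u b, u a>, which is at
    least |u a|^2 + |u b|^2 - 2 |u a| |u b| because u^2 <= u and x is a contraction. *)
Lemma unit_block_mcone n (x y : 'M[SS]_n) : mnorm x <= 1 ->
  (forall i j v, os_op (y i j) v = os_op u (os_op (x i j) (os_op u v))) ->
  mcone SS (n + n) (unit_block y).
Proof.
move=> x1 yE; apply: mconeE => [i j|v].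
  have os0 : os_star (0 : S) = 0.
    by have := os_starP (-1) (0 : S) 0; rewrite scaler0 addr0 rmorphN1 scaleN1r addNr.
  have ud (k l : 'I_n) : os_star (if k == l then u else 0) = if l == k then u else 0.
    by rewrite eq_sym; case: eqP.
  rewrite /unit_block; case: (split_ordP i) => k ->; case: (split_ordP j) => l ->.
  - by rewrite !block_mxEul !mxE ud.
  - by rewrite block_mxEdl block_mxEur mxE os_starK.
  - by rewrite block_mxEdl block_mxEur mxE.
  - by rewrite !block_mxEdr !mxE ud.
pose a : dsum H n := fun i => v (lshift n i); pose b : dsum H n := fun i => v (rshift n i).
rewrite (@block_form n _ _ _ _ v a b)// !diag_form star_form; set s := \sum_i \sum_j _.
pose ua : dsum H n := fun i => os_op u (a i).
pose ub : dsum H n := fun i => os_op u (b i).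
have sE : s = \sum_i \sum_j ip H (os_op (x i j) (ub j)) (ua i).
  apply: eq_bigr => i _; apply: eq_bigr => j _.
  by rewrite yE os_adjoint us.
have sle : normc s <= hnorm ua * hnorm ub.
  rewrite sE; apply: le_trans (mnorm_ip x ub ua) _.
  by rewrite mulrC ler_wpM2l ?hnorm_ge0// ler_piMl ?hnorm_ge0.
have ule (c : dsum H n) : hnorm ((fun i => os_op u (c i)) : dsum H n) ^+ 2 <=
    Re (\sum_i ip H (os_op u (c i)) (c i)).
  by rewrite sqr_hnorm_dsum raddf_sum; apply: ler_sum => i _; exact: uP.
have := ule a; have := ule b; rewrite -/ua -/ub.
rewrite !raddfD /=; set p := Re _; set q := Re _ => hb ha.
have := Re_le_normc (- s); rewrite normcN raddfN /=.
have := hnorm_ge0 ua; have := hnorm_ge0 ub; have -> : Re s^* = Re s by case: (s).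
move=> _ _ h; have := sqr_ge0 (hnorm ua - hnorm ub); rewrite sqrrB; lra.
Qed.

Lemma unit_block_entry n (y : 'M[SS]_n) i j : unit_block y (lshift n i) (rshift n j) = y i j.
Proof. by rewrite /unit_block block_mxEur. Qed.

End UnitBlock.

Lemma mconeZ n (x : 'M[SS]_n) (c : R) : 0 <= c -> mcone SS n x ->
  mcone SS n (map_mx ( *:%R c%:C%C) x).
Proof.
move=> c0 xp; apply: mconeE => [i j|v].
  rewrite !mxE -[_ *: _]addr0 os_starP (mcone_star i j xp).
  have -> : os_star (0 : S) = 0.
    by have := os_starP (-1) (0 : S) 0; rewrite scaler0 addr0 rmorphN1 scaleN1r addNr.
  by rewrite addr0; congr (_ *: _); exact: conjR.
under eq_bigr do under eq_bigr do rewrite mxE os_opZl ipZl.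
under eq_bigr do rewrite -mulr_sumr.
rewrite -mulr_sumr; have := mcone_ge0 v xp; rewrite lecE => /andP[_].
by case: (\sum_i _) => a b /= a0; rewrite mul0r subr0 mulr_ge0.
Qed.

End Blocks.

Lemma mx_op_delta (R : realType) n (A : 'M[R[i]]_n) i j :
  ip (dsum (scalar_space R) n) (mx_op A (delta_vec j (1 : scalar_space R)))
    (delta_vec i (1 : scalar_space R)) = A i j.
Proof.
rewrite ip_delta_vecr -[LHS]/(_ * 1^*) rmorph1 mulr1 /mx_op (bigD1 j)//=.
rewrite /delta_vec eqxx mulr1 big1 ?addr0// => k /negPf ->.
by rewrite mulr0.
Qed.

Lemma delta_sum (V : nmodType) (a : V) n : (0 < n)%N ->
  \sum_(0 <= k < n) (if k == 0%N then a else 0) = a.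
Proof.
move=> n0; rewrite big_ltn//= big_nat_cond big1 ?addr0// => k.
by rewrite andbT => /andP[k0 _]; rewrite gtn_eqF.
Qed.

(** * The map mu is bounded below *)

Section MuBounds.
Variables (R : realType) (S : opspace R).
Local Notation H := (os_H S).
Local Notation SS := (smos_of_opspace S).

Lemma mu_dual_linear : linear (@mu_dual R SS).
Proof. by move=> a f g; exact: (@mu_to_image_linear R (dual_wsmos SS) a f g). Qed.

Lemma mu_dual_surj (y : ddual SS) : exists f, mu_dual f = y.
Proof. exact: (@mu_to_image_surj R (dual_wsmos SS)). Qed.

Lemma ddual_mnormE n (f : 'M[dualT SS]_n) :
  mnorm (map_mx (@mu_dual R SS) f) = ND_mnorm (map_mx (@mu R (dual_wsmos SS)) f).
Proof. by rewrite /= map_val_mu. Qed.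

Lemma ddual_nrmE (f : dualT SS) :
  nrm (mu_dual f) = ND_mnorm (const_mx (@mu R (dual_wsmos SS) f) : 'M_1).
Proof. by rewrite /nrm -map_const_mx ddual_mnormE map_const_mx. Qed.

Lemma ddual_nrm_le (f : dualT SS) : nrm (mu_dual f) <= nrm (f : dual SS).
Proof.
by rewrite ddual_nrmE -map_const_mx; apply: mu_mnorm_le; exact: dual_nrm_ge0.
Qed.

Lemma ddual_nrm_WQ (f : dualT SS) n (chi : dualT SS -> Mn R n.+1) :
  @WQ R (dual_wsmos SS) n.+1 chi -> nrm (chi f : Mn R n.+1) <= nrm (mu_dual f).
Proof.
move=> /(@ND_mnorm_WQ R (dual_wsmos SS) n 1 (const_mx f)).
by rewrite !map_const_mx -ddual_nrmE.
Qed.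

Section CutDown.
Variables (u x y : S).
Hypotheses (us : os_star u = u)
  (uP : forall v, hnorm (os_op u v) ^+ 2 <= Re (ip H (os_op u v) v))
  (x1 : nrm (x : SS) <= 1)
  (yE : forall v, os_op y v = os_op u (os_op x (os_op u v))).

Lemma cut_down_le1 : nrm (y : SS) <= 1.
Proof.
apply: nrm_le => // v; rewrite yE mul1r.
apply: le_trans (unit_contr uP _) _; apply: le_trans (nrmP _ _) _.
by apply: le_trans (ler_piMl (hnorm_ge0 _) x1) _; exact: unit_contr.
Qed.

(* Each of the four entries of the positive block has norm at most 1, so the block
   divided by 4 is a contraction. *)
Lemma cut_down_WQ : exists2 chi : dualT SS -> Mn R 2, @WQ R (dual_wsmos SS) 2 chi &
  exists i j, forall f : dualT SS, f y = (4%:R : R)%:C%C * chi f i j.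
Proof.
pose X := unit_block u (const_mx y : 'M[SS]_1).
have Xp : mcone SS (1 + 1) X.
  apply: (@unit_block_mcone _ _ _ us uP _ (const_mx x)) => // i j v.
  by rewrite !mxE yE.
have Xe i j : nrm (X i j) <= 1.
  rewrite /X /unit_block; case: (split_ordP i) => k ->; case: (split_ordP j) => l ->.
  - by rewrite block_mxEul mxE !ord1 eqxx nrm_unit.
  - by rewrite block_mxEur mxE cut_down_le1.
  - by rewrite block_mxEdl !mxE -[os_star y]/(star (y : SS)) nrm_star cut_down_le1.
  - by rewrite block_mxEdr mxE !ord1 eqxx nrm_unit.
have X4 : mnorm X <= 4%:R.
  apply: le_trans (mnorm_le_entries X) _.
  apply: (@le_trans _ _ (\sum_(i < 1 + 1) \sum_(j < 1 + 1) 1)).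
    by apply: ler_sum => i _; apply: ler_sum => j _; exact: Xe.
  by rewrite !sumr_const !card_ord -mulrnA.
pose c : R := 4%:R^-1; have c0 : 0 <= c by rewrite invr_ge0.
exists (evmx (map_mx ( *:%R c%:C%C) X : 'M[SS]_(1 + 1))).
  apply: evmx_WQ; first exact: mconeZ.
  apply: le_trans (mnormZ_le _ _) _; rewrite normcR ger0_norm// /c.
  by rewrite mulrC ler_pdivrMr// mul1r.
exists (lshift 1 (@ord0 0) : 'I_(1 + 1)), (rshift 1 (@ord0 0) : 'I_(1 + 1)) => f.
rewrite mxE mxE dualTZ mulrA -rmorphM /= divff ?pnatr_eq0//.
by rewrite unit_block_entry mxE rmorph1 mul1r.
Qed.

Lemma cut_down_bound (f : dualT SS) : normc (f y) <= 4%:R * nrm (mu_dual f).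
Proof.
have [chi chiW [i [j ->]]] := cut_down_WQ.
rewrite Normc.normcM normcR ger0_norm// ler_wpM2l//.
apply: le_trans (ddual_nrm_WQ f chiW).
rewrite -[X in normc X]mx_op_delta; apply: le_trans (mx_op_ip_le _ _ _) _.
by rewrite !hnorm_delta_vec hnorm_scalar Normc.normc1 !mulr1.
Qed.

Lemma cut_down_predual : exists2 p, predual (ddual SS) p &
  forall f : dualT SS, f y = (4%:R : R)%:C%C * p (mu_dual f).
Proof.
have [chi chiW [i [j chiE]]] := cut_down_WQ.
pose idx : ND_index (dual_wsmos SS) := existT _ 1%N (SigSub (mem_set chiW)).
(* Sequences supported at k = 0 make a single matrix entry a normal functional; the partial sums are
   constant from n = 1 on, the one at n = 0 being empty. *)
pose d (l : 'I_2) (k : nat) : dsum (scalar_space R) 2 :=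
  if k == 0%N then delta_vec l (1 : scalar_space R) else 0.
have cd l : cvgn (series (fun k => hnorm (d l k) ^+ 2)).
  apply: (cvgP (hnorm (delta_vec l (1 : scalar_space R)) ^+ 2)); apply: cvg_near_cst.
  exists 1%N => // n n0; rewrite /series /= -[RHS](delta_sum _ n0).
  by apply: eq_bigr => k _; rewrite /d; case: eqP => // _; rewrite hnorm0 expr0n.
have [h hn hP] := @ND_normal_exists R (dual_wsmos SS) (fun _ => idx) (d j) (d i) (cd j) (cd i).
exists (fun z : ddual SS => h (mu_image_val z)); first by exists h.
move=> f; rewrite chiE; congr (_ * _); rewrite -mx_op_delta /=.
apply: normc_lim_unique; last exact: ((cvg_normcP _ _).1 (hP _)).
move=> e e0; exists 1%N => n n0.
rewrite /series /= (eq_bigr (fun k => if k == 0%N then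
  ip _ (mx_op (chi f) (delta_vec j (1 : scalar_space R))) (delta_vec i (1 : scalar_space R))
  else 0)) => [|k _]; last first.
  rewrite /d; case: (k == 0%N); [by []|exact: (@ip0r _ (dsum (scalar_space R) 2))].
by rewrite delta_sum// subrr Normc.normc0.
Qed.

End CutDown.

Hypothesis S_au : approx_unital S.

Lemma approx_unital1 (x : S) (e : R) : 0 < e -> exists u y : S,
  [/\ os_star u = u,
      forall v, hnorm (os_op u v) ^+ 2 <= Re (ip H (os_op u v) v),
      forall v, os_op y v = os_op u (os_op x (os_op u v)) &
      nrm (x - y : SS) <= e].
Proof.
move=> e0; have [u [y [us uP yE xy]]] := @S_au unit (fun _ => x) e e0.
by exists u, (y tt); split=> // v; exact: yE.
Qed.

(** The constant 4 of [cut_down_bound] passes from the elements u x u to all x because f is norm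
    continuous; so mu is bounded below, hence injective. *)
Lemma mu_dual_bound (f : dualT SS) (x : SS) :
  normc (f x) <= 4%:R * nrm (mu_dual f) * nrm x.
Proof.
have mu0 : 0 <= nrm (mu_dual f) by rewrite ddual_nrmE; exact: ND_mnorm_ge0.
have [f0 f0P fM] := dualT_bound f.
have le1 (z : SS) : nrm z <= 1 -> normc (f z) <= 4%:R * nrm (mu_dual f).
  move=> z1; apply/ler_addgt0Pl => e e0.
  have e'0 : 0 < e / (f0 + 1) by rewrite divr_gt0// ltr_wpDl.
  have [u [y [us uP yE zy]]] := approx_unital1 z e'0.
  have -> : f z = f (z - y) + f y by rewrite dualTB; ring.
  apply: le_trans (le_normcD _ _) _; apply: lerD; last exact: (cut_down_bound us uP z1 yE).
  apply: le_trans (fM _) _; apply: le_trans (ler_wpM2l f0P zy) _.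
  by rewrite mulrA ler_pdivrMr ?ltr_wpDl//; have := ltW e0; nra.
have [x0|x0] := eqVneq (nrm x) 0.
  by rewrite (nrm_eq0 x0) dualT0 Normc.normc0 nrm0 mulr0.
have xp : 0 < nrm x by rewrite lt_neqAle eq_sym x0 nrm_ge0.
rewrite -ler_pdivrMr// mulrC -[(nrm x)^-1]ger0_norm ?invr_ge0 ?nrm_ge0//.
rewrite -normcR -Normc.normcM -dualTZ; apply: le1.
apply: le_trans (nrmZ_le _ _) _.
by rewrite normcR ger0_norm ?invr_ge0 ?nrm_ge0// mulVf.
Qed.

Lemma mu_dual_inj : injective (@mu_dual R SS).
Proof.
move=> f g fg; apply: dualT_eqP => x; apply/eqP; rewrite -subr_eq0.
pose h : dualT SS := (-1) *: g + f.
have -> : f x - g x = h x by rewrite -[RHS]/(-1 * g x + f x); ring.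
have h0 : mu_dual h = 0 by rewrite mu_dual_linear fg scaleN1r addNr.
have := mu_dual_bound h x; rewrite h0.
have -> : nrm (0 : ddual SS) = 0.
  apply/le_anti/andP; split; last first.
    by rewrite -h0 ddual_nrmE; exact: ND_mnorm_ge0.
  apply: ND_mnorm_le => // i.
  rewrite (_ : map_mx _ _ = const_mx (0 : Mn R (ND_size i))).
    by rewrite -/(nrm (0 : Mn R (ND_size i))) (@nrm0 R (mx_opspace R (ND_size i))).
  by apply/matrixP => k l; rewrite !mxE.
rewrite mulr0 mul0r => hx; apply/eqP/Normc.eq0_normc/le_anti.
by rewrite hx normc_ge0.
Qed.

End MuBounds.

(** * Normal functionals on T^d as evaluations on T^* *)

Section NormalFunctionals.
Variables (R : realType) (T : opspace R).
Local Notation TT := (smos_of_opspace T).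
Hypothesis T_complete : norm_complete (fun x : T => nrm (x : TT)).

Lemma normal_eval (h : ND (dual_wsmos TT) -> R[i]) : ND_normal h ->
  exists z : TT, forall f : dualT TT, h (mu (f : dual_wsmos TT)) = f z.
Proof.
move=> [i [xi [eta [cxi ceta hP]]]].
have /choice[z zE] : forall k, exists z : TT, forall f : dualT TT,
    ip _ (mx_op (mu (f : dual_wsmos TT) (i k)) (xi k)) (eta k) = f z.
  move=> k; have [X XE] := WQ_evmx (set_valP (projT2 (i k))).
  exists (\sum_a \sum_b ((xi k b : R[i]) * (eta k a : R[i])^*) *: X a b) => f.
  rewrite /= XE /dsum_ip /mx_op /= /scalar_ip dualT_sum; apply: eq_bigr => a _.
  rewrite mulr_suml dualT_sum; apply: eq_bigr => b _.
  by rewrite mxE dualTZ; ring.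
(* X itself is not known to be a contraction; but its evaluation map is contractive on functionals,
   and these determine the norm of [z k]. *)
have z_le k : nrm (z k) <= hnorm (xi k) * hnorm (eta k).
  apply: nrm_le_functionals => [|f]; first by rewrite mulr_ge0 ?hnorm_ge0.
  rewrite -zE; apply: le_trans (mx_op_ip_le _ _ _) _.
  rewrite -mulrA mulrC ler_wpM2l ?mulr_ge0 ?hnorm_ge0//.
  have [[_ _ /(_ 1%N (const_mx f)) chif] _] := set_valP (projT2 (i k)).
  by rewrite -[mu _ _]/(val (projT2 (i k)) f) {1}/nrm -map_const_mx.
have [||l lP] := @dominated_series R TT (@nrm R TT) (@nrm0 R T) (@nrmN R T)
    (@nrmD R T) T_complete z (fun k => 1 * (hnorm (xi k) ^+ 2 + hnorm (eta k) ^+ 2)).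
- move=> k; apply: normal_dominated; rewrite ?hnorm_ge0 ?ler01// mul1r.
  exact: z_le.
- exact: cvg_series_scaled_sum.
exists l => f; apply: normc_lim_unique; first exact: ((cvg_normcP _ _).1 (hP _)).
move=> e e0; have [M M0 fM] := dualT_bound f.
have e'0 : 0 < e / (M + 1) by rewrite divr_gt0// ltr_wpDl.
have [N lN] := lP _ e'0; exists N => n /lN {}lN.
rewrite /series /= (eq_bigr (fun k => f (z k))) => [|k _]; last exact: zE.
rewrite -dualT_sum -dualTB; apply: le_lt_trans (fM _) _.
apply: le_lt_trans (ler_wpM2l M0 (ltW lN)) _.
by rewrite mulrA ltr_pdivrMr ?ltr_wpDl//; nra.
Qed.

Lemma mu_dual_continuous : wstar_continuous (dual_wsmos TT) (ddual TT) (@mu_dual R TT).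
Proof.
apply: wstar_continuousP => _ [h /normal_eval[z zE] <-].
rewrite (_ : _ \o _ = (fun f : dualT TT => f z)); last by apply/funext => f; rewrite /= zE.
by apply: (@predual_continuous R (dual_wsmos TT)); exists z.
Qed.

End NormalFunctionals.

(** * Recovering the predual map *)

Lemma ddual_mconeE (R : realType) (S : opspace R) n
    (f : 'M[dualT (smos_of_opspace S)]_n) :
  mcone (ddual S) n (map_mx (@mu_dual R S) f) =
  ND_mcone (map_mx (@mu R (dual_wsmos S)) f).
Proof. by rewrite -map_val_mu. Qed.

Lemma mu_dual_star (R : realType) (S : opspace R) (f : dualT (smos_of_opspace S)) :
  mu_dual (dual_star f) = star (mu_dual f).
Proof. exact: esym (mu_to_image_star (f : dual_wsmos (smos_of_opspace S))). Qed.

Section Predual.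
Variables (R : realType) (S T : opspace R).
Local Notation SS := (smos_of_opspace S).
Local Notation TT := (smos_of_opspace T).
Local Notation HS := (os_H S).
Local Notation HT := (os_H T).
Hypothesis S_au : approx_unital S.

Variables (psi : ddual TT -> ddual SS) (G : dualT TT -> dualT SS).
Hypothesis psiC : CCp (ddual TT) (ddual SS) psi.
Hypothesis psiG : forall f, mu_dual (G f) = psi (mu_dual f).

(** The 4 comes from mu on S^*, which is only bounded below; psi and mu on T^* do not increase
    norms. *)
Lemma lift_bound (f : dualT TT) (x : SS) :
  normc (G f x) <= 4%:R * nrm (f : dual TT) * nrm x.
Proof.
apply: le_trans (mu_dual_bound S_au _ _) _.
rewrite ler_wpM2r ?nrm_ge0// ler_wpM2l// psiG.
apply: le_trans (ddual_nrm_le f).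
have [_ _ /(_ 1%N (const_mx (mu_dual f)))] := psiC.
by rewrite map_const_mx.
Qed.

Lemma lift_linear (a : R[i]) (f g : dualT TT) : G (a *: f + g) = a *: G f + G g.
Proof.
have [lpsi _ _] := psiC.
by apply: (mu_dual_inj S_au); rewrite mu_dual_linear !psiG mu_dual_linear lpsi.
Qed.

Lemma lift_star (f : dualT TT) : G (dual_star f) = dual_star (G f).
Proof.
have [_ [spsi _] _] := psiC; apply: (mu_dual_inj S_au).
by rewrite psiG !mu_dual_star spsi psiG.
Qed.

Lemma map_lift n (F : 'M[dualT TT]_n) :
  map_mx (@mu_dual R SS) (map_mx G F) = map_mx psi (map_mx (@mu_dual R TT) F).
Proof. by apply/matrixP => i j; rewrite !mxE psiG. Qed.

Section Transpose.
Variable phi : SS -> TT.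
Hypothesis Gphi : forall f x, G f x = f (phi x).

Lemma transpose_linear : linear phi.
Proof.
move=> a x y; apply: vector_functional_sep => f.
by rewrite -Gphi dualTD dualTZ !Gphi -dualTZ -dualTD.
Qed.

Lemma transpose_star x : phi (os_star x) = os_star (phi x).
Proof.
apply: vector_functional_sep => f; rewrite -Gphi.
have := lift_star (dual_star f); rewrite dual_starK => ->.
by rewrite /= os_starK Gphi /= conjCK.
Qed.

(* Evaluating [G] at the positive matrix of functionals [<. v_l, v_k>] and pairing
   with the unit vectors returns the quadratic form of [phi x] at [v]. *)
Lemma transpose_mcone n (x : 'M[SS]_n) : mcone SS n x -> mcone TT n (map_mx phi x).
Proof.
move=> xp; apply: mconeE => [i j|v].
  by rewrite !mxE -transpose_star (mcone_star i j xp).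
(* N(D) has only blocks of size at least 1, so the empty matrix is treated apart. *)
case: n x xp v => [|n] x xp v; first by rewrite big_ord0.
pose F : 'M[dualT TT]_n.+1 := \matrix_(k, l) vector_functional (v l) (v k).
have Fp : ND_mcone (map_mx (@mu R (dual_wsmos SS)) (map_mx G F)).
  have := mu_mcone (mcone_vector_functional v : mcone (dual_wsmos TT) _ F).
  rewrite -!ddual_mconeE map_lift => Fp.
  by have [_ [_ psip] _] := psiC; exact: psip Fp.
(* Evaluation at x belongs to [WQ] once x is scaled to a contraction; the added 1 allows for norm
   0. *)
pose c : R := (mnorm x + 1)^-1.
have x1 : 0 < mnorm x + 1 by rewrite ltr_wpDl// mnorm_ge0.
have c0 : 0 < c by rewrite invr_gt0.
have cW : @WQ R (dual_wsmos SS) n.+1 (evmx (map_mx ( *:%R c%:C%C) x : 'M[SS]_n.+1)).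
  apply: evmx_WQ; first by apply: mconeZ => //; exact: ltW.
  apply: le_trans (mnormZ_le _ _) _; rewrite normcR ger0_norm ?(ltW c0)//.
  rewrite -(mulVf (lt0r_neq0 x1)).
  by rewrite ler_wpM2l ?(ltW c0)// lerDl.
have := ND_mcone_WQ cW Fp.
move=> /(@mcone_ge0 R (mx_opspace R n.+1) n.+1 _
  (fun l => delta_vec l (1 : scalar_space R))).
under eq_bigr do under eq_bigr do rewrite mxE [os_op _ _]/(mx_op _ _) mx_op_delta.
rewrite (_ : \sum_i _ = c%:C%C *
    \sum_i \sum_j ip HT (os_op (map_mx phi x i j) (v j)) (v i)).
  by rewrite pmulr_rge0 ?ltcR// lecE => /andP[].
rewrite mulr_sumr; apply: eq_bigr => i _; rewrite mulr_sumr; apply: eq_bigr => j _.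
rewrite /evmx [LHS]mxE [map_mx _ F _ _]mxE [X in dual_fun _ X]mxE dualTZ Gphi.
by rewrite [map_mx _ x _ _]mxE mxE.
Qed.

(** A provisional bound: it makes phi continuous, so that [transpose_contr] can pass from u x u to
    x. *)
Lemma transpose_bound x : nrm (phi x) <= 4%:R * nrm x.
Proof.
apply: nrm_le_functionals => [|f]; first by rewrite mulr_ge0 ?nrm_ge0.
by rewrite -Gphi mulrAC lift_bound.
Qed.

(** No factor 4 appears: u is itself a positive contraction, so evaluation at u is in [WQ], and the
    vector functional of a has norm at most |a|^2. *)
Lemma transpose_unit (u : S) (a : HT) : os_star u = u ->
  (forall v, hnorm (os_op u v) ^+ 2 <= Re (ip HS (os_op u v) v)) ->
  Re (ip HT (os_op (phi u) a) a) <= hnorm a ^+ 2.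
Proof.
move=> us uP; apply: le_trans (Re_le_normc _) _.
rewrite -[ip HT _ _]/(vector_functional a a (phi u)) -Gphi.
set f := vector_functional a a.
have uW : @WQ R (dual_wsmos SS) 1 (evmx (const_mx u : 'M[SS]_1)).
  apply: evmx_WQ; last exact: nrm_unit.
  apply: mconeE => [i j|v]; first by rewrite !mxE.
  rewrite !big_ord1 mxE; apply: le_trans (uP _); exact: sqr_ge0.
apply: (@le_trans _ _ (nrm (mu_dual (G f)))); last first.
  rewrite psiG; have [_ _ /(_ 1%N (const_mx (mu_dual f)))] := psiC.
  rewrite map_const_mx => h; apply: le_trans h _.
  apply: le_trans (ddual_nrm_le f) _; rewrite expr2.
  exact: nrm_vector_functional.
apply: le_trans (ddual_nrm_WQ (G f) uW).
have -> : G f u = evmx (const_mx u : 'M[SS]_1) (G f) ord0 ord0 by rewrite !mxE.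
rewrite -[X in normc X]mx_op_delta; apply: le_trans (mx_op_ip_le _ _ _) _.
by rewrite !hnorm_delta_vec hnorm_scalar Normc.normc1 !mulr1.
Qed.

(** Positivity of the image of the block, with phi(u) <= 1 on the diagonal, reads 0 <= |a|^2 + |b|^2
    + 2 Re <phi(y) b, a>; choosing the lengths and the phase of a and b gives the bound. *)
Lemma transpose_cut_down (u : S) n (x y : 'M[SS]_n) (v w : dsum HT n) :
  os_star u = u ->
  (forall v, hnorm (os_op u v) ^+ 2 <= Re (ip HS (os_op u v) v)) ->
  mnorm x <= 1 ->
  (forall i j v, os_op (y i j) v = os_op u (os_op (x i j) (os_op u v))) ->
  normc (ip (dsum HT n) (amp (@os_op R T) (map_mx phi y) v) w) <= hnorm v * hnorm w.
Proof.
move=> us uP x1 yE.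
have Pp := transpose_mcone (unit_block_mcone us uP x1 yE).
have quad (a b : dsum HT n) : 0 <= hnorm a ^+ 2 + hnorm b ^+ 2 +
    2%:R * Re (ip (dsum HT n) (amp (@os_op R T) (map_mx phi y) b) a).
  pose c : dsum HT (n + n) := fun i =>
    match fintype.split i with inl i => a i | inr i => b i end.
  have cl i : c (lshift n i) = a i by rewrite /c -[lshift n i]/(unsplit (inl i)) unsplitK.
  have cr i : c (rshift n i) = b i by rewrite /c -[rshift n i]/(unsplit (inr i)) unsplitK.
  have := mcone_ge0 c Pp; rewrite lecE => /andP[_].
  rewrite /unit_block map_block_mx (@block_form R T n _ _ _ _ c a b cl cr).
  have -> : (map_mx phi (unit_diag u n) : 'M[TT]_n) = unit_diag (phi u) n.
    apply/matrixP => i j; rewrite !mxE; case: eqP => // _.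
    exact: (linear0 transpose_linear).
  have -> : (map_mx phi (\matrix_(i, j) os_star (y j i)) : 'M[TT]_n) =
      \matrix_(i, j) os_star (map_mx phi y j i).
    by apply/matrixP => i j; rewrite !mxE transpose_star.
  rewrite !diag_form star_form -!ip_amp !raddfD /= Re_conj.
  have ule (d : dsum HT n) : \sum_i Re (ip HT (os_op (phi u) (d i)) (d i)) <= hnorm d ^+ 2.
    by rewrite sqr_hnorm_dsum; apply: ler_sum => i _; exact: transpose_unit.
  rewrite !raddf_sum /=.
  have := ule a; have := ule b.
  lra.
have bA := @amp_bounded R T HT (@os_op R T) n (map_mx phi y) (@os_bounded R T).
have [v0|v0] := eqVneq (hnorm v) 0.
  by rewrite (hnorm_eq0 v0) (bounded_op0 bA) ip0l Normc.normc0 hnorm0 mul0r.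
have [w0|w0] := eqVneq (hnorm w) 0.
  by rewrite (hnorm_eq0 w0) ip0r Normc.normc0 hnorm0 mulr0.
have vp : 0 < hnorm v by rewrite lt_neqAle eq_sym v0 hnorm_ge0.
have wp : 0 < hnorm w by rewrite lt_neqAle eq_sym w0 hnorm_ge0.
have [c c1 cE] := phase (ip (dsum HT n) (amp (@os_op R T) (map_mx phi y) v) w).
(* Both vectors get length |v| |w| and c makes the cross term real and negative, so the inequality
   becomes 0 <= 2 |v|^2 |w|^2 - 2 |v| |w| |s|. *)
have := quad ((hnorm v)%:C%C *: w) (((hnorm w)%:C%C * c) *: v).
rewrite !hnormZ Normc.normcM c1 !normcR !ger0_norm ?hnorm_ge0// mulr1.
have -> : amp (@os_op R T) (map_mx phi y) (((hnorm w)%:C%C * c) *: v) =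
    ((hnorm w)%:C%C * c) *: amp (@os_op R T) (map_mx phi y) v.
  have [lA _] := bA; have := lA ((hnorm w)%:C%C * c) v 0.
  by rewrite (bounded_op0 bA) !addr0.
rewrite ipZl ipZr conjR; set s := ip _ _ _ in cE *.
have -> : (hnorm w)%:C%C * c * ((hnorm v)%:C%C * s) = (hnorm w * hnorm v)%:C%C * (c * s).
  by rewrite rmorphM /=; ring.
have -> : Re ((hnorm w * hnorm v)%:C%C * (c * s)) = hnorm w * hnorm v * Re (c * s).
  by case: (c * s) => p q /=; rewrite mul0r subr0.
rewrite cE => h; rewrite -(ler_pM2l (mulr_gt0 vp wp)); nra.
Qed.

(** All entries of x are cut down by the same u; this is why [approx_unital] is stated for finite
    families. *)
Lemma transpose_contr n (x : 'M[SS]_n) : mnorm x <= 1 -> mnorm (map_mx phi x) <= 1.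
Proof.
move=> x1; apply/ler_addgt0Pl => e e0.
(* There are n^2 entries, each moved by at most 4 times the tolerance under phi; the 1 covers n =
   0. *)
have d0 : 0 < e / (4 * (n * n)%:R + 1) by rewrite divr_gt0// ltr_wpDl// mulr_ge0.
have [u [y [us uP yE xy]]] := @S_au _ (fun ij : 'I_n * 'I_n => x ij.1 ij.2) _ d0.
pose Y : 'M[SS]_n := \matrix_(i, j) y (i, j).
apply: mnorm_le_ip => [|v w]; first by rewrite addr_ge0// ltW.
have YE i j v' : os_op (Y i j) v' = os_op u (os_op (x i j) (os_op u v')).
  by rewrite mxE yE.
have := @transpose_cut_down u n x Y v w us uP x1 YE; rewrite ip_amp => hY.
have := mnorm_ip (\matrix_(i, j) (phi (x i j) - phi (Y i j)) : 'M[TT]_n) v w.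
rewrite (_ : \sum_i _ = \sum_i \sum_j ip HT (os_op (map_mx phi x i j) (v j)) (w i) -
    \sum_i \sum_j ip HT (os_op (map_mx phi Y i j) (v j)) (w i)); last first.
  rewrite -sumrB; apply: eq_bigr => i _; rewrite -sumrB; apply: eq_bigr => j _.
  by rewrite !mxE os_opBl ipBl.
set s := \sum_i _; set t := \sum_i _ in hY *; set D := mnorm _ => hD.
have -> : s = (s - t) + t by ring.
apply: le_trans (le_normcD _ _) _; rewrite !mulrDl mul1r; apply: lerD => //.
apply: le_trans hD _; rewrite -!mulrA ler_wpM2r ?mulr_ge0 ?hnorm_ge0//.
apply: le_trans (mnorm_le_entries _) _.
apply: (@le_trans _ _ (\sum_(i < n) \sum_(j < n) 4%:R * (e / (4 * (n * n)%:R + 1)))).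
  apply: ler_sum => i _; apply: ler_sum => j _; rewrite mxE.
  have lphi := transpose_linear.
  have -> : phi (x i j) - phi (Y i j) = phi (x i j - Y i j).
    have := lphi (-1) (Y i j) (x i j); rewrite !scaleN1r => e1.
    by rewrite [x i j - _]addrC e1 addrC.
  apply: le_trans (transpose_bound _) _; rewrite ler_wpM2l// mxE.
  exact: (xy (i, j)).
rewrite !sumr_const !card_ord -mulrnA -[_ *+ _]mulr_natr; set k := (n * n)%:R.
have k0 : 0 <= k by rewrite ler0n.
rewrite (_ : 4 * (e / _) * k = e * (4 * k) / (4 * k + 1)); last by ring.
by rewrite ler_pdivrMr ?ltr_wpDl ?mulr_ge0// ler_wpM2l ?(ltW e0)// lerDl.
Qed.

Lemma transpose_CCp : CCp SS TT phi.
Proof.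
split; first exact: transpose_linear.
  by split; [exact: transpose_star|exact: transpose_mcone].
move=> n x; apply/ler_addgt0Pl => e e0.
have Mp : 0 < e + mnorm x by rewrite ltr_pwDl// mnorm_ge0.
pose c : R[i] := (e + mnorm x)^-1%:C%C.
have x1 : mnorm (map_mx ( *:%R c) x : 'M[SS]_n) <= 1.
  apply: le_trans (mnormZ_le _ _) _.
  by rewrite normcR ger0_norm ?invr_ge0 ?(ltW Mp)// mulrC ler_pdivrMr// mul1r lerDr (ltW e0).
have := transpose_contr x1.
have -> : map_mx phi x = map_mx ( *:%R (e + mnorm x)%:C%C)
    (map_mx phi (map_mx ( *:%R c) x : 'M[SS]_n)) :> 'M[TT]_n.
  apply/matrixP => i j; rewrite !mxE.
  have -> : phi (c *: x i j) = c *: phi (x i j).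
    have := transpose_linear c (x i j) 0.
    by rewrite (linear0 transpose_linear) !addr0.
  by rewrite scalerA /c -rmorphM /= divff ?gt_eqF// scale1r.
move=> h; apply: le_trans (mnormZ_le _ _) _.
by rewrite normcR ger0_norm ?(ltW Mp)// ler_piMr// ltW.
Qed.

End Transpose.
End Predual.

(** * Existence of the predual map *)

Section TransposeExists.
Variables (R : realType) (S T : opspace R).
Local Notation SS := (smos_of_opspace S).
Local Notation TT := (smos_of_opspace T).
Hypothesis S_au : approx_unital S.
Hypothesis T_complete : norm_complete (fun x : T => nrm (x : TT)).

Variables (psi : ddual TT -> ddual SS) (G : dualT TT -> dualT SS).
Hypothesis psiC : CCw (ddual TT) (ddual SS) psi.
Hypothesis psiG : forall f, mu_dual (G f) = psi (mu_dual f).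

Lemma transpose_cut_down_exists (u x y : S) : os_star u = u ->
  (forall v, hnorm (os_op u v) ^+ 2 <= Re (ip (os_H S) (os_op u v) v)) ->
  nrm (x : SS) <= 1 -> (forall v, os_op y v = os_op u (os_op x (os_op u v))) ->
  exists z : TT, forall f, G f y = f z.
Proof.
move=> us uP x1 yE; have [p pp pE] := cut_down_predual us uP x1 yE.
have [psiCC psiW] := psiC.
have [||z zE] := @wstar_form_eval R TT (fun f => p (mu_dual (G f))).
(* An element of the predual of S^d is given here only as a function, so linearity is read off G
   through [pE], after cancelling the 4. *)
- move=> a f g; have GL := lift_linear S_au psiCC psiG.
  have c4 : ((4%:R : R)%:C%C : R[i]) != 0 by rewrite eq_complex /= pnatr_eq0.
  apply: (mulfI c4); rewrite -pE GL -[LHS]/(a * G f y + G g y) !pE.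
  by rewrite -[_ *: _]/(a * p (mu_dual (G f))); ring.
- rewrite (_ : (fun f => _) = p \o (psi \o @mu_dual R TT)); last first.
    by apply/funext => f; rewrite psiG.
  have cpsi := wstar_continuous_comp (mu_dual_continuous T_complete) psiW.
  move=> f; apply: (@continuous_comp (wstar_top (dual_wsmos TT)) (wstar_top (ddual SS)) R[i]^o
    (psi \o @mu_dual R TT) p); first exact: cpsi.
  exact: (predual_continuous pp).
by exists ((4%:R : R)%:C%C *: z) => f; rewrite pE zE dualTZ.
Qed.

(** Cut-downs y_n tend to x, and the points z_n that represent them satisfy |z_m - z_n| <= 4 |y_m -
    y_n|; so they converge in T, and the limit represents x. *)
Lemma transpose_exists : exists phi : SS -> TT, forall f x, G f x = f (phi x).
Proof.
suff ex x : exists z : TT, forall f, G f x = f z.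
  by have [phi phiE] := choice ex; exists phi.
have [psiCC _] := psiC.
wlog x1 : x / nrm (x : SS) <= 1.
  move=> h; have x1 : 0 < nrm (x : SS) + 1 by rewrite ltr_wpDl// nrm_ge0.
  have [|z zE] := h ((nrm (x : SS) + 1)^-1%:C%C *: x).
    apply: le_trans (nrmZ_le _ _) _; rewrite normcR ger0_norm ?invr_ge0 ?(ltW x1)//.
    by rewrite -[leRHS](mulVf (lt0r_neq0 x1)) ler_wpM2l ?invr_ge0 ?(ltW x1)// lerDl.
  exists ((nrm (x : SS) + 1)%:C%C *: z) => f.
  by rewrite dualTZ -zE dualTZ mulrA -rmorphM /= divff ?gt_eqF// mul1r.
have /choice[y yP] : forall n, exists y : SS, nrm (x - y) <= n.+1%:R^-1 /\
    exists z : TT, forall f, G f y = f z.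
  move=> n; have n0 : 0 < n.+1%:R^-1 :> R by rewrite invr_gt0.
  have [u [y [us uP yE xy]]] := approx_unital1 S_au x n0.
  by exists y; split=> //; exact: transpose_cut_down_exists yE.
have /choice[z zE] : forall n, exists z : TT, forall f, G f (y n) = f z.
  by move=> n; have [_] := yP n.
have y_lim e : 0 < e -> exists N : nat, forall n, (N <= n)%N -> nrm (x - y n) < e.
  move=> e0; have [N Ne] := ltr_add_invr e0.
  exists N => n Nn; have [h _] := yP n; apply: le_lt_trans h _.
  move: Ne; rewrite add0r; apply: le_lt_trans.
  by rewrite lef_pV2 ?posrE ?ltr0n// ler_nat.
have [e e0|l lP] := @T_complete z.
  have e8 : 0 < e / 8%:R / 2%:R by rewrite !divr_gt0.
  have [N yN] := y_lim _ e8; exists N => m n Nm Nn.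
  apply: (@le_lt_trans _ _ (4%:R * (e / 8%:R))); last by lra.
  apply: nrm_le_functionals => [|f]; first by rewrite mulr_ge0 ?divr_ge0 ?ltW.
  rewrite dualTB -!zE -dualTB; apply: le_trans (lift_bound S_au psiCC psiG _ _) _.
  rewrite [leLHS]mulrAC ler_wpM2r ?dual_nrm_ge0//.
  rewrite ler_wpM2l//.
  have -> : y m - y n = (x - y n) - (x - y m) by rewrite opprB [RHS]addrC subrKA.
  apply: le_trans (nrmD _ _) _; rewrite nrmN [leRHS]splitr.
  by apply: lerD; apply/ltW/yN.
exists l => f; apply: (@normc_lim_unique R (fun n => f (z n))) => e e0.
  have [M M0 fM] := dualT_bound (G f).
  have e'0 : 0 < e / (M + 1) by rewrite divr_gt0// ltr_wpDl.
  have [N yN] := y_lim _ e'0; exists N => n /yN {}yN.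
  rewrite -zE -dualTB; apply: le_lt_trans (fM _) _; rewrite nrmB.
  apply: le_lt_trans (ler_wpM2l M0 (ltW yN)) _.
  by rewrite mulrA ltr_pdivrMr ?ltr_wpDl//; nra.
have [M M0 fM] := dualT_bound f.
have e'0 : 0 < e / (M + 1) by rewrite divr_gt0// ltr_wpDl.
have [N lN] := lP _ e'0; exists N => n /lN {}lN.
rewrite -dualTB; apply: le_lt_trans (fM _) _.
apply: le_lt_trans (ler_wpM2l M0 (ltW lN)) _.
by rewrite mulrA ltr_pdivrMr ?ltr_wpDl//; nra.
Qed.

End TransposeExists.

(** * Square roots and faithful representations of C*-algebras *)

Section NormedStarAlgebra.
Variables (R : realType) (S : operator_system R) (mul : S -> S -> S) (nm : S -> R).
Hypothesis A : cstar_algebra_for mul nm.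
Implicit Types (x y z a : S) (T X Y C L : S -> S).

Let star := @os_star R S.

Lemma cmulDl x y z : mul (x + y) z = mul x z + mul y z.
Proof. by have := cs_mulPl A 1 x y z; rewrite !scale1r. Qed.

Lemma cmulDr x y z : mul z (x + y) = mul z x + mul z y.
Proof. by have := cs_mulPr A 1 x y z; rewrite !scale1r. Qed.

Lemma cmul0l z : mul 0 z = 0.
Proof. by have := cs_mulPl A (-1) 0 0 z; rewrite scaler0 addr0 scaleN1r addNr. Qed.

Lemma cmul0r z : mul z 0 = 0.
Proof. by have := cs_mulPr A (-1) 0 0 z; rewrite scaler0 addr0 scaleN1r addNr. Qed.

Lemma cmulZl c x z : mul (c *: x) z = c *: mul x z.
Proof. by have := cs_mulPl A c x 0 z; rewrite cmul0l !addr0. Qed.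

Lemma cmulZr c x z : mul z (c *: x) = c *: mul z x.
Proof. by have := cs_mulPr A c x 0 z; rewrite cmul0r !addr0. Qed.

Lemma cmulNl x z : mul (- x) z = - mul x z.
Proof. by rewrite -scaleN1r cmulZl scaleN1r. Qed.

Lemma cmulNr x z : mul z (- x) = - mul z x.
Proof. by rewrite -scaleN1r cmulZr scaleN1r. Qed.

Lemma starD x y : star (x + y) = star x + star y.
Proof. by have := os_starP 1 x y; rewrite rmorph1 !scale1r. Qed.

Lemma star0 : star 0 = 0.
Proof. by have := os_starP (-1) (0 : S) 0; rewrite scaler0 addr0 rmorphN1 scaleN1r addNr. Qed.

Lemma starZ c x : star (c *: x) = c^* *: star x.
Proof. by have := os_starP c x 0; rewrite -/star star0 !addr0. Qed.

Lemma starN x : star (- x) = - star x.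
Proof. by rewrite -scaleN1r starZ rmorphN1 scaleN1r. Qed.

Lemma nm0 : nm 0 = 0.
Proof. by have := cs_normZ A 0 0; rewrite scaler0 Normc.normc0 mul0r. Qed.

Lemma nmN x : nm (- x) = nm x.
Proof. by rewrite -scaleN1r (cs_normZ A) normcN Normc.normc1 mul1r. Qed.

Lemma nm_ge0 x : 0 <= nm x.
Proof.
have := cs_normD A x (- x); rewrite subrr nm0 nmN -mulr2n -mulr_natl.
by rewrite pmulr_rge0.
Qed.

Lemma nmZR (c : R) x : 0 <= c -> nm (c%:C%C *: x) = c * nm x.
Proof. by move=> c0; rewrite (cs_normZ A) normcR ger0_norm. Qed.

Lemma nm_star x : nm (star x) = nm x.
Proof.
have le y : nm y <= nm (star y).
  have [->|y0] := eqVneq (nm y) 0; first exact: nm_ge0.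
  have yp : 0 < nm y by rewrite lt_neqAle eq_sym y0 nm_ge0.
  by rewrite -(ler_pM2r yp) -expr2 -(cs_cstar A); exact: (cs_normM A).
by apply/le_anti; rewrite le andbT -{2}[x]os_starK le.
Qed.

(* The algebra acts on itself from the left; the selfadjoint operators of this
   action stand for selfadjoint elements of its unitization. *)
Definition sym_op T : Prop :=
  [/\ linear T, forall x y, mul (star (T x)) y = mul (star x) (T y) &
      exists2 M, 0 <= M & forall x, nm (T x) <= M * nm x].

Section Linear.
Variables (T : S -> S) (lT : linear T).

Lemma lop0 : T 0 = 0. Proof. exact: (linear0 lT). Qed.
Lemma lopZ c x : T (c *: x) = c *: T x.
Proof. by have := lT c x 0; rewrite lop0 !addr0. Qed.
Lemma lopD x y : T (x + y) = T x + T y.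
Proof. by have := lT 1 x y; rewrite !scale1r. Qed.
Lemma lopN x : T (- x) = - T x.
Proof. by rewrite -scaleN1r lopZ scaleN1r. Qed.
Lemma lopB x y : T (x - y) = T x - T y.
Proof. by rewrite lopD lopN. Qed.
End Linear.

Lemma sym_op_id : sym_op id.
Proof. by split=> //; exists 1 => // x; rewrite mul1r. Qed.

Lemma sym_op_mul a : star a = a -> sym_op (mul a).
Proof.
move=> aa; split=> [c x y|x y|].
- by rewrite cmulDr cmulZr.
- by rewrite /star (cs_starM A) -/star aa (cs_mulA A).
- by exists (nm a) => [|x]; [exact: nm_ge0|exact: (cs_normM A)].
Qed.

Lemma sym_op_comp X Y : sym_op X -> sym_op Y -> (forall x, X (Y x) = Y (X x)) ->
  sym_op (X \o Y).
Proof.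
move=> [lX sX [M M0 bX]] [lY sY [N N0 bY]] XY; split=> [c x y|x y|] /=.
- by rewrite lY lX.
- by rewrite sX sY XY.
- exists (M * N) => [|x]; first exact: mulr_ge0.
  by apply: le_trans (bX _) _; rewrite -mulrA ler_wpM2l.
Qed.

Lemma sym_op_comb X Y (c d : R) : sym_op X -> sym_op Y ->
  sym_op (fun x => c%:C%C *: X x + d%:C%C *: Y x).
Proof.
move=> [lX sX [M M0 bX]] [lY sY [N N0 bY]]; split=> [e x y|x y|] /=.
- rewrite lX lY !scalerDr !scalerA [c%:C%C * e]mulrC [d%:C%C * e]mulrC.
  by rewrite -!scalerA addrACA.
- rewrite starD !starZ !conjR cmulDl cmulDr !cmulZl !cmulZr.
  by rewrite sX sY.
- exists (`|c| * M + `|d| * N) => [|x]; first by rewrite addr_ge0 ?mulr_ge0.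
  apply: le_trans (cs_normD A _ _) _; rewrite !(cs_normZ A) !normcR mulrDl -!mulrA.
  by apply: lerD; rewrite ler_wpM2l.
Qed.

(* Both [X + iY] and [X - iY] are isometric, and [X] is their mean. *)
Lemma pythagoras_contr X Y : sym_op X -> sym_op Y -> (forall x, X (Y x) = Y (X x)) ->
  (forall x, X (X x) + Y (Y x) = x) -> forall x, nm (X x) <= nm x.
Proof.
move=> [lX sX _] [lY sY _] XY XY1 x.
have isom c : c * c^* = 1 -> c + c^* = 0 -> nm (X x + c *: Y x) = nm x.
  move=> cc c0; apply/eqP; rewrite -(@eqrXn2 _ 2) ?nm_ge0//; apply/eqP.
  rewrite -!(cs_cstar A) -/star starD starZ cmulDl !cmulDr !cmulZl !cmulZr.
  rewrite !sX !sY scalerA [c^* * c]mulrC cc scale1r XY.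
  congr nm; set p := mul _ (X (X x)); set q := mul _ (Y (X x)); set r := mul _ (Y (Y x)).
  have -> : p + c *: q + (c^* *: q + r) = p + r + (c *: q + c^* *: q).
    by rewrite addrA -[p + c *: q + _]addrA [RHS]addrAC addrA.
  by rewrite -scalerDl c0 scale0r addr0 -cmulDr XY1.
have ii : ('i%C : R[i])^* = - 'i%C.
  by apply/eqP; rewrite eq_complex /= oppr0 !eqxx.
have i2 : ('i%C : R[i]) * 'i%C = -1 by rewrite -expr2 sqr_i.
have z1 := isom 'i%C; have z2 := isom (- 'i%C).
have {}z1 : nm (X x + 'i%C *: Y x) = nm x.
  by apply: z1; rewrite ii ?mulrN ?i2 ?opprK ?subrr.
have {}z2 : nm (X x + - 'i%C *: Y x) = nm x.
  by apply: z2; rewrite rmorphN /= ii ?opprK ?mulNr ?i2 ?opprK ?addNr.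
have Xx : (2%:R : R)%:C%C *: X x = (X x + 'i%C *: Y x) + (X x + - 'i%C *: Y x).
  by rewrite addrACA scaleNr subrr addr0 rmorph_nat scaler_nat mulr2n.
have : 2%:R * nm (X x) <= 2%:R * nm x.
  rewrite -nmZR// Xx; apply: le_trans (cs_normD A _ _) _.
  by rewrite z1 z2 mulr_natl mulr2n.
by rewrite ler_pM2l.
Qed.

Section SquareRoot.
Variables (C : S -> S) (C_sym : sym_op C) (C1 : forall x, nm (C x) <= nm x).

(* [W = lim (sqrt_iter n)] solves [2 W = C + W ^ 2], so that [(1 - W) ^ 2 = 1 - C];
   [1 - sqrt_gap n] is the same iteration for the scalar [C = 1] and dominates it. *)
Fixpoint sqrt_iter n : S -> S :=
  if n is n'.+1 then fun x => (2%:R^-1 : R)%:C%C *: (C x + sqrt_iter n' (sqrt_iter n' x))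
  else fun=> 0.

Fixpoint sqrt_gap n : R :=
  if n is n'.+1 then sqrt_gap n' - sqrt_gap n' ^+ 2 / 2%:R else 1.

Lemma sqrt_gap_itv n : 0 <= sqrt_gap n <= 1.
Proof. by elim: n => [|n /= /andP[h0 h1]]; rewrite ?lexx ?ler01//; apply/andP; split; nra. Qed.

(** The map t - t^2 / 2 increases on [0, 1] and sends 2/k to 2/k - 2/k^2 <= 2/(k + 1). The rate is
    only 1/n because for C = 1 the limit 1 is a double root of 2 w = 1 + w^2. *)
Lemma sqrt_gap_le n : sqrt_gap n <= 2%:R / (n.+2)%:R.
Proof.
elim: n => [|n IH]; first by rewrite /= divff ?pnatr_eq0.
have /andP[h0 h1] := sqrt_gap_itv n; rewrite /= -[n.+3%:R]natr1.
set g := sqrt_gap n in h0 h1 IH *; set t := _ / _ in IH.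
have k2 : (2%:R : R) <= n.+2%:R by rewrite ler_nat.
set k : R := n.+2%:R in t IH k2 *; have k0 : 0 < k by lra.
have t1 : t <= 1 by rewrite ler_pdivrMr// mul1r.
have h : g - g ^+ 2 / 2%:R <= t - t ^+ 2 / 2%:R by nra.
apply: le_trans h _; rewrite ler_pdivlMr; last by lra.
have -> : (t - t ^+ 2 / 2%:R) * (k + 1) = 2%:R - 2%:R / k ^+ 2.
  by rewrite /t; field; rewrite -natrD pnatr_eq0.
by rewrite gerBl divr_ge0// sqr_ge0.
Qed.

(** Every identity for the limit of [sqrt_iter] is obtained this way: the defect is bounded by
    [sqrt_gap n] times a constant for all n. *)
Lemma le_sqrt_gap0 z (K : R) : 0 <= K -> (forall n, nm z <= sqrt_gap n * K) -> z = 0.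
Proof.
move=> K0 zK; apply: (cs_norm0 A); apply/le_anti; rewrite nm_ge0 andbT.
apply/ler_addgt0Pl => e e0; rewrite addr0.
have e'0 : 0 < e / (2%:R * (K + 1)) by rewrite divr_gt0// mulr_gt0// ltr_wpDl.
have [N Ne] := ltr_add_invr e'0; rewrite add0r in Ne.
apply: le_trans (zK N) _; apply: le_trans (ler_wpM2r K0 (sqrt_gap_le N)) _.
have h : N.+2%:R^-1 <= e / (2%:R * (K + 1)).
  apply: le_trans (ltW Ne); by rewrite lef_pV2 ?posrE ?ltr0n// ler_nat.
move: h; rewrite ler_pdivlMr ?mulr_gt0 ?ltr_wpDl//.
have : 0 <= N.+2%:R^-1 :> R by rewrite invr_ge0.
set t := N.+2%:R^-1; nra.
Qed.

Lemma sqrt_iter_comm L : linear L -> (forall x, L (C x) = C (L x)) ->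
  forall n x, L (sqrt_iter n x) = sqrt_iter n (L x).
Proof.
move=> lL LC; elim=> [|n IH] x /=; first exact: (lop0 lL).
by rewrite (lopZ lL) (lopD lL) LC !IH.
Qed.

(** The norm bound propagates because (1 + (1 - g)^2) / 2 = 1 - (g - g^2 / 2). *)
Lemma sqrt_iter_sym n : [/\ sym_op (sqrt_iter n),
  forall x, sqrt_iter n (C x) = C (sqrt_iter n x) &
  forall x, nm (sqrt_iter n x) <= (1 - sqrt_gap n) * nm x].
Proof.
have [lC _ _] := C_sym.
elim: n => [|n [w_sym wC w_le]].
  split=> [|x|x] /=; rewrite ?(lop0 lC) ?subrr ?mul0r ?nm0//.
  split=> [c x y|x y|] /=; first by rewrite scaler0 addr0.
    by rewrite star0 cmul0l cmul0r.
  by exists 0 => // x; rewrite nm0 mul0r.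
split=> [|x|x] /=.
- have ww := sym_op_comp w_sym w_sym (fun x => erefl).
  have := sym_op_comb 2%:R^-1 2%:R^-1 C_sym ww.
  by congr sym_op; apply/funext => x /=; rewrite scalerDr.
- by rewrite !wC (lopZ lC) (lopD lC).
rewrite nmZR ?invr_ge0//; have := cs_normD A (C x) (sqrt_iter n (sqrt_iter n x)).
have := w_le x; have := w_le (sqrt_iter n x).
have /andP[h0 h1] := sqrt_gap_itv n; have := C1 x.
set g := sqrt_gap n in h0 h1 *.
set p := nm (_ + _); set q := nm (sqrt_iter n (sqrt_iter n x)); set s := nm (sqrt_iter n x).
move=> a b c d.
have : q <= (1 - g) * ((1 - g) * nm x) by apply: le_trans b _; rewrite ler_wpM2l// subr_ge0.
move=> f; have : p <= nm x + (1 - g) * ((1 - g) * nm x) by lra.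
move=> e; rewrite ler_pdivrMl//; apply: le_trans e _; rewrite le_eqVlt; apply/orP; left.
by apply/eqP; field.
Qed.

(** The iterates w and w' commute, so the next difference is (w' - w)(w' + w) / 2; the scalar
    iteration satisfies the same identity, which makes the bound reproduce itself exactly. *)
Lemma sqrt_iter_step n x :
  nm (sqrt_iter n.+1 x - sqrt_iter n x) <= (sqrt_gap n - sqrt_gap n.+1) * nm x.
Proof.
elim: n x => [|n IH] x.
  rewrite /= addr0 subr0 nmZR ?invr_ge0// expr1n.
  by have := C1 x; have := nm_ge0 x; lra.
have [[lw' _ _] w'C w'_le] := sqrt_iter_sym n.+1.
have [[lw _ _] wC w_le] := sqrt_iter_sym n.
set w' := sqrt_iter n.+1 in lw' w'C w'_le IH *; set w := sqrt_iter n in lw wC w_le IH *.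
have w'w y : w' (w y) = w (w' y) by apply: sqrt_iter_comm.
have -> : sqrt_iter n.+2 x - w' x =
    (2%:R^-1 : R)%:C%C *: (w' (w' x + w x) - w (w' x + w x)).
  rewrite -[sqrt_iter n.+2 x]/((2%:R^-1 : R)%:C%C *: (C x + w' (w' x))).
  rewrite -[X in _ - X]/((2%:R^-1 : R)%:C%C *: (C x + w (w x))).
  rewrite -scalerBr; congr (_ *: _).
  rewrite (lopD lw') (lopD lw) w'w.
  set p := C x; set q := w' (w' x); set r := w (w x); set t := w (w' x).
  by rewrite [- (p + r)]opprD addrACA subrr add0r opprD addrA addrK.
rewrite nmZR ?invr_ge0//; apply: le_trans (ler_wpM2l _ (IH _)) _; first by rewrite invr_ge0.
have := cs_normD A (w' x) (w x); have := w'_le x; have := w_le x.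
have /andP[h0 h1] := sqrt_gap_itv n; have /andP[k0 k1] := sqrt_gap_itv n.+1.
have gk : sqrt_gap n - sqrt_gap n.+1 = sqrt_gap n ^+ 2 / 2%:R by rewrite /=; ring.
have ->: sqrt_gap n.+2 = sqrt_gap n.+1 - sqrt_gap n.+1 ^+ 2 / 2%:R by [].
move: gk; set g := sqrt_gap n in h0 h1 *; set k := sqrt_gap n.+1 in k0 k1 *.
have kE : k = g - g ^+ 2 / 2%:R by [].
move=> gk a b c; have e : nm (w' x + w x) <= (1 - g + (1 - k)) * nm x by lra.
have gk0 : 0 <= g - k by rewrite gk divr_ge0// sqr_ge0.
rewrite mulrA; apply: le_trans (ler_wpM2l _ e) _; first by rewrite mulr_ge0// invr_ge0.
rewrite mulrA ler_wpM2r ?nm_ge0// le_eqVlt; apply/orP; left; apply/eqP.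
by rewrite kE; field.
Qed.

End SquareRoot.

End NormedStarAlgebra.

Section StarNorm.
Variables (R : realType) (S : operator_system R) (mul : S -> S -> S) (nm : S -> R).
Hypothesis A : cstar_algebra_for mul nm.
Implicit Types (x y z a : S) (T X Y C L : S -> S).
Local Notation sym := (sym_op mul nm).

Lemma sqrt_gap_small (K e : R) : 0 <= K -> 0 < e ->
  exists N, forall n, (N <= n)%N -> @sqrt_gap R n * K < e.
Proof.
move=> K0 e0; have e'0 : 0 < e / (2%:R * (K + 1)) by rewrite divr_gt0// mulr_gt0// ltr_wpDl.
have [N Ne] := ltr_add_invr e'0; rewrite add0r in Ne; exists N => n Nn.
apply: le_lt_trans (ler_wpM2r K0 (sqrt_gap_le _ n)) _.
have h : n.+2%:R^-1 <= N.+1%:R^-1 :> R.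
  by rewrite lef_pV2 ?posrE ?ltr0n// ler_nat ltnS; exact: leqW.
move: (le_lt_trans h Ne); rewrite ltr_pdivlMr ?mulr_gt0 ?ltr_wpDl//.
have : 0 <= n.+2%:R^-1 :> R by rewrite invr_ge0.
set t := n.+2%:R^-1; nra.
Qed.

Lemma nm_triangle x y z : nm (x - z) <= nm (x - y) + nm (y - z).
Proof.
have -> : x - z = (x - y) + (y - z) by rewrite addrA subrK.
exact: (cs_normD A).
Qed.

Lemma nmBC x y : nm (x - y) = nm (y - x).
Proof. by rewrite -(nmN A) opprB. Qed.

Section Limit.
Variables (C : S -> S) (C_sym : sym C) (C1 : forall x, nm (C x) <= nm x).
Local Notation w := (sqrt_iter C).
Local Notation g := (@sqrt_gap R).

Lemma sqrt_iter_cauchy n m x : (n <= m)%N -> nm (w n x - w m x) <= g n * nm x.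
Proof.
move=> nm'; have /andP[gm0 _] := sqrt_gap_itv R m.
apply: (@le_trans _ _ ((g n - g m) * nm x)); last first.
  by rewrite ler_wpM2r ?(nm_ge0 A)// gerBl.
elim: m nm' {gm0} => [|m IH]; first by rewrite leqn0 => /eqP ->; rewrite !subrr mul0r (nm0 A).
rewrite leq_eqVlt ltnS => /orP[/eqP -> |/IH {}IH]; first by rewrite !subrr mul0r (nm0 A).
apply: le_trans (nm_triangle _ (w m x) _) _; rewrite [X in _ + X]nmBC.
have -> : (g n - g m.+1) * nm x = (g n - g m) * nm x + (g m - g m.+1) * nm x by ring.
by apply: lerD => //; exact: (sqrt_iter_step A C_sym C1).
Qed.

Lemma sqrt_iter_lim : exists W : S -> S, forall n x, nm (w n x - W x) <= g n * nm x.
Proof.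
have /choice[W WP] : forall x, exists l, forall n, nm (w n x - l) <= g n * nm x.
  move=> x; have [e e0|l lP] := @cs_complete R S mul nm A (fun n => w n x).
    have e20 : 0 < e / 2%:R by rewrite divr_gt0.
    have [N gN] := sqrt_gap_small (nm_ge0 A x) e20; exists N => m n Nm Nn.
    apply: le_lt_trans (nm_triangle _ (w N x) _) _; rewrite nmBC [ltRHS]splitr.
    by apply: ltrD; apply: le_lt_trans (sqrt_iter_cauchy _ _) (gN N (leqnn N)).
  exists l => n; apply/ler_addgt0Pl => e e0; have [N lN] := lP e e0.
  apply: le_trans (nm_triangle _ (w (maxn n N) x) _) _; rewrite addrC.
  apply: lerD; first by apply/ltW/lN; rewrite leq_maxr.
  by apply: sqrt_iter_cauchy; rewrite leq_maxl.
by exists W => n x; exact: WP.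
Qed.

(** Y is 1 - W. The bound on 1 - Y allows a further root to be taken, of Y itself, and the last
    clause makes successive roots commute with whatever commutes with C. *)
Lemma sqrt_op_exists : exists Y : S -> S, [/\ sym Y,
  forall x, Y (Y x) = x - C x,
  forall x, nm (x - Y x) <= nm x &
  forall L, linear L -> (exists2 M, 0 <= M & forall x, nm (L x) <= M * nm x) ->
    (forall x, L (C x) = C (L x)) -> forall x, L (Y x) = Y (L x)].
Proof.
have [W WP] := sqrt_iter_lim.
have w_sym n := sqrt_iter_sym A C_sym C1 n.
have g01 n := sqrt_gap_itv R n.
have W1 x : nm (W x) <= nm x.
  have [_ _ /(_ x) w0] := w_sym 0%N; have := WP 0%N x.
  by rewrite /= add0r -scaleN1r (cs_normZ A) normcN Normc.normc1 !mul1r.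
have lW : linear W.
  move=> c x y; apply/eqP; rewrite -subr_eq0; apply/eqP.
  pose K := nm (c *: x + y) + (normc c * nm x + nm y).
  have K0 : 0 <= K by rewrite !addr_ge0 ?mulr_ge0 ?(nm_ge0 A) ?normc_ge0.
  apply: (le_sqrt_gap0 A K0) => n; have [[lw _ _] _ _] := w_sym n.
  have -> : W (c *: x + y) - (c *: W x + W y) =
      - (w n (c *: x + y) - W (c *: x + y)) + (c *: (w n x - W x) + (w n y - W y)).
    rewrite lw scalerBr; set p := c *: w n x; set q := w n y; set r := c *: W x.
    by rewrite opprB [p - r + _]addrACA -[- r - W y]opprD addrA subrK.
  apply: le_trans (cs_normD A _ _) _; rewrite (nmN A) /K mulrDr; apply: lerD => //.
  apply: le_trans (cs_normD A _ _) _; rewrite mulrDr; apply: lerD => //.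
  by rewrite (cs_normZ A) mulrCA ler_wpM2l ?normc_ge0.
have sW x y : mul (os_star (W x)) y = mul (os_star x) (W y).
  apply/eqP; rewrite -subr_eq0; apply/eqP.
  pose K := nm x * nm y + nm x * nm y.
  have K0 : 0 <= K by rewrite !addr_ge0 ?mulr_ge0 ?(nm_ge0 A).
  apply: (le_sqrt_gap0 A K0) => n; have [[_ sw _] _ _] := w_sym n.
  have -> : mul (os_star (W x)) y - mul (os_star x) (W y) =
      - mul (os_star (w n x - W x)) y + mul (os_star x) (w n y - W y).
    have starB (u v : S) : os_star (u - v) = os_star u - os_star v by rewrite starD starN.
    rewrite starB (cmulDl A) (cmulDr A) (cmulNl A) (cmulNr A) sw opprB.
    by rewrite addrA subrK.
  apply: le_trans (cs_normD A _ _) _; rewrite (nmN A) /K mulrDr.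
  apply: lerD; apply: le_trans (cs_normM A _ _) _.
    by rewrite (nm_star A) mulrA ler_wpM2r ?(nm_ge0 A).
  by rewrite (nm_star A) mulrCA ler_wpM2l ?(nm_ge0 A).
have W_sym : sym W by split=> //; exists 1 => // x; rewrite mul1r.
have WW x : W x + W x = C x + W (W x).
  apply/eqP; rewrite -subr_eq0; apply/eqP.
  pose K := nm x + nm x + (nm x + nm x).
  have K0 : 0 <= K by rewrite !addr_ge0 ?(nm_ge0 A).
  apply: (le_sqrt_gap0 A K0) => n; have [[lw _ _] _ w_le] := w_sym n.
  have w_le1 z : nm (w n z) <= nm z.
    apply: le_trans (w_le z) _; rewrite ler_piMl ?(nm_ge0 A)//.
    by have /andP[h _] := g01 n; rewrite gerBl.
  have gS : g n.+1 <= g n by rewrite /= gerBl divr_ge0// sqr_ge0.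
  have e : w n.+1 x + w n.+1 x = C x + w n (w n x).
    rewrite /= -scalerDl -rmorphD /= (_ : 2%:R^-1 + 2%:R^-1 = 1 :> R); last by field.
    by rewrite scale1r.
  have -> : W x + W x - (C x + W (W x)) =
      - ((w n.+1 x - W x) + (w n.+1 x - W x)) +
      (w n (w n x - W x) + (w n (W x) - W (W x))).
    rewrite (lopB lw) subrKA [_ - W x + _]addrACA e -opprD opprB.
    by rewrite !opprD -[RHS]addrA subrKA.
  apply: le_trans (cs_normD A _ _) _; rewrite (nmN A) /K mulrDr.
  have h : nm (w n.+1 x - W x) <= g n * nm x.
    by apply: le_trans (WP _ _) _; rewrite ler_wpM2r ?(nm_ge0 A).
  apply: lerD; apply: le_trans (cs_normD A _ _) _; rewrite mulrDr; apply: lerD => //.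
    exact: le_trans (w_le1 _) (WP _ _).
  apply: le_trans (WP _ _) _; rewrite ler_wpM2l//.
  by have /andP[] := g01 n.
pose Y x := x - W x.
have Y_sym : sym Y.
  have := sym_op_comb A 1 (-1) (sym_op_id mul nm) W_sym.
  congr sym; apply/funext => x /=.
  by rewrite /Y scale1r rmorphN rmorph1 scaleN1r.
exists Y; split=> //.
- move=> x; rewrite /Y (lopB lW) opprB.
  have -> : W (W x) = W x + W x - C x by rewrite WW addrAC subrr add0r.
  by rewrite [_ - C x - W x]addrAC addrK subrKA.
- by move=> x; rewrite /Y opprB addrCA subrr addr0.
move=> L lL [M M0 LM] LC x; rewrite /Y (lopB lL); congr (_ - _).
apply/eqP; rewrite -subr_eq0; apply/eqP.
pose K := M * nm x + nm (L x).
have K0 : 0 <= K by rewrite addr_ge0 ?mulr_ge0 ?(nm_ge0 A).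
apply: (le_sqrt_gap0 A K0) => n.
have -> : L (W x) - W (L x) = - L (w n x - W x) + (w n (L x) - W (L x)).
  by rewrite (lopB lL) (sqrt_iter_comm lL LC) opprB addrA subrK.
apply: le_trans (cs_normD A _ _) _; rewrite (nmN A) /K mulrDr.
apply: lerD => //; apply: le_trans (LM _) _.
by rewrite mulrCA ler_wpM2l.
Qed.

End Limit.

End StarNorm.

(** * A faithful representation is isometric *)

Section FaithfulIsometric.
Variables (R : realType) (S : operator_system R) (mul : S -> S -> S) (nm : S -> R).
Hypothesis A : cstar_algebra_for mul nm.
Implicit Types (x y z a : S) (X Y : S -> S).
Local Notation sym := (sym_op mul nm).
Local Notation H := (os_H S).

Lemma sym_op_linear X : sym X -> linear X. Proof. by case. Qed.

Lemma sym_op_bounded X : sym X -> exists2 M, 0 <= M & forall x, nm (X x) <= M * nm x.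
Proof. by case. Qed.

Lemma ip_gram x y (v : H) :
  ip H (os_op x v) (os_op y v) = ip H (os_op (mul (os_star y) x) v) v.
Proof. by rewrite (cs_opM A) [RHS]os_adjoint os_starK. Qed.

Lemma sym_op_gram X x (v : H) : sym X ->
  hnorm (os_op (X x) v) ^+ 2 = Re (ip H (os_op (X (X x)) v) (os_op x v)).
Proof. by move=> [_ sX _]; rewrite sqr_hnorm !ip_gram sX. Qed.

(** For Y a root of 1 - a^2, the element Y a is in the algebra, so |a v|^2 - |a a v|^2 = |(Y a) v|^2
    >= 0 makes sense without a unit. Hence a is contractive on its range, and |a v|^2 = <a a v, v>
    extends this to all v. *)
Lemma selfadjoint_contr a (v : H) : os_star a = a -> nm a <= 1 ->
  hnorm (os_op a v) <= hnorm v.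
Proof.
move=> aa a1; have La := sym_op_mul A aa.
have LLa := sym_op_comp La La (fun=> erefl).
have [x|Y [Y_sym YY _ _]] := sqrt_op_exists A LLa.
  have le z : nm (mul a z) <= nm z.
    by apply: le_trans (cs_normM A _ _) _; rewrite ler_piMl ?(nm_ge0 A).
  exact: le_trans (le _) (le _).
have sa w w' : ip H (os_op a w) w' = ip H w (os_op a w') by rewrite os_adjoint aa.
have h : hnorm (os_op a (os_op a v)) <= hnorm (os_op a v).
  apply: hnorm_le_sqr; have := sqr_ge0 (hnorm (os_op (Y a) v)).
  rewrite (sym_op_gram _ _ Y_sym) YY /= os_opBl ipBl ReB !(cs_opM A).
  by rewrite sa -sa Re_ipxx sa Re_ipxx subr_ge0.
have [->|av] := eqVneq (hnorm (os_op a v)) 0; first exact: hnorm_ge0.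
have avp : 0 < hnorm (os_op a v) by rewrite lt_neqAle eq_sym av hnorm_ge0.
rewrite -(ler_pM2l avp) -expr2 sqr_hnorm -sa.
apply: le_trans (Re_le_normc _) _; apply: le_trans (cauchy_schwarz _ _) _.
by rewrite ler_wpM2r ?hnorm_ge0.
Qed.

Lemma star_gram x : os_star (mul (os_star x) x) = mul (os_star x) x.
Proof. by rewrite (cs_starM A) os_starK. Qed.

Lemma op_le_nm x (v : H) : hnorm (os_op x v) <= nm x * hnorm v.
Proof.
have [x0|x0] := eqVneq (nm x) 0.
  by rewrite (cs_norm0 A x0) os_op0l hnorm0 (nm0 A) mul0r.
have xp : 0 < nm x by rewrite lt_neqAle eq_sym x0 (nm_ge0 A).
pose t := (nm x ^+ 2)^-1; have t0 : 0 <= t by rewrite invr_ge0 sqr_ge0.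
pose a := t%:C%C *: mul (os_star x) x.
have aa : os_star a = a by rewrite /a starZ conjR star_gram.
have a1 : nm a <= 1.
  by rewrite (nmZR A)// (cs_cstar A) /t mulVf// sqrf_eq0.
have h := selfadjoint_contr v aa a1.
rewrite -(@ler_pXn2r _ 2)// ?nnegrE ?mulr_ge0 ?hnorm_ge0 ?(nm_ge0 A)//.
rewrite exprMn sqr_hnorm ip_gram -ler_pdivrMl ?exprn_gt0// -/t.
have -> : t * Re (ip H (os_op (mul (os_star x) x) v) v) = Re (ip H (os_op a v) v).
  by rewrite /a os_opZl ipZl; case: (ip _ _ _) => p q /=; rewrite mul0r subr0.
apply: le_trans (Re_le_normc _) _; apply: le_trans (cauchy_schwarz _ _) _.
by rewrite expr2 ler_wpM2r ?hnorm_ge0.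
Qed.

(* With [b = a ^ 2 - 1], [X = b / K] and [Y1 = |b| / K] a square, the elements
   [d = (Y1 + X) x] satisfy [Y1 d = X d]; since [X] is negative on the range of the
   representation, [d] is in its kernel.  Hence [a ^ 2 + K Y1 = 1]. *)
Lemma nm_selfadjoint_le1 a (r : R) : os_star a = a -> 0 <= r -> r < 1 ->
  (forall v, hnorm (os_op a v) <= r * hnorm v) -> nm a <= 1.
Proof.
move=> aa r0 r1 ar; have La := sym_op_mul A aa.
have LLa := sym_op_comp La La (fun=> erefl).
(* This K makes X = (a^2 - 1) / K a contraction. *)
pose K := nm a ^+ 2 + 1; have K0 : 0 < K by rewrite ltr_wpDl// sqr_ge0.
pose X x := K^-1%:C%C *: (mul a (mul a x)) + (- K^-1)%:C%C *: x.
have X_sym : sym X by exact: (sym_op_comb A K^-1 (- K^-1) LLa (sym_op_id mul nm)).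
have lX := sym_op_linear X_sym.
have X1 x : nm (X x) <= nm x.
  apply: le_trans (cs_normD A _ _) _; rewrite !(cs_normZ A) !normcR normrN.
  rewrite ger0_norm ?invr_ge0 ?(ltW K0)// -mulrDr ler_pdivrMl//.
  rewrite /K mulrDl mul1r lerD2r expr2 -mulrA.
  apply: le_trans (cs_normM A _ _) _; rewrite ler_wpM2l ?(nm_ge0 A)//.
  exact: (cs_normM A).
have commXX : forall L, linear L -> (forall x, L (mul a x) = mul a (L x)) ->
    forall x, L (X x) = X (L x).
  by move=> L lL La' x; rewrite /X (lopD lL) !(lopZ lL) !La'.
have XX_sym := sym_op_comp X_sym X_sym (fun=> erefl).
(* Roots are available only in the form sqrt(1 - C) with C a contraction. So sqrt(X^2) is obtained
   as Y1 = sqrt(1 - Y0^2), where Y0 = sqrt(1 - X^2) is a contraction because Y0^2 + X^2 = 1. *)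
have [x|Y0 [Y0_sym Y0Y0 _ Y0c]] := sqrt_op_exists A XX_sym.
  exact: le_trans (X1 _) (X1 _).
have Y0X x : Y0 (X x) = X (Y0 x).
  by rewrite (Y0c X)//; exact: sym_op_bounded.
have Y01 : forall x, nm (Y0 x) <= nm x.
  apply: (pythagoras_contr A Y0_sym X_sym Y0X) => x.
  by rewrite Y0Y0 /= subrK.
have C1_sym := sym_op_comp Y0_sym Y0_sym (fun=> erefl).
have [x|Y1 [Y1_sym Y1Y1 Y1_le Y1c]] := sqrt_op_exists A C1_sym.
  exact: le_trans (Y01 _) (Y01 _).
have {}Y1Y1 x : Y1 (Y1 x) = X (X x) by rewrite Y1Y1 /= Y0Y0 /= opprB addrC subrK.
have commY1 L : linear L -> (exists2 M, 0 <= M & forall x, nm (L x) <= M * nm x) ->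
    (forall x, L (mul a x) = mul a (L x)) -> forall x, L (Y1 x) = Y1 (L x).
  move=> lL bL La'; apply: Y1c => // x /=.
  have h y : L (Y0 y) = Y0 (L y).
    by apply: Y0c => // z /=; rewrite !commXX.
  by rewrite !h.
have lY1 := sym_op_linear Y1_sym.
have W1_sym : sym (fun x => x - Y1 x).
  have := sym_op_comb A 1 (-1) (sym_op_id mul nm) Y1_sym.
  congr sym; apply/funext => x /=.
  by rewrite scale1r rmorphN rmorph1 scaleN1r.
(* Y2 is a root of Y1, taken with C = 1 - Y1; it shows Y1 to be positive in the representation. *)
have [//|Y2 [Y2_sym Y2Y2 _ Y2c]] := sqrt_op_exists A W1_sym.
have {}Y2Y2 x : Y2 (Y2 x) = Y1 x by rewrite Y2Y2 subKr.
have XY1 x : X (Y1 x) = Y1 (X x).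
  apply: commY1 => //; first exact: sym_op_bounded.
  by move=> y; rewrite /X (cmulDr A) !(cmulZr A).
have Y1E x : Y1 x = - X x.
  apply/eqP; rewrite -addr_eq0; apply/eqP; set d := Y1 x + X x.
  have dE : Y2 (Y2 d) = X d.
    by rewrite Y2Y2 /d (lopD lY1) Y1Y1 -XY1 [RHS](lopD lX) addrC.
  apply: os_inj => v; rewrite os_op0l; apply: hnorm_eq0.
  have := sqr_ge0 (hnorm (os_op (Y2 d) v)); rewrite (sym_op_gram _ _ Y2_sym) dE.
  rewrite /X os_opDl !os_opZl ipDl !ipZl !(cs_opM A).
  have sa w w' : ip H (os_op a w) w' = ip H w (os_op a w') by rewrite os_adjoint aa.
  rewrite sa !ip_hnorm -!rmorphM -rmorphD /= mulNr -mulrBr pmulr_rge0 ?invr_gt0//.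
  rewrite subr_ge0 => h.
  have := ar (os_op d v); have := hnorm_ge0 (os_op a (os_op d v)).
  have := hnorm_ge0 (os_op d v); move: h.
  set p := hnorm (os_op a _); set q := hnorm _ => h q0 p0 pq.
  have qp : q <= p by rewrite -(@ler_pXn2r _ 2)// nnegrE.
  nra.
have lY2 := sym_op_linear Y2_sym.
pose s : R := Num.sqrt K.
have ss : s * s = K by rewrite -expr2 sqr_sqrtr// ltW.
(* The relation a^2 + K Y1 = 1 becomes a^2 + (s Y2)^2 = 1, so [pythagoras_contr] bounds
   multiplication by a; applied to a itself it gives nm(a)^2 <= nm(a). *)
have sY2 : sym (fun x => s%:C%C *: Y2 x).
  have := sym_op_comb A s 0 Y2_sym Y2_sym.
  by congr sym; apply/funext => x /=; rewrite rmorph0 scale0r addr0.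
have aY2 x : mul a (Y2 x) = Y2 (mul a x).
  apply: Y2c; [exact: sym_op_linear|exact: sym_op_bounded|] => y.
  rewrite (lopB (sym_op_linear La)); congr (_ - _).
  apply: commY1; [exact: sym_op_linear|exact: sym_op_bounded|by []].
have le : forall x, nm (mul a x) <= nm x.
  apply: (pythagoras_contr A La sY2) => x; first by rewrite (cmulZr A) aY2.
  rewrite (lopZ lY2) scalerA -rmorphM /= ss Y2Y2 Y1E /X opprD -!scaleNr.
  rewrite scalerDr !scalerA -!rmorphN -!rmorphM /= opprK mulrN mulfV ?gt_eqF//.
  by rewrite rmorphN rmorph1 scaleN1r scale1r addrA subrr add0r.
have := le a; rewrite -{1}aa (cs_cstar A).
have [-> //|a0] := eqVneq (nm a) 0.
have ap : 0 < nm a by rewrite lt_neqAle eq_sym a0 (nm_ge0 A).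
by rewrite expr2 ger_pMl.
Qed.

Lemma nm_le_op x (M : R) : 0 <= M -> (forall v, hnorm (os_op x v) <= M * hnorm v) -> nm x <= M.
Proof.
move=> M0 xM; apply/ler_addgt0Pl => e e0.
(* The slack e makes the ratio r = M^2 / (e + M)^2 strictly less than 1. *)
have t0 : 0 < e + M by rewrite ltr_pwDl.
set t := e + M in t0 *.
have t20 : 0 < t ^+ 2 by rewrite exprn_gt0.
pose a := (t ^+ 2)^-1%:C%C *: mul (os_star x) x.
have a1 : nm a <= 1.
  apply: (@nm_selfadjoint_le1 _ ((t ^+ 2)^-1 * (M * M))).
  - by rewrite /a starZ conjR star_gram.
  - by rewrite mulr_ge0 ?invr_ge0 ?mulr_ge0// ltW.
  - by rewrite mulrC ltr_pdivrMr// mul1r /t; nra.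
  - move=> v; rewrite os_opZl hnormZ normcR ger0_norm ?invr_ge0 ?(ltW t20)//.
    rewrite -mulrA ler_wpM2l ?invr_ge0 ?(ltW t20)// (cs_opM A) -mulrA.
    apply: (@le_trans _ _ (M * hnorm (os_op x v))); last by rewrite ler_wpM2l.
    apply: hnorm_le_ip => [|w]; first by rewrite mulr_ge0 ?hnorm_ge0.
    rewrite os_adjoint os_starK; apply: le_trans (cauchy_schwarz _ _) _.
    by rewrite [M * _]mulrC -mulrA ler_wpM2l ?hnorm_ge0.
rewrite -(@ler_pXn2r _ 2)// ?nnegrE ?(nm_ge0 A) ?(ltW t0)// -(cs_cstar A).
move: a1; rewrite (nmZR A) ?invr_ge0 ?(ltW t20)//.
by rewrite ler_pdivrMl// mulr1.
Qed.

Lemma nm_nrm x : nm x = nrm (x : smos_of_opspace S).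
Proof.
apply/le_anti/andP; split.
  by apply: nm_le_op => [|v]; [exact: nrm_ge0|exact: nrmP].
by apply: nrm_le => [|v]; [exact: (nm_ge0 A)|exact: op_le_nm].
Qed.

Lemma cstar_complete : norm_complete (fun x : S => nrm (x : smos_of_opspace S)).
Proof.
have -> : (fun x : S => nrm (x : smos_of_opspace S)) = nm.
  by apply/funext => x; rewrite nm_nrm.
exact: (cs_complete A).
Qed.

End FaithfulIsometric.

(** * Approximate units *)

Section PositiveContraction.
Variables (R : realType) (H : ipspace R) (a : H -> H).
Hypotheses (a_lin : linear a) (a_sym : forall v w, ip H (a v) w = ip H v (a w)).
Hypothesis a_ge0 : forall v, 0 <= Re (ip H (a v) v).
Hypothesis a_le1 : forall v, hnorm (a v) <= hnorm v.

Lemma pc_sub v w : a (v - w) = a v - a w.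
Proof. by rewrite [v - w]addrC [RHS]addrC; have := a_lin (-1) w v; rewrite !scaleN1r. Qed.

Lemma Re_ip_sub v w : Re (ip H (a (v - w)) (v - w)) =
  Re (ip H (a v) v) - 2%:R * Re (ip H (a v) w) + Re (ip H (a w) w).
Proof.
rewrite pc_sub ipBl !ipBr !ReB (a_sym w v) (Re_ipC w (a v)); ring.
Qed.

Lemma Re_ip_le v : Re (ip H (a v) v) <= hnorm v ^+ 2.
Proof.
apply: le_trans (Re_le_normc _) _; apply: le_trans (cauchy_schwarz _ _) _.
by rewrite expr2 ler_wpM2r ?hnorm_ge0.
Qed.

(** This is a^2 <= a without a root of a: expand 0 <= <a (v - a v), v - a v> and bound <a a v, a v>
    by |a v|^2. *)
Lemma sqr_pc_le v : hnorm (a v) ^+ 2 <= Re (ip H (a v) v).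
Proof.
have := a_ge0 (v - a v); rewrite Re_ip_sub Re_ipxx.
have := Re_ip_le (a v); lra.
Qed.

Definition co_pc v := v - a v.

Lemma co_pc_sym v w : ip H (co_pc v) w = ip H v (co_pc w).
Proof. by rewrite /co_pc ipBl ipBr a_sym. Qed.

Lemma sqr_co_pc v : hnorm (co_pc v) ^+ 2 =
  hnorm v ^+ 2 - 2%:R * Re (ip H (a v) v) + hnorm (a v) ^+ 2.
Proof.
rewrite /co_pc -Re_ipxx ipBl !ipBr !ReB !Re_ipxx (Re_ipC v (a v)); ring.
Qed.

Lemma co_pc_decrease v : Re (ip H (a v) v) <= hnorm v ^+ 2 - hnorm (co_pc v) ^+ 2.
Proof. by rewrite sqr_co_pc; have := sqr_pc_le v; lra. Qed.

Lemma co_pc_contr v : hnorm (co_pc v) <= hnorm v.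
Proof. by apply: hnorm_le_sqr; have := co_pc_decrease v; have := a_ge0 v; lra. Qed.

Lemma Re_ip_co_pc v : Re (ip H (a (co_pc v)) (co_pc v)) <= Re (ip H (a v) v).
Proof.
rewrite Re_ip_sub Re_ipxx.
by have := Re_ip_le (a v); have := sqr_ge0 (hnorm (a v)); lra.
Qed.

Lemma iter_co_pc_contr m v : hnorm (iter m co_pc v) <= hnorm v.
Proof. by elim: m => [|m IH] //=; apply: le_trans (co_pc_contr _) IH. Qed.

Lemma iter_co_pc_sym m v w : ip H (iter m co_pc v) w = ip H v (iter m co_pc w).
Proof. by elim: m v w => [|m IH] v w //=; rewrite co_pc_sym IH -iterSr. Qed.

(* With [w_j = (1 - a)^j v], the terms [<a w_j, w_j>] decrease and are bounded by
   [|w_j|^2 - |w_(j+1)|^2], whose sum telescopes. *)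
Lemma Re_ip_iter_co_pc m v :
  m%:R * Re (ip H (a (iter m co_pc v)) (iter m co_pc v)) <= hnorm v ^+ 2.
Proof.
set s := fun j => Re (ip H (a (iter j co_pc v)) (iter j co_pc v)).
have s_le j k : (j <= k)%N -> s k <= s j.
  elim: k => [|k IH]; first by rewrite leqn0 => /eqP ->.
  rewrite leq_eqVlt ltnS => /orP[/eqP -> //|/IH]; apply: le_trans.
  exact: Re_ip_co_pc.
have sum : \sum_(j < m) s j <= hnorm v ^+ 2 - hnorm (iter m co_pc v) ^+ 2.
  elim: m => [|m IH]; first by rewrite big_ord0 subrr.
  by rewrite big_ord_recr /=; have := co_pc_decrease (iter m co_pc v); rewrite -/(s m); lra.
apply: (@le_trans _ _ (\sum_(j < m) s j)).
  rewrite mulr_natl -[X in _ *+ X]card_ord -sumr_const; apply: ler_sum => j _.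
  by apply: s_le; exact: ltnW.
by apply: le_trans sum _; rewrite gerBl sqr_ge0.
Qed.

End PositiveContraction.

Section CstarApproximateUnit.
Variables (R : realType) (S : operator_system R) (mul : S -> S -> S) (nm : S -> R).
Hypothesis A : cstar_algebra_for mul nm.
Local Notation H := (os_H S).

(* [1 - (1 - a)^m], an element of the algebra even without a unit. *)
Fixpoint unit_seq (a : S) m : S :=
  if m is m'.+1 then unit_seq a m' + (a - mul a (unit_seq a m')) else 0.

Lemma unit_seqE a m v : os_op (unit_seq a m) v = v - iter m (co_pc (os_op a)) v.
Proof.
elim: m => [|m IH] /=; first by rewrite os_op0l subrr.
rewrite os_opDl os_opBl (cs_opM A) IH os_opBr /co_pc.
set w := iter _ _ _.
by rewrite subKr opprB addrA addrAC [v + _]addrC.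
Qed.

Lemma cstar_approx_unital : approx_unital S.
Proof.
move=> I x e e0.
(* With P = 1 - u one has x - u x u = x P + P x u, so both x P and P x must be small; hence products
   of both orders are summed. *)
pose b : S := \sum_i (mul (os_star (x i)) (x i) +
  mul (os_star (os_star (x i))) (os_star (x i))).
pose c := nrm (b : smos_of_opspace S) + 1.
have c0 : 0 < c by rewrite ltr_wpDl// nrm_ge0.
pose a := c^-1%:C%C *: b.
have bs : os_star b = b.
  rewrite /b (big_morph (@os_star R S) (@starD R S) (star0 S)); apply: eq_bigr => i _.
  by rewrite starD !(star_gram A).
have sta : os_star a = a by rewrite /a starZ conjR bs.
have bE v : Re (ip H (os_op b v) v) =
    \sum_i (hnorm (os_op (x i) v) ^+ 2 + hnorm (os_op (os_star (x i)) v) ^+ 2).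
  rewrite os_suml (big_morph (fun u => ip H u v) (fun u w => ipDl u w v) (ip0l v)).
  rewrite (big_morph (@complex.Re R) (@ReD R) erefl); apply: eq_bigr => i _.
  by rewrite os_opDl ipDl ReD -!(ip_gram A) !Re_ipxx.
have aE v : Re (ip H (os_op a v) v) = c^-1 * Re (ip H (os_op b v) v).
  by rewrite /a os_opZl ipZl; case: (ip _ _ _) => p q /=; rewrite mul0r subr0.
have lin : linear (os_op a) by have [] := os_bounded a.
have sa v w : ip H (os_op a v) w = ip H v (os_op a w) by rewrite os_adjoint sta.
have b_ge0 v : 0 <= Re (ip H (os_op b v) v).
  by rewrite bE sumr_ge0// => i _; rewrite addr_ge0 ?sqr_ge0.
have a_ge0 v : 0 <= Re (ip H (os_op a v) v).
  by rewrite aE mulr_ge0 ?invr_ge0 ?(ltW c0).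
have a_le1 v : hnorm (os_op a v) <= hnorm v.
  rewrite /a os_opZl hnormZ normcR ger0_norm ?invr_ge0 ?(ltW c0)// ler_pdivrMl//.
  apply: le_trans (nrmP _ _) _; rewrite ler_wpM2r ?hnorm_ge0//.
  by rewrite /c lerDl.
have xa i v : hnorm (os_op (x i) v) ^+ 2 <= c * Re (ip H (os_op a v) v) /\
    hnorm (os_op (os_star (x i)) v) ^+ 2 <= c * Re (ip H (os_op a v) v).
  rewrite aE mulrA mulfV ?gt_eqF// mul1r bE (bigD1 i)//=.
  have : 0 <= \sum_(j | j != i) (hnorm (os_op (x j) v) ^+ 2 +
      hnorm (os_op (os_star (x j)) v) ^+ 2).
    by rewrite sumr_ge0// => j _; rewrite addr_ge0 ?sqr_ge0.
  have := sqr_ge0 (hnorm (os_op (x i) v)).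
  have := sqr_ge0 (hnorm (os_op (os_star (x i)) v)).
  by move=> h1 h2 h3; split; lra.
pose d := e / 2%:R; have d0 : 0 < d by rewrite divr_gt0.
pose N := Num.bound (c / d ^+ 2).
have Nc : c <= d ^+ 2 * N%:R.
  have : c / d ^+ 2 < N%:R by apply: archi_boundP; rewrite divr_ge0 ?sqr_ge0 ?(ltW c0).
  by rewrite ltr_pdivrMr ?exprn_gt0// mulrC => /ltW.
(* The exponent is even so that P is the square of (1 - a)^N; this gives P^2 <= P, which is u^2 <= u
   for u = 1 - P. *)
pose P v := iter (N + N) (co_pc (os_op a)) v.
have P_small v : c * Re (ip H (os_op a (P v)) (P v)) <= (d * hnorm v) ^+ 2.
  have := Re_ip_iter_co_pc lin sa a_ge0 a_le1 (N + N) v.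
  rewrite -/(P v) natrD; have := a_ge0 (P v); set s := Re _ => s0 h.
  apply: (@le_trans _ _ (d ^+ 2 * N%:R * s)); first by rewrite ler_wpM2r.
  rewrite [(d * _) ^+ 2]exprMn -[leLHS]mulrA; apply: ler_wpM2l; first exact: sqr_ge0.
  by have : 0 <= N%:R * s by [exact: mulr_ge0]; lra.
have xP i v : hnorm (os_op (x i) (P v)) <= d * hnorm v /\
    hnorm (os_op (os_star (x i)) (P v)) <= d * hnorm v.
  have [h1 h2] := xa i (P v).
  have sq (p q : R) : 0 <= p -> 0 <= q -> p ^+ 2 <= q ^+ 2 -> p <= q.
    by move=> p0 q0; rewrite ler_pXn2r ?nnegrE.
  have dv : 0 <= d * hnorm v by rewrite mulr_ge0 ?hnorm_ge0 ?(ltW d0).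
  split; apply: sq; rewrite ?hnorm_ge0//; [exact: le_trans h1 (P_small v)|].
  exact: le_trans h2 (P_small v).
pose u := unit_seq a (N + N).
have uE v : os_op u v = v - P v by exact: unit_seqE.
have Ps v w : ip H (P v) w = ip H v (P w) by exact: iter_co_pc_sym.
have us : os_star u = u.
  apply: os_inj => w; apply: ip_injr => v.
  by rewrite -os_adjoint !uE ipBl ipBr Ps.
have PP v : hnorm (P v) ^+ 2 <= Re (ip H (P v) v).
  have -> : ip H (P v) v = ip H (iter N (co_pc (os_op a)) v) (iter N (co_pc (os_op a)) v).
    by rewrite /P iterD iter_co_pc_sym.
  rewrite Re_ipxx ler_pXn2r ?nnegrE ?hnorm_ge0// /P iterD.
  exact: iter_co_pc_contr.
clearbody P u.
have uP v : hnorm (os_op u v) ^+ 2 <= Re (ip H (os_op u v) v).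
  rewrite uE -Re_ipxx !(ipBl, ipBr) !ReB !Re_ipxx (Re_ipC v (P v)).
  have := PP v; lra.
exists u, (fun i => mul u (mul (x i) u)); split=> // [i v|i].
  by rewrite !(cs_opM A).
apply: nrm_le_ip => [|v w]; first exact: ltW.
have -> : ip H (os_op (x i - mul u (mul (x i) u)) v) w =
    ip H (os_op (x i) (P v)) w + ip H (os_op u v) (os_op (os_star (x i)) (P w)).
  rewrite os_opBl !(cs_opM A) -os_adjoint -Ps -ipDl; congr (ip H _ w).
  set z := os_op (x i) (os_op u v).
  have -> : os_op (x i) v = os_op (x i) (P v) + z by rewrite /z uE os_opBr addrC subrK.
  by rewrite uE opprB addrACA subrr addr0.
apply: le_trans (le_normcD _ _) _.
have [h1 _] := xP i v; have [_ h2] := xP i w.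
have hw0 := hnorm_ge0 w.
have -> : e * hnorm v * hnorm w = d * hnorm v * hnorm w + hnorm v * (d * hnorm w).
  by rewrite /d; field.
apply: lerD; apply: le_trans (cauchy_schwarz _ _) _; first by rewrite ler_wpM2r.
by apply: ler_pM; rewrite ?hnorm_ge0//; exact: unit_contr.
Qed.

End CstarApproximateUnit.

Section UnitalApproximateUnit.
Variables (R : realType) (S : operator_system R).

Lemma unital_approx_unital : unital_opsys S -> approx_unital S.
Proof.
move=> [u uE] I x e e0; exists u, x; split=> [|v|i v|i].
- by apply: os_inj => w; apply: ip_injr => v; rewrite -os_adjoint !uE.
- by rewrite uE Re_ipxx.
- by rewrite !uE.
- by rewrite subrr nrm0 ltW.
Qed.

End UnitalApproximateUnit.

(** * The Hahn-Banach theorem *)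

Section HahnBanach.
Variables (R : realType) (V : lmodType R[i]).
Implicit Types (x y z : V) (p q : V -> R).
Local Notation "t *r x" := (t%:C%C *: x) (at level 40).

Definition sublinear q : Prop :=
  [/\ q 0 = 0, forall x y, q (x + y) <= q x + q y &
      forall (t : R) x, 0 < t -> q (t *r x) <= t * q x].

Lemma rscaleA (s t : R) x : s *r (t *r x) = (s * t) *r x.
Proof. by rewrite scalerA -rmorphM. Qed.

Lemma sublinearZ q (t : R) x : sublinear q -> 0 <= t -> q (t *r x) = t * q x.
Proof.
move=> [q0 _ qZ]; rewrite le_eqVlt => /orP[/eqP <-|t0].
  by rewrite rmorph0 scale0r q0 mul0r.
apply/le_anti/andP; split; first exact: qZ.
have ti0 : 0 < t^-1 by rewrite invr_gt0.
have := qZ _ (t *r x) ti0; rewrite rscaleA mulVf ?gt_eqF// rmorph1 scale1r.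
by rewrite ler_pdivlMl.
Qed.

Lemma sublinear_opp q x : sublinear q -> - q (- x) <= q x.
Proof. by move=> [q0 qD _]; have := qD x (- x); rewrite subrr q0; lra. Qed.

(** The common pattern of three infima: along a ray in [tilt], over a chain in Zorn's lemma, and
    over a subspace for the distance to it. *)
Lemma sublinear_inf (E : V -> set R) :
  (forall x, E x !=set0) -> (forall x, has_lbound (E x)) ->
  (forall a, E 0 a -> 0 <= a) -> (exists2 a, E 0 a & a <= 0) ->
  (forall x y a b, E x a -> E y b -> exists2 c, E (x + y) c & c <= a + b) ->
  (forall (t : R) x a, 0 < t -> E x a -> exists2 c, E (t *r x) c & c <= t * a) ->
  sublinear (fun x => inf (E x)).
Proof.
move=> E0 Eb E_ge0 [a0 Ea0 a00] ED EZ; split=> [|x y|t x t0].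
- apply/le_anti/andP; split; first exact: le_trans (ge_inf (Eb 0) Ea0) a00.
  exact: lb_le_inf.
- rewrite -lerBlDr; apply: lb_le_inf => // a Ea; rewrite lerBlDr -lerBlDl.
  apply: lb_le_inf => // b Eb'; rewrite lerBlDl; have [c Ec cab] := ED _ _ _ _ Ea Eb'.
  by apply: le_trans cab; exact: ge_inf.
- rewrite -ler_pdivrMl//; apply: lb_le_inf => // a Ea.
  rewrite ler_pdivrMl//; have [c Ec ca] := EZ _ _ _ t0 Ea.
  by apply: le_trans ca; exact: ge_inf.
Qed.

(* A sublinear functional that admits no smaller one is odd, because tilting it
   along [y] does not change it; an odd sublinear functional is linear. *)
Definition tilt q y x := inf [set q (x + t *r y) - t * q y | t in [set t : R | 0 <= t]].

Lemma tiltP q y : sublinear q ->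
  [/\ sublinear (tilt q y), forall x, tilt q y x <= q x & tilt q y (- y) <= - q y].
Proof.
move=> sq; have [q0 qD qZ] := sq.
have lb x t : 0 <= t -> - q (- x) <= q (x + t *r y) - t * q y.
  move=> t0; rewrite -(sublinearZ y sq t0).
  have := qD (x + t *r y) (- x); rewrite addrAC subrr add0r; lra.
have hlb x : has_lbound [set q (x + t *r y) - t * q y | t in [set t : R | 0 <= t]].
  by exists (- q (- x)) => _ [t /= t0 <-]; exact: lb.
have mem x (t : R) : 0 <= t ->
    [set q (x + t *r y) - t * q y | t in [set t : R | 0 <= t]] (q (x + t *r y) - t * q y).
  by move=> t0; exists t.
split.
- apply: sublinear_inf => // [x|a [t /= t0 <-]|
    |x z _ _ [s /= s0 <-] [t /= t0 <-]|t x _ t0 [s /= s0 <-]].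
  + by eexists; apply: (mem x 0).
  + by have := lb 0 t t0; rewrite oppr0 q0 oppr0.
  + by eexists; [apply: (mem 0 0)|]; rewrite // mul0r subr0 rmorph0 scale0r addr0 q0.
  + eexists; first by apply: (mem _ (s + t)); exact: addr_ge0.
    rewrite rmorphD scalerDl addrACA.
    by have := qD (x + s *r y) (z + t *r y); lra.
  + eexists; first by apply: (mem _ (t * s)); apply: mulr_ge0 => //; exact: ltW.
    rewrite -rscaleA -scalerDr.
    by have := qZ t (x + s *r y) t0; lra.
- move=> x; apply: le_trans (ge_inf (hlb x) (mem x 0 (lexx 0))) _.
  by rewrite mul0r subr0 rmorph0 scale0r addr0.
- apply: le_trans (ge_inf (hlb _) (mem _ 1 ler01)) _.
  by rewrite rmorph1 scale1r addNr q0 mul1r add0r.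
Qed.

Lemma minimal_sublinear_odd q : sublinear q ->
  (forall p, sublinear p -> (forall x, p x <= q x) -> p = q) ->
  forall y, q (- y) = - q y.
Proof.
move=> sq qmin y; have [st lt ty] := tiltP y sq.
rewrite (qmin _ st lt) in ty; apply/le_anti; rewrite ty /=.
by have := sublinear_opp (- y) sq; rewrite opprK.
Qed.

Lemma odd_sublinear_linear q : sublinear q -> (forall y, q (- y) = - q y) ->
  (forall x y, q (x + y) = q x + q y) /\ (forall (t : R) x, q (t *r x) = t * q x).
Proof.
move=> sq qN; have [q0 qD qZ] := sq; split=> [x y|t x].
  apply/le_anti; rewrite qD /=.
  by have := qD (x + y) (- y); rewrite addrK qN; lra.
have [t0|/ltW t0] := leP 0 t; first by rewrite (sublinearZ x sq t0).
have tN : 0 <= - t by rewrite oppr_ge0.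
have := sublinearZ x sq tN; rewrite rmorphN scaleNr qN mulNr.
exact: oppr_inj.
Qed.

Lemma minimal_sublinear_exists p : sublinear p -> exists q,
  [/\ sublinear q, forall x, q x <= p x &
      forall q', sublinear q' -> (forall x, q' x <= q x) -> q' = q].
Proof.
move=> sp; pose U := {q : V -> R | sublinear q /\ forall x, q x <= p x}.
(* Zorn's lemma yields maximal elements, so the order is reversed and the bound of a chain is its
   pointwise infimum. *)
pose rel (q q' : U) : bool := `[< forall x, sval q' x <= sval q x >].
pose p' : U := exist _ p (conj sp (fun x => lexx _)).
have [|q1 q2 q3 /asboolP h1 /asboolP h2|[q1 h1] [q2 h2] /asboolP h /asboolP h'|A tot|] :=
    @Zorn U rel.
- by move=> q; apply/asboolP.
- by apply/asboolP => x; exact: le_trans (h2 x) (h1 x).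
- have e : q1 = q2 by apply/funext => x; apply/le_anti; rewrite h h'.
  by move: h1 {h h'}; rewrite e => h1; congr exist; exact: Prop_irrelevance.
- have [[q0 Aq0]|A0] := pselect (exists u, A u); last first.
    by exists p' => q Aq; case: A0; exists q.
  pose E x := [set sval u x | u in A].
  have Elb x : has_lbound (E x).
    exists (- p (- x)) => _ [q _ <-]; have [sq qp] := svalP q.
    by apply: le_trans (sublinear_opp x sq); rewrite lerN2.
  have sE : sublinear (fun x => inf (E x)).
    apply: sublinear_inf => // [x|a [q _ <-]|
      |x y _ _ [q Aq <-] [r Ar <-]|t x _ t0 [q Aq <-]].
    + by exists (sval q0 x), q0.
    + by have [[-> _ _] _] := svalP q.
    + by exists (sval q0 0); [exists q0|have [[-> _ _] _] := svalP q0].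
    + have [qr|rq] := tot _ _ Aq Ar.
        exists (sval r (x + y)); first by exists r.
        have [[_ rD _] _] := svalP r; apply: le_trans (rD x y) _.
        by rewrite lerD2r; move/asboolP: qr.
      exists (sval q (x + y)); first by exists q.
      have [[_ qD _] _] := svalP q; apply: le_trans (qD x y) _.
      by rewrite lerD2l; move/asboolP: rq.
    + exists (sval q (t *r x)); first by exists q.
      by have [[_ _ qZ] _] := svalP q; exact: qZ.
  have Ep x : inf (E x) <= p x.
    have [_ q0p] := svalP q0; apply: le_trans (q0p x).
    by apply: ge_inf => //; exists q0.
  exists (exist (fun q => sublinear q /\ forall x, q x <= p x) _ (conj sE Ep)).
  move=> u Au; apply/asboolP => x /=.
  by apply: ge_inf => //; exists u.
move=> [q [sq qp]] qmin; exists q; split=> // q' sq' q'q.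
have q'p x : q' x <= p x by exact: le_trans (q'q x) (qp x).
pose u' : U := exist (fun q => sublinear q /\ forall x, q x <= p x) q' (conj sq' q'p).
suff /(congr1 sval) : u' = exist _ q (conj sq qp) by [].
by apply: qmin; apply/asboolP.
Qed.

Variables (nm : V -> R) (M : set V).
Hypotheses (nm_pos : forall x, 0 <= nm x) (nm_zero : nm 0 = 0).
Hypotheses (nm_sub : forall x y, nm (x + y) <= nm x + nm y)
  (nm_scale : forall c x, nm (c *: x) <= normc c * nm x).
Hypotheses (M0 : M 0) (ML : forall c x y, M x -> M y -> M (c *: x + y)).

Lemma hahn_banach_separation y0 (d : R) : 0 < d -> (forall m, M m -> d <= nm (y0 - m)) ->
  exists f : V -> R[i], [/\ linear (f : V -> R[i]^o), forall m, M m -> f m = 0,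
    f y0 <> 0 & forall x, normc (f x) <= 2%:R * nm x].
Proof.
move=> d0 y0M.
pose p x := inf [set nm (x - m) | m in M].
have hlb x : has_lbound [set nm (x - m) | m in M].
  by exists 0 => _ [m _ <-].
have MZ c m : M m -> M (c *: m) by move=> Mm; rewrite -[_ *: _]addr0; exact: ML.
have MD m m' : M m -> M m' -> M (m + m') by move=> Mm Mm'; rewrite -[m]scale1r; exact: ML.
have sp : sublinear p.
  apply: sublinear_inf => // [x|a [m _ <-] //|
    |x y _ _ [m Mm <-] [m' Mm' <-]|t x _ t0 [m Mm <-]].
  - by exists (nm (x - 0)), 0.
  - by exists (nm (0 - 0)); [exists 0|rewrite subrr nm_zero].
  - exists (nm (x + y - (m + m'))); first by exists (m + m') => //; exact: MD.
    by rewrite opprD addrACA.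
  - exists (nm (t *r x - t *r m)); first by exists (t *r m) => //; exact: MZ.
    by rewrite -scalerBr; apply: le_trans (nm_scale _ _) _; rewrite normcR ger0_norm// ltW.
have p_nm x : p x <= nm x.
  by apply: ge_inf => //; exists 0; rewrite ?subr0.
have pM m : M m -> p m <= 0.
  by move=> Mm; apply: ge_inf => //; exists m; rewrite ?subrr.
have py0 : d <= p y0.
  by apply: lb_le_inf => [|_ [m Mm <-]]; [exists (nm (y0 - 0)), 0|exact: y0M].
(* Tilting the distance p along y0 before minimizing forces q(-y0) <= -p(y0), hence q(y0) >= d. *)
have [st lt ty] := tiltP y0 sp.
have [q [sq qt qmin]] := minimal_sublinear_exists st.
have qN := minimal_sublinear_odd sq qmin.
have [qD qZ] := odd_sublinear_linear sq qN.
have qy0 : d <= q y0.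
  by have := qt (- y0); rewrite qN; move: ty py0; lra.
have q_nm x : q x <= nm x by apply: le_trans (qt x) _; exact: le_trans (lt x) (p_nm x).
have nm_opp x : nm (- x) <= nm x.
  by rewrite -scaleN1r; apply: le_trans (nm_scale _ _) _; rewrite normcN Normc.normc1 mul1r.
have q_abs x : `|q x| <= nm x.
  rewrite ler_norml q_nm andbT lerNl -qN; exact: le_trans (q_nm _) (nm_opp _).
have qM m : M m -> q m = 0.
  have le m' : M m' -> q m' <= 0.
    by move=> Mm'; apply: le_trans (qt _) _; apply: le_trans (lt _) _; exact: pM.
  move=> Mm; apply/le_anti; rewrite le//= -oppr_le0 -qN -scaleN1r.
  by apply: le; exact: MZ.
(* The complex form whose real part is the real linear q; the factor 2 comes from bounding the
   modulus by real and imaginary parts. *)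
pose f x : R[i] := Complex (q x) (- q ('i%C *: x)).
exists f; split=> [c x y|m Mm|fy|x].
- have cE z : c *: z = (Re c) *r z + (Im c) *r ('i%C *: z).
    by rewrite scalerA -scalerDl {1}[c]complexE [_ * 'i%C]mulrC.
  have qc z : q (c *: z) = Re c * q z + Im c * q ('i%C *: z) by rewrite cE qD !qZ.
  have ii z : 'i%C *: ('i%C *: z) = - z by rewrite scalerA -expr2 sqr_i scaleN1r.
  rewrite /f scalerDr scalerA mulrC -scalerA !qD !qc ii qN.
  apply/eqP; rewrite eq_complex; case: (c) => a b /=.
  by apply/andP; split; apply/eqP; ring.
- by rewrite /f qM// qM ?oppr0//; exact: MZ.
- by have := congr1 (@complex.Re R) fy; rewrite /= => qy; rewrite qy in qy0; lra.
- apply: le_trans (normc_le_ReIm _) _; rewrite /= normrN mulr_natl mulr2n.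
  apply: lerD => //; apply: le_trans (q_abs _) _; apply: le_trans (nm_scale _ _) _.
  by rewrite /= expr0n expr1n add0r sqrtr1 mul1r.
Qed.

End HahnBanach.

(** * Dual maps and the main theorem *)

Section DualMaps.
Variables (R : realType) (S T : opspace R) (phi : CCp S T).
Local Notation SS := (smos_of_opspace S).
Local Notation TT := (smos_of_opspace T).

Lemma theta_dual_map n (f : 'M[dualT TT]_n) :
  theta (map_mx (dual_map phi) f) = theta f \o val phi.
Proof. by apply/funext => x; apply/matrixP => i j; rewrite !mxE. Qed.

Lemma dual_map_CCw : CCw (dual_wsmos TT) (dual_wsmos SS) (dual_map phi).
Proof.
have [lphi [sphi pphi] cphi] := set_valP phi.
have dstar (f : dualT TT) : dual_map phi (dual_star f) = dual_star (dual_map phi f).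
  by apply: dualT_eqP => x; rewrite /= sphi.
split; first split.
- by move=> a f g; apply: dualT_eqP.
- split=> // n f [fs [ts tp]]; split.
    by apply/matrixP => i j; rewrite -[in RHS]fs !mxE dstar.
  rewrite theta_dual_map; split=> [x|m x xp]; first by rewrite /= sphi ts.
  by rewrite -map_mx_compE; exact/tp/pphi.
- move=> n f; apply: (@dual_mnorm_le R S n (map_mx (dual_map phi) f)) => m X X1.
  rewrite theta_dual_map -map_mx_compE; apply: dual_mnorm_ub.
  exact: le_trans (cphi _ _) X1.
apply: wstar_continuousP => _ [x _ <-].
by apply: (@predual_continuous R (dual_wsmos TT)); exists (val phi x).
Qed.

Hypothesis T_au : approx_unital T.

Lemma dmap_exists : exists psi : CCw (ddual TT) (ddual SS), is_dmap phi psi.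
Proof.
have mu_inj : injective (@mu R (dual_wsmos TT)).
  by move=> f g fg; apply: (mu_dual_inj T_au); exact: val_inj.
have [psi psiC psiE] := mu_image_lift dual_map_CCw mu_inj.
by exists (SigSub (mem_set psiC)) => f; exact: psiE.
Qed.

End DualMaps.

Lemma dmap_unique (R : realType) (S T : opspace R) (phi : CCp S T)
    (psi psi' : CCw (ddual T) (ddual S)) :
  is_dmap phi psi -> is_dmap phi psi' -> psi = psi'.
Proof.
move=> h h'; apply: val_inj; apply/funext => y.
by have [f <-] := mu_dual_surj y; rewrite h h'.
Qed.

Section Isomorphisms.
Variables (R : realType) (X Y : smos_data R) (f : X -> Y) (g : Y -> X).

(** [corder_mono] compares the cones only on selfadjoint matrices, hence the hypothesis on the cone
    of X. *)
Lemma mos_iso_CCp : mos_iso X Y f -> cisometric X Y f ->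
  (forall n (x : 'M[X]_n), mcone X n x -> selfadjoint x) -> CCp X Y f.
Proof.
move=> [lf _ [sf _ pf] _] cf Xs; split=> //.
  by split=> // n x xp; apply/pf => //; exact: Xs.
by move=> n x; rewrite cf.
Qed.

Hypotheses (fK : cancel f g) (gK : cancel g f).

Lemma map_mxK n (x : 'M[X]_n) : map_mx g (map_mx f x) = x.
Proof. by apply/matrixP => i j; rewrite !mxE fK. Qed.

Lemma map_mxKV n (y : 'M[Y]_n) : map_mx f (map_mx g y) = y.
Proof. by apply/matrixP => i j; rewrite !mxE gK. Qed.

Lemma mos_iso_inv_CCp : mos_iso X Y f -> cisometric X Y f ->
  (forall n (y : 'M[Y]_n), mcone Y n y -> selfadjoint y) -> CCp Y X g.
Proof.
move=> [lf _ [sf finj pf] _] cf Ys.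
have sg y : g (star y) = star (g y) by apply: finj; rewrite gK sf gK.
split.
- by move=> a y z; apply: finj; rewrite lf !gK.
- split=> // n y yp; apply/pf; last by rewrite map_mxKV.
  by rewrite /selfadjoint -[in RHS](Ys _ _ yp); apply/matrixP => i j; rewrite !mxE sg.
- by move=> n y; rewrite -cf map_mxKV.
Qed.

Lemma CCp_mos_iso : CCp X Y f -> CCp Y X g -> mos_iso X Y f /\ cisometric X Y f.
Proof.
move=> [lf [sf pf] cf] [_ [_ pg] cg].
have iso : cisometric X Y f.
  move=> n x; apply/le_anti; rewrite cf /=.
  by have := cg _ (map_mx f x); rewrite map_mxK.
split=> //; split=> //; first by exists g.
  split=> //; first exact: can_inj fK.
  by move=> n x _; split=> [|/pg]; [exact: pf|rewrite map_mxK].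
split; first by exists 1 => n x; rewrite mul1r iso.
by exists 1 => // n x x1; rewrite iso x1.
Qed.

End Isomorphisms.

Lemma opspace_mcone_selfadjoint (R : realType) (S : opspace R) n
    (x : 'M[smos_of_opspace S]_n) : mcone S n x -> selfadjoint x.
Proof. by case. Qed.

Lemma ddual_mcone_selfadjoint (R : realType) (S : smos_data R) n
    (y : 'M[ddual S]_n) : mcone (ddual S) n y -> selfadjoint y.
Proof.
move=> yp; apply/matrixP => i j; apply: val_inj; apply: ND_eqP => k.
have [/matrixP/(_ i j) + _] := yp k.
by rewrite !mxE.
Qed.

(** * Bijectivity of the dual assignment and recovery of isomorphisms *)

Section Recovery.
Variables (R : realType) (S T : opspace R).
Local Notation SS := (smos_of_opspace S).
Local Notation TT := (smos_of_opspace T).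
Hypotheses (S_au : approx_unital S) (T_au : approx_unital T).
Hypothesis S_complete : norm_complete (fun x : S => nrm (x : SS)).
Hypothesis T_complete : norm_complete (fun x : T => nrm (x : TT)).

Lemma mu_dual_lift (S' T' : opspace R) (psi : ddual T' -> ddual S') :
  exists G : dualT T' -> dualT S', forall f, mu_dual (G f) = psi (mu_dual f).
Proof.
by have /choice[G GE] := fun f : dualT T' => mu_dual_surj (psi (mu_dual f)); exists G.
Qed.

Lemma dmap_surj (psi : CCw (ddual TT) (ddual SS)) : exists phi : CCp SS TT, is_dmap phi psi.
Proof.
have [psiC psiW] := set_valP psi.
have [G GE] := mu_dual_lift (val psi).
have [phi phiE] := transpose_exists S_au T_complete (set_valP psi) GE.
have phiC := transpose_CCp S_au psiC GE phiE.
exists (SigSub (mem_set phiC)) => f; rewrite -GE; congr mu_dual.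
by apply: dualT_eqP => x; rewrite phiE.
Qed.

Lemma dmap_inj (phi phi' : CCp SS TT) (psi : CCw (ddual TT) (ddual SS)) :
  is_dmap phi psi -> is_dmap phi' psi -> phi = phi'.
Proof.
move=> h h'; apply: val_inj; apply/funext => x; apply: vector_functional_sep => f.
have := h f; rewrite h' => /(mu_dual_inj S_au) /(congr1 (fun g : dualT SS => g x)) /= e.
by rewrite e.
Qed.

Section InverseTranspose.
Variables (psi : ddual TT -> ddual SS) (psi' : ddual SS -> ddual TT).
Variables (G : dualT TT -> dualT SS) (G' : dualT SS -> dualT TT) (phi : SS -> TT).
Hypotheses (psiK : cancel psi psi') (psiKV : cancel psi' psi).
Hypotheses (psiC : CCp (ddual TT) (ddual SS) psi) (psi'C : CCp (ddual SS) (ddual TT) psi').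
Hypotheses (GE : forall f, mu_dual (G f) = psi (mu_dual f))
  (G'E : forall h, mu_dual (G' h) = psi' (mu_dual h)).
Hypothesis Gphi : forall f x, G f x = f (phi x).

Lemma liftK : cancel G G'.
Proof. by move=> f; apply: (mu_dual_inj T_au); rewrite G'E GE psiK. Qed.

Lemma liftKV : cancel G' G.
Proof. by move=> f; apply: (mu_dual_inj S_au); rewrite GE G'E psiKV. Qed.

(** A functional h on S is G (G' h), so h(x) = (G' h)(phi x), and G' is bounded by 4. *)
Lemma transpose_bounded_below x : nrm (x : SS) <= 4%:R * nrm (phi x).
Proof.
apply: nrm_le_functionals => [|h]; first by rewrite mulr_ge0 ?nrm_ge0.
by rewrite -{1}(liftKV h) Gphi mulrAC (lift_bound T_au psi'C G'E).
Qed.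

(** Since psi' is not known to be weak-* continuous, [transpose_exists] does not apply to it.
    Instead the range of phi is dense by separation, and closed since phi is bounded below and S is
    complete. *)
Lemma transpose_surj y : exists x, phi x = y.
Proof.
have lphi := transpose_linear Gphi.
have [_ _ phi_contr] := transpose_CCp S_au psiC GE Gphi.
have phiB x x' : phi (x - x') = phi x - phi x'.
  by have := lphi (-1) x' x; rewrite !scaleN1r => e; rewrite [x - x']addrC e addrC.
have phi_nrm x : nrm (phi x) <= nrm (x : SS).
  by have := phi_contr 1%N (const_mx x); rewrite map_const_mx.
have [[d d0 yd]|far] := pselect (exists2 d : R, 0 < d & forall x, d <= nrm (y - phi x : TT)).
  pose M : set T := [set z | exists x, phi x = z].
  have M0 : M 0 by exists 0; exact: linear0.
  have ML c z z' : M z -> M z' -> M (c *: z + z').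
    by move=> [x <-] [x' <-]; exists (c *: x + x'); exact: lphi.
  have [_ [x <-]|f [lf fphi fy f_le]] := hahn_banach_separation (@nrm_ge0 R T) (@nrm0 R T)
      (@nrmD R T) (@nrmZ_le R T) M0 ML d0 (y0 := y); first exact: yd.
  have fT : (f : TT -> R[i]^o) \in @functional R TT by apply/asboolP; split=> //; exists 2%:R.
  (* A functional that vanishes on the range of phi is killed by G, hence equal to G' 0 = 0. *)
  case: fy; rewrite -[f y]/(DualT fT y) -(liftK (DualT fT)).
  have -> : G (DualT fT) = 0.
    by apply: dualT_eqP => x; rewrite Gphi /= fphi//; exists x.
  rewrite (_ : G' 0 = 0)//; apply: (mu_dual_inj T_au).
  have [lpsi' _ _] := psi'C.
  by rewrite G'E !(linear0 (@mu_dual_linear R _)) (linear0 lpsi').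
have /choice[x xP] : forall n, exists x, nrm (y - phi x : TT) < n.+1%:R^-1.
  move=> n; apply/not_existsP => yx; apply: far.
  exists n.+1%:R^-1 => [|x]; first by rewrite invr_gt0 ltr0n.
  by rewrite leNgt; apply/negP/yx.
have x_lim e : 0 < e -> exists N, forall n, (N <= n)%N -> nrm (y - phi (x n) : TT) < e.
  move=> e0; have [N Ne] := ltr_add_invr e0.
  exists N => n Nn; apply: lt_le_trans (xP n) _; apply: ltW.
  move: Ne; rewrite add0r; apply: le_lt_trans.
  by rewrite lef_pV2 ?posrE ?ltr0n// ler_nat.
have [e e0|l lP] := @S_complete x.
  have e8 : 0 < e / 8%:R by rewrite divr_gt0.
  have [N xN] := x_lim _ e8; exists N => m n Nm Nn.
  apply: le_lt_trans (transpose_bounded_below _) _.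
  have -> : phi (x m - x n) = (y - phi (x n)) - (y - phi (x m)).
    by rewrite phiB opprB [RHS]addrC subrKA.
  have := nrmD (y - phi (x n)) (- (y - phi (x m))); rewrite nrmN.
  have := xN m Nm; have := xN n Nn; lra.
exists l; apply/eqP; rewrite -subr_eq0; apply/eqP; apply: nrm_eq0; apply/le_anti.
rewrite nrm_ge0 andbT; apply/ler_addgt0Pl => e e0; rewrite addr0.
have e20 : 0 < e / 2%:R by rewrite divr_gt0.
have [N xN] := x_lim _ e20; have [N' lN] := lP _ e20.
have := xN _ (leq_maxl N N'); have := lN _ (leq_maxr N N'); set k := maxn N N' => h h'.
have -> : phi l - y = - (phi (x k - l)) - (y - phi (x k)).
  by rewrite phiB !opprB subrKA.
apply: le_trans (nrmD _ _) _; rewrite !nrmN.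
by have := phi_nrm (x k - l); lra.
Qed.

(** The inverse of phi is a transpose of G', so [transpose_CCp] applies to it as well and improves
    the constant 4 to 1. *)
Lemma transpose_inverse_CCp : exists2 phi' : TT -> SS, CCp TT SS phi' &
  cancel phi phi' /\ cancel phi' phi.
Proof.
have /choice[phi' phiK'] := transpose_surj.
have phi'C : CCp TT SS phi'.
  apply: (transpose_CCp T_au psi'C G'E) => h y.
  by rewrite -{2}(liftKV h) Gphi phiK'.
exists phi' => //; split=> // x; apply: vector_functional_sep => h.
by rewrite -(liftKV h) !Gphi phiK'.
Qed.

End InverseTranspose.
End Recovery.

(** The two kinds of spaces enter the main argument only through these two properties. *)
Lemma good_operator_system (R : realType) (S : operator_system R) :
  cstar_algebra S \/ (unital_opsys S /\ complete_opsys S) ->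
  approx_unital S /\ norm_complete (fun x : S => nrm (x : smos_of_opspace S)).
Proof.
move=> [[mul [nm A]]|[Su Sc]].
  by split; [exact: cstar_approx_unital A|exact: cstar_complete A].
by split; [exact: unital_approx_unital|].
Qed.

Lemma dmap_inverse (R : realType) (S T : opspace R) (f : CCp S T) (g : CCp T S)
    (psi : CCw (ddual T) (ddual S)) (chi : CCw (ddual S) (ddual T)) :
  is_dmap f psi -> is_dmap g chi -> cancel (val g) (val f) -> cancel (val psi) (val chi).
Proof.
move=> fpsi gchi gK y; have [h <-] := mu_dual_surj y.
by rewrite fpsi gchi; congr mu_dual; apply: dualT_eqP => x; rewrite /= gK.
Qed.

Theorem corollary3p18 (R : realType) (S T : operator_system R)
  (hS : cstar_algebra S \/ (unital_opsys S /\ complete_opsys S))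
  (hT : cstar_algebra T \/ (unital_opsys T /\ complete_opsys T)) :
  [/\ forall phi : CCp S T, exists! psi : CCw (ddual T) (ddual S), is_dmap phi psi,
      exists d : CCp S T -> CCw (ddual T) (ddual S),
        (forall phi, is_dmap phi (d phi)) /\ bijective d
    & (exists phi : S -> T, mos_iso S T phi /\ cisometric S T phi) <->
      (exists psi : ddual T -> ddual S,
         [/\ mos_iso (ddual T) (ddual S) psi, cisometric (ddual T) (ddual S) psi
           & wstar_continuous (ddual T) (ddual S) psi])].
Proof.
have [S_au S_complete] := good_operator_system hS.
have [T_au T_complete] := good_operator_system hT.
split.
- move=> phi; have [psi phipsi] := dmap_exists phi T_au.
  by exists psi; split=> // psi'; exact: dmap_unique.
- have /choice[d dP] := fun phi : CCp S T => dmap_exists phi T_au.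
  have /choice[c cP] := fun psi => dmap_surj S_au T_complete psi.
  exists d; split=> //; exists c => [phi|psi].
    exact: (dmap_inj S_au (cP (d phi)) (dP phi)).
  exact: (dmap_unique (dP (c psi)) (cP psi)).
split.
- move=> [phi [phi_iso phi_isom]].
  have [_ [phi' phiK phiKV] _ _] := phi_iso.
  have phiC := mos_iso_CCp phi_iso phi_isom (@opspace_mcone_selfadjoint R S).
  have phi'C := mos_iso_inv_CCp phiKV phi_iso phi_isom (@opspace_mcone_selfadjoint R T).
  pose f : CCp S T := SigSub (mem_set phiC); pose g : CCp T S := SigSub (mem_set phi'C).
  have [psi fpsi] := dmap_exists f T_au; have [chi gchi] := dmap_exists g S_au.
  have psiK : cancel (val psi) (val chi) by exact: (dmap_inverse fpsi gchi).
  have chiK : cancel (val chi) (val psi) by exact: (dmap_inverse gchi fpsi).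
  have [psiC psiW] := set_valP psi; have [chiC _] := set_valP chi.
  have [psi_iso psi_isom] := CCp_mos_iso psiK chiK psiC chiC.
  by exists (val psi).
move=> [psi [psi_iso psi_isom psiW]].
have [_ [psi' psiK psiKV] _ _] := psi_iso.
have psiC := mos_iso_CCp psi_iso psi_isom (@ddual_mcone_selfadjoint R T).
have psi'C := mos_iso_inv_CCp psiKV psi_iso psi_isom (@ddual_mcone_selfadjoint R S).
have [G GE] := mu_dual_lift psi; have [G' G'E] := mu_dual_lift psi'.
have [phi phiE] := transpose_exists S_au T_complete (conj psiC psiW) GE.
have phiC := transpose_CCp S_au psiC GE phiE.
have [phi' phi'C [phiK phiKV]] :=
  transpose_inverse_CCp S_au T_au S_complete psiK psiKV psiC psi'C GE G'E phiE.
by exists phi; exact: CCp_mos_iso phiK phiKV phiC phi'C.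
Qed.
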